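(* Let $(\lambda^{(N)})_{N\ge1}$ be a sequence of integer partitions and $(m^{(N)})_{N\ge 1}$ a sequence of positive integers with $\ell(\lambda^{(N)})<m^{(N)}$ for all $N$. Write $\lambda=\lambda^{(N)}$, $m=m^{(N)}$, $n=|\lambda|$, and suppose $n/m\to\infty$ in such a way that $\lambda_1/m^3\to\infty$ as $N\to\infty$. Let $\mathbf t(\lambda)=(t_1,\dots,t_m)$ with $t_j=\lambda_j/\lambda_1$ (where $\lambda_j=0$ for $j>\ell(\lambda)$), let $\Delta\mathbf t(\lambda)=\{t_i-t_j:1\le i<j\le m\}$ be its distance multiset, and let $\widehat{\Delta\mathbf t(\lambda)}=\sqrt{12}\,\Delta\mathbf t(\lambda)/|\Delta\mathbf t(\lambda)|_2$. Then for each fixed $d\ge 2$ the standardized cumulants satisfy $$(\kappa_d^{\lambda;m})^*\sim \frac{B_d}{d}\,\big|\widehat{\Delta\mathbf t(\lambda)}\big|_d^d=\kappa_d^{\mathcal S_{\widehat{\Delta\mathbf t(\lambda)}}}.$$ Moreover: (i) If $m$ is bounded, then $\mathcal X_{\lambda;m}[\mathrm{rank}]^*$ converges in distribution if and only if the multisets $\widehat{\Delta\mathbf t(\lambda)}$ converge pointwise to some multiset $\mathbf d$, in which case the limiting distribution is $\mathcal S_{\mathbf d}$ and $\mathbf d\in\mathbf P_{\mathrm{DIST}}$. (ii) $m\to\infty$ if and only if $\mathcal X_{\lambda;m}[\mathrm{rank}]^*$ is asymptotically normal (converges in distribution to $\mathcal N(0,1)$).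
   Context: A semistandard tableau of shape $\lambda$ with entries at most $m$ is a filling of the Young diagram of $\lambda$ with integers in $\{1,\dots,m\}$, weakly increasing along rows and strictly increasing down columns; $\mathrm{SSYT}_{\le m}(\lambda)$ is the set of these. If $\alpha_i$ is the number of entries equal to $i$ in $T$, then $\mathrm{rank}(T)=\sum_{i\ge1}(i-1)\alpha_i$. $\mathcal X_{\lambda;m}[\mathrm{rank}]$ is the random variable $\mathrm{rank}(T)$ for $T$ uniform in $\mathrm{SSYT}_{\le m}(\lambda)$, and $\kappa_d^{\lambda;m}$ is its $d$-th cumulant. For a random variable $\mathcal X$ with mean $\mu$ and standard deviation $\sigma>0$, $\mathcal X^*=(\mathcal X-\mu)/\sigma$, whose cumulants are $\kappa_d/\kappa_2^{d/2}$ for $d\ge 2$. $B_d$ denotes the $d$-th Bernoulli number. For $p\ge1$ and a sequence $\mathbf t$ of nonnegative reals, $|\mathbf t|_p=(\sum_k t_k^p)^{1/p}$. Multisets of nonnegative reals are identified with weakly decreasing sequences $t_1\ge t_2\ge\cdots\ge0$ padded with zeros; pointwise convergence refers to these sequences in $\mathbb R^{\mathbb N}$. For such $\mathbf t$ with $|\mathbf t|_2<\infty$, $\mathcal S_{\mathbf t}=\sum_k \mathcal U[-t_k/2,t_k/2]$ is the (almost surely convergent) sum of independent continuous uniform random variables. For a multiset $\mathbf t=\{t_1\ge\cdots\ge t_m\}$, its distance multiset is $\Delta\mathbf t=\{t_i-t_j:1\le i<j\le m\}$; for $\mathbf t$ with $0<|\mathbf t|_2<\infty$, $\widehat{\mathbf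 t}=\sqrt{12}\,\mathbf t/|\mathbf t|_2$. $\mathbf P_{\mathrm{DIST}}=\{\widehat{\Delta\mathbf t}:\mathbf t=\{1=t_1\ge\cdots\ge t_m=0\},\ m\ge2\}$. Statements about sequences refer to $N\to\infty$. *)

(* Defs.v *)
From HB Require Import structures.
From mathcomp Require Import all_boot all_order all_algebra.
From mathcomp Require Import finmap.
From mathcomp Require Import all_classical all_reals all_analysis.
From mathcomp Require Import measurable_realfun.

Set Implicit Arguments.
Unset Strict Implicit.
Unset Printing Implicit Defensive.

Import Order.TTheory GRing.Theory Num.Theory.
Import numFieldNormedType.Exports.

Local Open Scope classical_set_scope.
Local Open Scope ring_scope.

(* Partitions: rows are numbered from 0, so lambda_j is [nth 0 la j.-1] and
   the number of parts is [size la]. *)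
Definition is_partition (la : seq nat) : bool :=
  sorted geq la && (0%N \notin la).

(* A cell is a row index together with a column index in that row. *)
Definition cell (la : seq nat) := {i : 'I_(size la) & 'I_(nth 0%N la i)}.

Definition row_of (la : seq nat) (c : cell la) : nat := tag c.
Definition col_of (la : seq nat) (c : cell la) : nat := tagged c.

(* Fillings with values in {0, ..., m}; the value 0 is excluded by [is_ssyt]. *)
Definition filling (la : seq nat) (m : nat) := {ffun cell la -> 'I_m.+1}.

HB.instance Definition _ la m := Finite.on (filling la m).
HB.instance Definition _ la m :=
  isPointed.Build (filling la m) [ffun=> ord0].
HB.instance Definition _ la m := @isMeasurable.Build default_measure_display
  (filling la m) discrete_measurable discrete_measurable0
  discrete_measurableC discrete_measurableU.

Definition is_ssyt (la : seq nat) (m : nat) (T : filling la m) : bool :=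
  [&& [forall c, (0 < T c)%N],
      [forall c, forall c', (row_of c == row_of c') && (col_of c < col_of c')%N
                            ==> (T c <= T c')%N]
    & [forall c, forall c', (col_of c == col_of c') && (row_of c < row_of c')%N
                            ==> (T c < T c')%N]].

Definition SSYT (la : seq nat) (m : nat) : set (filling la m) :=
  [set T | is_ssyt T].
Arguments SSYT : clear implicits.

Lemma measurable_SSYT la m : measurable (SSYT la m).
Proof. by []. Qed.

Definition content (la : seq nat) (m : nat) (T : filling la m) (i : nat) : nat :=
  #|[pred c | T c == i :> nat]|.

Definition rank (la : seq nat) (m : nat) (T : filling la m) : nat :=
  (\sum_(1 <= i < m.+1) (i - 1) * content T i)%N.

Section rank_variable.
Variables (R : realType) (la : seq nat) (m : nat).

(* The default [dirac point] is only used when there is no semistandard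
   tableau, which does not happen for a partition with at most m parts. *)
Definition ssyt_prob : probability (filling la m) R :=
  mnormalize (mrestr (@counting (filling la m) R) (measurable_SSYT la m))
             (dirac point).

Definition rank_fun (T : filling la m) : R := (rank T)%:R.

Lemma measurable_rank_fun : measurable_fun [set: filling la m] rank_fun.
Proof. by []. Qed.

HB.instance Definition _ :=
  isMeasurableFun.Build _ _ _ _ rank_fun measurable_rank_fun.

Definition rank_var : {RV ssyt_prob >-> R} := rank_fun.

End rank_variable.

Section random_variables.
Context (R : realType) (dp : measure_display) (T : measurableType dp)
  (P : probability T R).

Definition standardize_fun (X : {RV P >-> R}) (w : T) : R :=
  (X w - fine 'E_P[X]) / Num.sqrt (fine 'V_P[X]).

Lemma measurable_standardize_fun (X : {RV P >-> R}) :
  measurable_fun [set: T] (standardize_fun X).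
Proof.
apply: measurable_funM; last exact: measurable_cst.
by apply: measurable_funB; [exact: measurable_funP|exact: measurable_cst].
Qed.

HB.instance Definition _ (X : {RV P >-> R}) :=
  isMeasurableFun.Build _ _ _ _ (standardize_fun X)
    (measurable_standardize_fun X).

Definition standardize (X : {RV P >-> R}) : {RV P >-> R} := standardize_fun X.

(* The coefficient of t^d / d! in log E[exp(tX)]. *)
Definition cumulant (d : nat) (X : {RV P >-> R}) : R :=
  derive1n d (fun t : R => ln (fine ('M_P X t))) 0.

Definition mutually_independent (U : nat -> {RV P >-> R}) : Prop :=
  forall (J : {fset nat}) (B : nat -> set R), (forall k, measurable (B k)) ->
    P (\bigcap_(k in [set` J]) (U k @^-1` B k)) =
    (\prod_(k <- J) P (U k @^-1` B k))%E.

End random_variables.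

(* The uniform law on [a, b]; for a = b it is the point mass at a. *)
Definition unif_law (R : realType) (a b : R) : set R -> \bar R :=
  if pselect (a < b) is left ab then uniform_prob ab else dirac a.

(* [is_unif_sum t S]: S is a realization of the random variable
   S_t = sum_k U[-t_k/2, t_k/2], whose law depends only on t. *)
Definition is_unif_sum (R : realType) (t : R^nat) (dp : measure_display)
    (T : measurableType dp) (P : probability T R) (S : {RV P >-> R}) : Prop :=
  exists U : nat -> {RV P >-> R},
    [/\ mutually_independent U,
        forall k (A : set R), measurable A ->
          distribution P (U k) A = unif_law (- (t k / 2)) (t k / 2) A
      & {ae P, forall w, series (fun k => U k w) @ \oo --> S w}].

(* Convergence in distribution to the law [nu]: the distribution functions
   converge at every continuity point of the distribution function of [nu]. *)
Definition cvg_in_law (R : realType) (dp : nat -> measure_display)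
    (T : forall N, measurableType (dp N)) (P : forall N, probability (T N) R)
    (X : forall N, {RV (P N) >-> R})
    (nu : set R -> \bar R) : Prop :=
  forall x : R, {for x, continuous (fun y : R => nu `]-oo, y]%classic)} ->
    cdf (X N) x @[N --> \oo] --> nu `]-oo, x]%classic.

(* B_n is determined by sum_(k <= n) C(n+1, k) B_k = [n = 0]. *)
Fixpoint bernoulli_seq (F : fieldType) (n : nat) : seq F :=
  if n is n'.+1 then
    let s := bernoulli_seq F n' in
    rcons s (((n' == 0%N)%:R - \sum_(k < n') 'C(n'.+1, k)%:R * s`_k) / n'.+1%:R)
  else [::].

Definition bernoulli (F : fieldType) (n : nat) : F := (bernoulli_seq F n.+1)`_n.

Section multisets.
Variable R : realType.

Definition is_multiset (t : R^nat) : Prop :=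
  (forall k, 0 <= t k) /\ (forall k, t k.+1 <= t k).

(* The weakly decreasing sequence, padded with zeros, of a finite multiset. *)
Definition multiset (s : seq R) : R^nat := nth 0 (sort >=%R s).

Definition pnorm (p : R) (t : R^nat) : \bar R :=
  ((\sum_(0 <= k <oo) (t k `^ p)%:E) `^ p^-1)%E.

Definition hat (t : R^nat) : R^nat :=
  fun k => Num.sqrt 12 * t k / fine (pnorm 2 t).

Definition distance_multiset (t : seq R) : seq R :=
  [seq t`_i - t`_j | j <- iota 0 (size t), i <- iota 0 j].

Definition hat_dist (t : seq R) : R^nat := hat (multiset (distance_multiset t)).

Definition P_DIST : set R^nat :=
  [set d | exists t : seq R,
     [/\ (2 <= size t)%N, sorted >=%R t, t`_0 = 1, t`_(size t).-1 = 0
       & d = hat_dist t]].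

Definition t_of_partition (la : seq nat) (m : nat) : seq R :=
  [seq (nth 0%N la j)%:R / (nth 0%N la 0)%:R | j <- iota 0 m].

End multisets.

(* Main.v *)
(* Peeling off the largest entries of a semistandard tableau (the sums over
   interlacing shapes are the row operations of a Vandermonde determinant) shows
   that the generating function of the rank is, up to a monomial, the product over
   i < j of [l_i - l_j + j - i]_q / [j - i]_q, where l is the partition.  At
   q = e^s a q-integer [a]_q is an exponential times a multiple of
   h(as) = sinh(as/2) / (as/2), the moment generating function of
   U[-a/2, a/2], and log h has Taylor coefficients B_d / d.  Hence the d-th
   cumulant of the rank is B_d / d times the sum of
   (l_i - l_j + j - i)^d - (j - i)^d, while the cumulants of S_t are B_d / d times
   the power sums of t; since l_1 / m^3 tends to infinity the shifts j - i are
   negligible.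

   Uniformly bounded moment generating functions turn convergence of cumulants
   into convergence of moments, then of trigonometric polynomials in the variable,
   and these approximate indicator functions of half-lines.  For the converse
   directions, rescaled distance multisets converge along every ultrafilter when m
   is bounded, and the limit is determined by the limit law because the cumulants
   of even order give all even power sums (even Bernoulli numbers do not vanish).
   For m tending to infinity the entries of the rescaled distance multiset tend to
   0 uniformly, so that its power sums of order d > 2 vanish in the limit. *)

Require Import Defs.
From HB Require Import structures.
From mathcomp Require Import all_boot all_order all_algebra.
From mathcomp Require Import fingroup perm finmap.
From mathcomp Require Import all_classical all_reals all_analysis.
From mathcomp Require Import measurable_realfun ring lra zify.

Set Implicit Arguments.
Unset Strict Implicit.
Unset Printing Implicit Defensive.

Import Order.TTheory GRing.Theory Num.Theory.
Import numFieldNormedType.Exports.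

Local Open Scope ring_scope.

(** * The generating function of the rank *)

(** The constant and the monomial in front of the product formula are never computed: the value 1 at
    s = 0 fixes the constant, and centring removes the monomial. The third power of m arises as
    follows. Replacing l_i - l_j + j - i by l_i - l_j in a power sum costs O(m l_1^(d-1)) for each
    of at most m^2 pairs, while the power sum itself is at least l_1^d, since the last of the m
    parts is 0. The uniform bound e^(12 s^2) on the moment generating functions comes from the
    product formula too: its denominators are at least 1 and its numerators are subgaussian. The
    passages to the limit are stated for proper filters, so that they apply along ultrafilters,
    where the missing limits exist by compactness. Limits of distance multisets are compared through
    their even power sums only; this gives the uniqueness of the limit as well as its membership in
    [P_DIST], in place of the continuity of sorting. *)

Lemma det_vandermonde_diff (F : comNzRingType) (k : nat) (a : nat -> F) :
  \det (\matrix_(i < k, e < k) (a i.+1 ^+ e.+1 - a i ^+ e.+1)) =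
  \prod_(i < k.+1) \prod_(j < k.+1 | (i < j)%N) (a j - a i).
Proof.
pose v : 'rV[F]_k.+1 := \row_j a j.
pose X : 'M[F]_k.+1 := (Vandermonde k.+1 v)^T.
(* Left multiplication by the unipotent [L] subtracts from each Vandermonde row the previous one.
   The column of exponent 0 becomes the first unit vector, and expansion along it leaves the matrix
   of differences. *)
pose L : 'M[F]_k.+1 := \matrix_(i, j) ((i == j)%:R - (i == j.+1 :> nat)%:R).
have dL : \det L = 1.
  rewrite det_trig; last first.
    apply/is_trig_mxP => i j ij; rewrite !mxE.
    by rewrite -val_eqE (ltn_eqF ij) (ltn_eqF (leqW ij)) subrr.
  by apply: big1 => i _; rewrite !mxE eqxx (ltn_eqF (ltnSn i)) subr0.
have LX0 e : (L *m X) ord0 e = a 0%N ^+ e.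
  rewrite mxE (bigD1 ord0)//= big1 => [|j /negbTE j0]; rewrite !mxE/=.
    by rewrite subr0 mul1r addr0.
  by rewrite eq_sym j0 subr0 mul0r.
have LXS (i : 'I_k) e : (L *m X) (lift ord0 i) e = a i.+1 ^+ e - a i ^+ e.
  rewrite mxE.
  under eq_bigr => j _ do rewrite !mxE mulrBl !mulr_natl.
  rewrite sumrB; congr (_ - _).
    rewrite (bigD1 (lift ord0 i))//= big1 => [|j /negbTE j0].
      by rewrite eqxx mulr1n addr0 /= /bump.
    by rewrite eq_sym j0.
  rewrite (bigD1 (widen_ord (leqnSn k) i))//= big1 => [|j /negbTE j0].
    by rewrite /bump /= add1n eqxx mulr1n addr0.
  by rewrite /bump /= add1n eqSS [_ == _]eq_sym; rewrite -val_eqE /= in j0; rewrite j0.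
have -> : \prod_(i < k.+1) \prod_(j < k.+1 | (i < j)%N) (a j - a i) =
          \det (L *m X).
  rewrite det_mulmx dL mul1r det_tr det_Vandermonde.
  by apply: eq_bigr => i _; apply: eq_bigr => j _; rewrite !mxE.
rewrite (expand_det_col _ ord0) big_ord_recl big1 => [|i _]; last first.
  by rewrite LXS !expr0 subrr mul0r.
rewrite LX0 expr0 mul1r addr0 /cofactor expr0 mul1r.
congr (\det _); apply/matrixP => i e; rewrite !mxE.
by have := LXS i (lift ord0 e); rewrite mxE => ->.
Qed.

Lemma geom_sum_itv (F : nzRingType) (q : F) (u v c B : nat) : (u <= v)%N -> (v <= B)%N ->
  (1 - q) * \sum_(x < B.+1 | (u <= x <= v)%N) q ^+ (x + c) =
  q ^+ (u + c) - q ^+ (v + c).+1.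
Proof.
move=> uv vB.
rewrite -(big_mkord (fun x => (u <= x <= v)%N) (fun x => q ^+ (x + c))).
rewrite (big_cat_nat _ (n := u)) //=; last by rewrite ltnW// ltnS (leq_trans uv).
rewrite [X in _ * (X + _)]big1_seq ?add0r; last first.
  by move=> i /andP[/andP[ui _]]; rewrite mem_index_iota => /andP[_]; rewrite ltnNge ui.
rewrite (big_cat_nat _ (n := v.+1)) //=; last by rewrite ltnW.
rewrite [X in _ * (_ + X)]big1_seq ?addr0; last first.
  by move=> i /andP[/andP[_ iv]]; rewrite mem_index_iota => /andP[]; rewrite ltnNge iv.
rewrite (eq_bigl (fun i => (u <= i < v.+1)%N && true)); last by move=> i; rewrite ltnS andbT.
rewrite -big_nat_cond mulr_sumr.
under eq_bigr => i _ do rewrite mulrBl mul1r -exprS -opprB -addSn.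
by rewrite sumrN telescope_sumr 1?leqW// opprB addSn.
Qed.

(** Inner shapes are finite functions so that they can be summed over; padding with zero parts turns
    them back into shapes on all of [nat]. *)
Definition extend_ffun k B (f : {ffun 'I_k -> 'I_B.+1}) (i : nat) : nat :=
  if insub i is Some j then f j else 0%N.

Lemma extend_ffunE k B (f : {ffun 'I_k -> 'I_B.+1}) (i : 'I_k) :
  extend_ffun f i = f i.
Proof. by rewrite /extend_ffun valK. Qed.

Lemma extend_ffun_ge k B (f : {ffun 'I_k -> 'I_B.+1}) i :
  (k <= i)%N -> extend_ffun f i = 0%N.
Proof. by move=> ki; rewrite /extend_ffun insubF// ltnNge ki. Qed.

(** Up to sign, the alternant in the bialternant formula for Schur polynomials, evaluated at 1, p,
    ..., p^(k-1). *)
Definition qvandermonde (F : fieldType) (p : F) (k : nat) (lam : nat -> nat) : F :=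
  \prod_(i < k) \prod_(j < k | (i < j)%N)
    (p ^+ (lam j + (k.-1 - j)) - p ^+ (lam i + (k.-1 - i))).

(** Interlacing constrains each [f i] separately, so the sum over inner shapes moves into the
    determinant row by row. Each entry becomes a geometric sum; the factor 1 - p^(e+1) clears its
    denominator and leaves a_(i+1)^(e+1) - a_i^(e+1) with a_i = p^(lam i + k - i), the matrix of
    [det_vandermonde_diff]. *)
Lemma qvandermonde_branching (F : fieldType) (p : F) (k B : nat) (lam : nat -> nat) :
  (forall i, lam i.+1 <= lam i)%N -> (forall i, lam i <= B)%N ->
  (\prod_(i < k) p ^+ (k.-1 - i)) * (\prod_(e < k) (1 - p ^+ e.+1)) *
  (\sum_(f : {ffun 'I_k -> 'I_B.+1} | [forall i : 'I_k, (lam i.+1 <= f i <= lam i)%N])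
     p ^+ (\sum_(i < k) f i) * qvandermonde p k (extend_ffun f)) =
  qvandermonde p k.+1 lam.
Proof.
move=> lamS lamB.
rewrite /(qvandermonde _ k.+1 _) /=.
pose b (f : {ffun 'I_k -> 'I_B.+1}) (i : 'I_k) := (f i + (k.-1 - i))%N.
have detf (f : {ffun 'I_k -> 'I_B.+1}) :
    (\prod_(i < k) p ^+ (k.-1 - i)) * (p ^+ (\sum_(i < k) f i) * qvandermonde p k (extend_ffun f)) =
    \det (\matrix_(i < k, e < k) (p ^+ e.+1) ^+ (b f i)).
  pose v : 'rV[F]_k := \row_i p ^+ b f i.
  have -> : \matrix_(i < k, e < k) (p ^+ e.+1) ^+ (b f i) =
     diag_mx v *m (Vandermonde k v)^T.
    by apply/matrixP => i e; rewrite mul_diag_mx !mxE -exprS -!exprM mulnC.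
  rewrite det_mulmx det_diag det_tr det_Vandermonde mulrA expr_sum -big_split/=.
  congr (_ * _); first by apply: eq_bigr => i _; rewrite mxE /b addnC exprD.
  by apply: eq_bigr => i _; apply: eq_bigr => j _; rewrite !mxE /b !extend_ffunE.
rewrite mulrAC mulr_sumr (eq_bigr _ (fun f _ => detf f)).
have /= <- := det_vandermonde_diff k (fun i : nat => p ^+ (lam i + (k - i))).
rewrite /determinant.
have mE (f : {ffun 'I_k -> 'I_B.+1}) (s : 'S_k) :
    \prod_i (\matrix_(i < k, e < k) (p ^+ e.+1) ^+ (b f i)) i (s i) =
    \prod_i (p ^+ (s i).+1) ^+ (b f i) by apply: eq_bigr => i _; rewrite mxE.
rewrite (eq_bigr _ (fun f _ => eq_bigr _ (fun s _ => congr1 ( *%R _) (mE f s)))).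
rewrite exchange_big /= mulr_suml; apply: eq_bigr => s _.
rewrite -mulr_sumr -mulrA; congr (_ * _).
rewrite (eq_bigl (fun f => f \in family (fun i : 'I_k => fun x : 'I_B.+1 => (lam i.+1 <= x <= lam i)%N))); last first.
  by move=> f.
rewrite -(bigA_distr_big_dep _ (fun (i : 'I_k) (x : 'I_B.+1) => (p ^+ (s i).+1) ^+ (x + (k.-1 - i)))) /=.
(* The factors 1 - p^(e+1) belong to the columns; reindexing by [s] attaches to row i the factor of
   column [s i]. *)
rewrite [X in _ * X](reindex_inj (@perm_inj _ s))/= -big_split/=.
apply: eq_bigr => i _; rewrite mulrC geom_sum_itv// mxE.
have ik := ltn_ord i.
rewrite -!exprM ![((s i).+1 * _)%N]mulnC !exprM; congr (_ ^+ _ ^+ _ - _ ^+ _ ^+ _).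
  by rewrite subnS -predn_sub.
by rewrite -addnS -predn_sub -subnS subnSK.
Qed.

Lemma card_ord_lt (B n : nat) : (n <= B)%N -> #|[pred c : 'I_B | (c < n)%N]| = n.
Proof.
by move=> nB; rewrite -sum1_card -(big_ord_widen _ (fun=> 1%N) nB) sum1_card card_ord.
Qed.

(** An inner row is known only through the number of its small entries; this recovers the positions
    of those entries. *)
Lemma card_initial_segment (B : nat) (P : pred 'I_B) :
  (forall c c' : 'I_B, (c < c')%N -> P c' -> P c) ->
  forall c : 'I_B, (c < #|P|)%N = P c.
Proof.
move=> Pdown c; apply/idP/idP => [cP|Pc].
  apply: contraTT cP => nPc; rewrite -leqNgt -[leqRHS](card_ord_lt (ltnW (ltn_ord c))).
  apply: subset_leq_card; apply/fintype.subsetP => x Px; rewrite inE ltnNge; apply: contra nPc.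
  rewrite leq_eqVlt => /orP[/eqP/val_inj ->//|cx].
  exact: Pdown cx _.
rewrite -[ltnLHS](card_ord_lt (ltnW (ltn_ord c))).
apply: proper_card; apply/properP; split; last by exists c; rewrite // inE ltnn.
by apply/fintype.subsetP => x; rewrite inE => xc; apply: Pdown xc Pc.
Qed.

(** * Tableaux inside a box *)

Section box_tableaux.
Variables (r B M : nat).
Implicit Types (T : {ffun 'I_r * 'I_B -> 'I_M.+1}) (lam : nat -> nat).

(* Tableaux of all shapes inside an r x B box live in one type: the value M,
   larger than all entries, marks the cells outside the shape. *)
Definition box_ssyt (k : nat) lam T : bool :=
  [&& [forall x : 'I_r * 'I_B, (T x < M)%N == (x.2 < lam x.1)%N],
      [forall x : 'I_r * 'I_B, (T x < M)%N ==> (0 < T x <= k)%N],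
      [forall i : 'I_r, forall c : 'I_B, forall c' : 'I_B, (c < c')%N ==> (T (i, c) <= T (i, c'))%N]
    & [forall c : 'I_B, forall i : 'I_r, forall i' : 'I_r, (i < i')%N && (T (i', c) < M)%N ==>
                            (T (i, c) < T (i', c))%N]].

Lemma box_ssytP k lam T :
  reflect [/\ forall (i : 'I_r) (c : 'I_B), (T (i, c) < M)%N = (c < lam i)%N,
              forall (i : 'I_r) (c : 'I_B), (T (i, c) < M)%N -> (0 < T (i, c) <= k)%N,
              forall (i : 'I_r) (c c' : 'I_B), (c < c')%N -> (T (i, c) <= T (i, c'))%N
            & forall (c : 'I_B) (i i' : 'I_r), (i < i')%N -> (T (i', c) < M)%N ->
                (T (i, c) < T (i', c))%N]
          (box_ssyt k lam T).
Proof.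
apply: (iffP and4P) => -[H1 H2 H3 H4]; split.
- by move=> i c; exact: (eqP (forallP H1 (i, c))).
- by move=> i c; apply/implyP; exact: (forallP H2 (i, c)).
- by move=> i c c' cc'; move/forallP : H3 => /(_ i)/forallP/(_ c)/forallP/(_ c')/implyP; apply.
- move=> c i i' ii' Tx; move/forallP : H4 => /(_ c)/forallP/(_ i)/forallP/(_ i')/implyP.
  by apply; rewrite ii'.
- by apply/forallP => -[i c]; rewrite /= H1.
- by apply/forallP => -[i c]; apply/implyP/H2.
- by apply/forallP => i; apply/forallP => c; apply/forallP => c'; apply/implyP/H3.
- apply/forallP => c; apply/forallP => i; apply/forallP => i'; apply/implyP => /andP[].
  exact: H4.
Qed.

(** Columns increase strictly from at least 1. Hence row k and the rows below it, counted from 0,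
    hold no entry at most k, so the inner shape has at most k rows. *)
Lemma box_ssyt_row_lt k lam T (i : 'I_r) (c : 'I_B) : box_ssyt k lam T ->
  (i < T (i, c))%N || (T (i, c) == M :> nat).
Proof.
move=> /box_ssytP[H1 H2 H3 H4].
case: i => i; elim: i => [|i IH] ir.
  case: (ltnP (T (Ordinal ir, c)) M) => [/H2/andP[-> //]|MT].
  by have := ltn_ord (T (Ordinal ir, c)); lia.
case: (ltnP (T (Ordinal ir, c)) M) => [TM|MT].
  have {}IH := IH (ltnW ir).
  have := H4 c (Ordinal (ltnW ir)) (Ordinal ir) (ltnSn i) TM => /= TT.
  case/orP: IH => [iT|/eqP TM'].
    by rewrite (leq_ltn_trans _ TT).
  by move: TT; rewrite TM' => /(ltn_trans TM); rewrite ltnn.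
by have := ltn_ord (T (Ordinal ir, c)); lia.
Qed.

Variables (F : fieldType) (p : F).

(** The exponent k - T x, rather than T x, gives an entry k weight 1; raising k by one multiplies
    the weight by p once per cell of the inner shape. *)
Definition box_weight (k : nat) T : F :=
  \prod_x (if (T x < M)%N then p ^+ (k - T x) else 1).

Definition box_sum (k : nat) lam : F := \sum_(T | box_ssyt k lam T) box_weight k T.

Lemma box_sum0 k lam : (forall i, lam i = 0%N) -> box_sum k lam = 1.
Proof.
move=> lam0; rewrite /box_sum (big_pred1 [ffun=> ord_max]); last first.
  move=> T; apply/box_ssytP/eqP => [[H1 _ _ _]|->].
    apply/ffunP => -[i c]; apply/val_inj/eqP; rewrite ffunE /= eqn_leq -ltnS ltn_ord /=.
    by rewrite leqNgt H1 lam0.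
  by split=> [i c|i c|i c c' _|c i i' _]; rewrite !ffunE /= ?ltnn ?lam0.
by apply: big1 => x _; rewrite ffunE ltnn.
Qed.

End box_tableaux.

(** * Removing the largest entries *)

Section branching.
Variables (r B M k : nat) (lam : nat -> nat).
Hypotheses (kM : (k.+1 < M)%N) (kr : (k < r)%N).
Hypotheses (lamS : forall i, (lam i.+1 <= lam i)%N) (lamB : forall i, (lam i <= B)%N)
  (lam0 : forall i, (k < i)%N -> lam i = 0%N).
Implicit Types (T : {ffun 'I_r * 'I_B -> 'I_M.+1}) (f : {ffun 'I_k -> 'I_B.+1}).

(** For a fixed inner shape f, [trunc] and [fill f] are inverse to each other; the lemmas below
    check this and the tableau conditions cell by cell. *)
Let inner T : {ffun 'I_k -> 'I_B.+1} :=
  [ffun i : 'I_k => inord #|[pred c | T (widen_ord (ltnW kr) i, c) <= k]%N|].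

Let trunc T : {ffun 'I_r * 'I_B -> 'I_M.+1} :=
  [ffun x => if (T x <= k)%N then T x else ord_max].

Let fill f T : {ffun 'I_r * 'I_B -> 'I_M.+1} :=
  [ffun x : 'I_r * 'I_B => if (x.2 < extend_ffun f x.1)%N then T x else
             if (x.2 < lam x.1)%N then inord k.+1 else ord_max].

Let interlace f := [forall i : 'I_k, (lam i.+1 <= f i <= lam i)%N].

Let lam_le i j : (i <= j)%N -> (lam j <= lam i)%N.
Proof. by elim: j => [|j IH]; [rewrite leqn0 => /eqP->|rewrite leq_eqVlt => /orP[/eqP->//|/IH/(leq_trans (lamS j))]]. Qed.

Let interlace_ext f i : interlace f -> (lam i.+1 <= extend_ffun f i <= lam i)%N.
Proof.
move=> /forallP fP; case: (ltnP i k) => ik.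
  by have := fP (Ordinal ik); rewrite -extend_ffunE.
by rewrite extend_ffun_ge// lam0.
Qed.

Let row_downward T : box_ssyt k.+1 lam T -> forall i (c c' : 'I_B), (c < c')%N ->
  [pred c | T (i, c) <= k]%N c' -> [pred c | T (i, c) <= k]%N c.
Proof.
by move=> /box_ssytP[_ _ H3 _] i c c' cc'; rewrite /=; apply: leq_trans (H3 _ _ _ cc').
Qed.

Let innerE T (i : 'I_r) (c : 'I_B) : box_ssyt k.+1 lam T ->
  (c < extend_ffun (inner T) i)%N = (T (i, c) <= k)%N.
Proof.
move=> TA; case: (ltnP i k) => ik; last first.
  rewrite extend_ffun_ge// ltn0; apply/esym/negbTE; rewrite -ltnNge.
  by case/orP: (box_ssyt_row_lt i c TA) => [|/eqP ->]; lia.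
rewrite -[X in extend_ffun _ X]/(val (Ordinal ik)) extend_ffunE ffunE inordK; last first.
  by rewrite ltnS -[leqRHS]card_ord max_card.
rewrite (card_initial_segment (@row_downward T TA _)) /=.
by congr (T (_, c) <= k)%N; apply/val_inj.
Qed.

(** If f_i < lam_(i+1), the cell of row i in column f_i would hold an entry above k, and the cell
    under it one above k + 1. *)
Let interlace_inner T : box_ssyt k.+1 lam T -> interlace (inner T).
Proof.
move=> TA; apply/forallP => i; rewrite -extend_ffunE.
have ir : (i < r)%N := ltn_trans (ltn_ord i) kr.
have i1r : (i.+1 < r)%N by rewrite (leq_ltn_trans _ kr).
have [H1 H2 H3 H4] := box_ssytP _ _ _ TA.
have extB : (extend_ffun (inner T) i <= B)%N by rewrite extend_ffunE -ltnS ltn_ord.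
apply/andP; split; rewrite leqNgt; apply/negP => lt.
  have cB : (extend_ffun (inner T) i < B)%N by exact: leq_trans lt _.
  have := innerE (Ordinal ir) (Ordinal cB) TA; rewrite /= ltnn => /esym/negbT.
  rewrite -ltnNge => kT.
  have TM : (T (Ordinal i1r, Ordinal cB) < M)%N by rewrite H1.
  have := H4 _ (Ordinal ir) (Ordinal i1r) (ltnSn i) TM; have /andP[_ Tk1] := H2 _ _ TM.
  by move=> /(leq_ltn_trans kT)/leq_trans/(_ Tk1); rewrite ltnn.
have cB : (lam i < B)%N by exact: leq_trans lt _.
have := innerE (Ordinal ir) (Ordinal cB) TA; rewrite lt => /esym Tk.
by have := H1 (Ordinal ir) (Ordinal cB); rewrite /= ltnn (leq_ltn_trans Tk)// ltnW.
Qed.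

Let trunc_ssyt T : box_ssyt k.+1 lam T -> box_ssyt k (extend_ffun (inner T)) (trunc T).
Proof.
move=> TA; have [H1 H2 H3 H4] := box_ssytP _ _ _ TA.
apply/box_ssytP; split.
- move=> i c; rewrite innerE// ffunE; case: ifPn => [Tk|]; last by rewrite ltnn.
  by rewrite (leq_ltn_trans Tk)// ltnW.
- move=> i c; rewrite ffunE; case: ifPn => [Tk TM|]; last by rewrite ltnn.
  by have := H2 _ _ TM; rewrite Tk andbT => /andP[].
- move=> i c c' cc'; rewrite !ffunE; have := H3 i _ _ cc'.
  case: ifPn => [Tk|nTk]; case: ifPn => //= Tk'; last by lia.
  by move=> _; rewrite -ltnS ltn_ord.
- move=> c i i' ii'; rewrite !ffunE.
  case: (ifPn (T (i', c) <= k)%N) => [Tk|]; last by rewrite ltnn.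
  by move=> /(H4 _ _ _ ii') TT; rewrite ifT//; lia.
Qed.

Let inordk : val (inord k.+1 : 'I_M.+1) = k.+1.
Proof. by rewrite /= inordK// ltnS ltnW. Qed.

Let fill_trunc T : box_ssyt k.+1 lam T -> fill (inner T) (trunc T) = T.
Proof.
move=> TA; have [H1 H2 H3 H4] := box_ssytP _ _ _ TA.
apply/ffunP => -[i c]; rewrite !ffunE /= innerE//.
case: ifPn => [->//|nTk]; rewrite -H1; case: ifPn => TM; apply/val_inj.
  by rewrite inordk /=; have := H2 _ _ TM; rewrite /=; lia.
by have := ltn_ord (T (i, c)); rewrite /=; lia.
Qed.

Let ext_S f i : interlace f -> (extend_ffun f i.+1 <= extend_ffun f i)%N.
Proof.
move=> fI; have /andP[+ _] := interlace_ext i fI; have /andP[_] := interlace_ext i.+1 fI.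
exact: leq_trans.
Qed.

Let ext_le f i j : interlace f -> (i <= j)%N -> (extend_ffun f j <= extend_ffun f i)%N.
Proof.
move=> fI; elim: j => [|j IH]; first by rewrite leqn0 => /eqP->.
by rewrite leq_eqVlt => /orP[/eqP->//|/IH/(leq_trans (ext_S j fI))].
Qed.

Let fill_le f T i c : box_ssyt k (extend_ffun f) T ->
  (fill f T (i, c) <= k)%N = (c < extend_ffun f i)%N.
Proof.
move=> /box_ssytP[H1 H2 H3 H4]; rewrite ffunE /=; case: ifPn => cf.
  by have := H2 i c; rewrite H1 cf => /(_ isT)/andP[].
by case: ifPn => cl; rewrite ?inordk /= => *; lia.
Qed.

Let fill_ssyt f T : interlace f -> box_ssyt k (extend_ffun f) T ->
  box_ssyt k.+1 lam (fill f T).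
Proof.
move=> fI TA; have [H1 H2 H3 H4] := box_ssytP _ _ _ TA.
have fl i : (extend_ffun f i <= lam i)%N by case/andP: (interlace_ext i fI).
apply/box_ssytP; split.
- move=> i c; rewrite ffunE /=; case: ifPn => cf.
    by rewrite H1 cf (leq_trans cf).
  by case: ifPn => cl; rewrite ?inordk ?ltnn.
- move=> i c; rewrite ffunE /=; case: ifPn => cf.
    by move=> /H2/andP[-> /leqW ->].
  by case: ifPn => cl; rewrite ?inordk ?ltnn ?leqnn.
- move=> i c c' cc'; rewrite !ffunE /=.
  have := H3 i c c' cc'; have := ltn_ord (T (i, c)); have := H2 i c; have := H1 i c.
  have := fl i.
  by case: ifPn => cf; case: ifPn => c'f; try case: ifPn => cl; try case: ifPn => c'l;
    rewrite ?inordk /= => *; lia.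
- move=> c i i' ii'; rewrite !ffunE /=.
  have := H4 c i i' ii'; have := H2 i c; have := H1 i c; have := H1 i' c.
  have := ext_le fI (ltnW ii'); have /andP[+ _] := interlace_ext i fI.
  have := lam_le ii'; have := fl i'; have := fl i.
  by case: ifPn => cf; case: ifPn => c'f; try case: ifPn => cl; try case: ifPn => c'l;
    rewrite ?inordk /= => *; lia.
Qed.

Let inner_fill f T : interlace f -> box_ssyt k (extend_ffun f) T -> inner (fill f T) = f.
Proof.
move=> fI TA; apply/ffunP => i; rewrite ffunE; apply/val_inj.
rewrite /= (eq_card (B := [pred c : 'I_B | (c < f i)%N])); last first.
  by move=> c; rewrite !inE fill_le//= extend_ffunE.
have fB := ltn_ord (f i).
by rewrite card_ord_lt// inordK.
Qed.

Let trunc_fill f T : interlace f -> box_ssyt k (extend_ffun f) T -> trunc (fill f T) = T.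
Proof.
move=> fI TA; have [H1 H2 H3 H4] := box_ssytP _ _ _ TA.
apply/ffunP => -[i c]; rewrite ffunE fill_le// ffunE /=; case: ifPn => [->//|cf].
by apply/val_inj; have := H1 i c; rewrite (negbTE cf); have := ltn_ord (T (i, c)); rewrite /= => *; lia.
Qed.

Variables (F : fieldType) (p : F).

Let fill_weight f T : interlace f -> box_ssyt k (extend_ffun f) T ->
  box_weight p k.+1 (fill f T) = p ^+ (\sum_(i < k) f i) * box_weight p k T.
Proof.
move=> fI TA; have [H1 H2 H3 H4] := box_ssytP _ _ _ TA.
have extB i : (extend_ffun f i <= B)%N.
  by case/andP: (interlace_ext i fI) => _ /leq_trans; apply.
have -> : p ^+ (\sum_(i < k) f i) =
    \prod_(x : 'I_r * 'I_B) (if (x.2 < extend_ffun f x.1)%N then p else 1).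
  rewrite -(pair_bigA _ (fun (i : 'I_r) (c : 'I_B) => if (c < extend_ffun f i)%N then p else 1)) /=.
  transitivity (\prod_(i < r) p ^+ extend_ffun f i).
    rewrite -expr_sum; congr (_ ^+ _).
    transitivity (\sum_(i < k) extend_ffun f i)%N.
      by apply: eq_bigr => i _; rewrite extend_ffunE.
    rewrite (big_ord_widen _ _ (ltnW kr)) big_mkcond; apply: eq_bigr => i _.
    by case: ltnP => // /extend_ffun_ge ->.
  apply: eq_bigr => i _; rewrite -big_mkcond /= prodr_const.
  by rewrite (card_ord_lt (extB i)).
rewrite -big_split; apply: eq_bigr => -[i c] _; rewrite /= H1 ffunE /=.
have := H1 i c; have := H2 i c.
case: (boolP (c < extend_ffun f i)%N) => cf; rewrite /= => Tk TM.
  by rewrite TM -exprS -subSn //; move: Tk; rewrite TM => /(_ isT)/andP[].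
by case: (boolP (c < lam i)%N) => cl; rewrite ?inordk ?kM /= ?ltnn ?subnn ?expr0 mulr1.
Qed.

Lemma box_sum_branching :
  box_sum r B M p k.+1 lam =
  \sum_(f : {ffun 'I_k -> 'I_B.+1} | [forall i : 'I_k, (lam i.+1 <= f i <= lam i)%N])
     p ^+ (\sum_(i < k) f i) * box_sum r B M p k (extend_ffun f).
Proof.
rewrite /box_sum (partition_big inner interlace) //=; apply: eq_bigr => f fI.
rewrite mulr_sumr (reindex_onto (fill f) trunc) /=; last first.
  by move=> T /andP[TA /eqP <-]; exact: fill_trunc.
apply: eq_big => [T|T /andP[/andP[fA /eqP fTf] /eqP <-]]; last first.
  by rewrite fill_weight//; rewrite -{1}fTf trunc_ssyt.
apply/idP/idP => [/andP[/andP[fA /eqP fTf] /eqP <-]|TA].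
  by rewrite -{1}fTf trunc_ssyt.
by rewrite fill_ssyt//= inner_fill// trunc_fill// !eqxx.
Qed.

End branching.

(** Both sides obey the same recursion up to a factor independent of the shape, which the hypothesis
    on the powers of p makes invertible. The next lemma reads the constant off the empty shape,
    whose only tableau has weight 1. *)
Lemma box_sum_prop_qvandermonde (F : fieldType) (p : F) (r B M k : nat) :
  p != 0 -> (forall e, (0 < e <= r)%N -> p ^+ e != 1) -> (r < M)%N -> (k <= r)%N ->
  exists C, forall lam : nat -> nat, (forall i, lam i.+1 <= lam i)%N ->
    (forall i, lam i <= B)%N -> (forall i, (k <= i)%N -> lam i = 0%N) ->
    box_sum r B M p k lam = C * qvandermonde p k lam.
Proof.
move=> p0 pe rM; elim: k => [_|k IH kr].
  exists 1 => lam _ _ lam0; rewrite box_sum0; last by move=> i; exact: lam0.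
  by rewrite /qvandermonde big_ord0 mulr1.
have [C HC] := IH (ltnW kr).
pose D := (\prod_(i < k) p ^+ (k.-1 - i)) * (\prod_(e < k) (1 - p ^+ e.+1)).
have D0 : D != 0.
  rewrite mulf_neq0//; apply/prodf_neq0 => i _; first by rewrite expf_neq0.
  by rewrite subr_eq0 eq_sym pe// (leq_trans _ (ltnW kr))// ltn_ord.
exists (C / D) => lam lamS lamB lam0.
rewrite -(@qvandermonde_branching F p k B lam)// -/D mulrA divfK//.
rewrite box_sum_branching//; last exact: leq_trans rM.
rewrite mulr_sumr; apply: eq_bigr => f /forallP fI.
rewrite mulrCA HC//; last by move=> i; exact: extend_ffun_ge.
- move=> i; case: (ltnP i.+1 k) => ik; last by rewrite extend_ffun_ge.
  have := fI (Ordinal ik); have := fI (Ordinal (ltnW ik)).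
  by rewrite -!extend_ffunE /= => /andP[h _] /andP[_ /leq_trans]; apply.
- move=> i; case: (ltnP i k) => ik; last by rewrite extend_ffun_ge.
  by have := fI (Ordinal ik); rewrite -extend_ffunE /= => /andP[_] /leq_trans; apply.
Qed.

Lemma box_sum_qvandermonde (F : fieldType) (p : F) (r B M : nat) (lam : nat -> nat) :
  p != 0 -> (forall e, (0 < e <= r)%N -> p ^+ e != 1) -> (r < M)%N ->
  (forall i, lam i.+1 <= lam i)%N -> (forall i, lam i <= B)%N ->
  (forall i, (r <= i)%N -> lam i = 0%N) ->
  box_sum r B M p r lam * qvandermonde p r (fun=> 0%N) = qvandermonde p r lam.
Proof.
move=> p0 pe rM lamS lamB lam0.
have [C HC] := box_sum_prop_qvandermonde B p0 pe rM (leqnn r).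
have C1 : C * qvandermonde p r (fun=> 0%N) = 1 by rewrite -HC// box_sum0.
by rewrite HC// mulrAC C1 mul1r.
Qed.

Lemma is_partition_nth_le la i : is_partition la -> (nth 0%N la i.+1 <= nth 0%N la i)%N.
Proof.
move=> /andP[s _]; case: (ltnP i.+1 (size la)) => ila; last by rewrite (nth_default _ ila).
by apply: (sorted_ltn_nth (rev_trans leq_trans) 0%N s i i.+1); rewrite ?inE // ltnW.
Qed.

Lemma is_partition_nth_le0 la i : is_partition la -> (nth 0%N la i <= nth 0%N la 0)%N.
Proof. by move=> pla; elim: i => // i; apply: leq_trans; exact: is_partition_nth_le. Qed.

Section box_filling.
Variables (la : seq nat) (m : nat).
Hypotheses (pla : is_partition la) (lam : (size la <= m)%N).
Let B := nth 0%N la 0.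

Lemma cell_inj (x y : cell la) : row_of x = row_of y -> col_of x = col_of y -> x = y.
Proof.
case: x y => [i c] [i' c']; rewrite /row_of /col_of /= => /val_inj ii'.
by case: _ / ii' c' => c' /val_inj ->.
Qed.

Lemma cell_exists i c : (c < nth 0%N la i)%N -> exists x : cell la, row_of x = i /\ col_of x = c.
Proof.
move=> cla; have ila : (i < size la)%N.
  by rewrite ltnNge; apply: contraTN cla => /(nth_default 0%N) ->.
by exists (Tagged (fun i : 'I_(size la) => 'I_(nth 0%N la i)) (Ordinal cla : 'I_(nth 0%N la (Ordinal ila)))).
Qed.

Lemma col_lt_row (x : cell la) : (col_of x < nth 0%N la (row_of x))%N.
Proof. by case: x => i c; exact: ltn_ord. Qed.

Let row_lt (x : cell la) : (row_of x < m)%N.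
Proof. by rewrite (leq_trans _ lam)//; case: x => i c; exact: ltn_ord. Qed.

Let col_lt (x : cell la) : (col_of x < B)%N.
Proof. exact: leq_trans (col_lt_row x) (is_partition_nth_le0 _ pla). Qed.

Let pos (x : cell la) : 'I_m * 'I_B := (Ordinal (row_lt x), Ordinal (col_lt x)).

Let pos_inj : injective pos.
Proof. by move=> x y [rxy cxy]; apply: cell_inj. Qed.

Let restr (T : {ffun 'I_m * 'I_B -> 'I_m.+2}) : filling la m :=
  [ffun x => inord (T (pos x))].

Let ext (T : filling la m) : {ffun 'I_m * 'I_B -> 'I_m.+2} :=
  [ffun y => if [pick x | pos x == y] is Some x then inord (T x) else ord_max].

Let ext_pos T x : ext T (pos x) = T x :> nat.
Proof.
rewrite ffunE; case: pickP => [y /eqP/pos_inj ->|/(_ x)]; last by rewrite eqxx.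
by rewrite inordK// ltnW// ltnS.
Qed.

Let posP (i : 'I_m) (c : 'I_B) : (c < nth 0%N la i)%N -> exists x, [/\ (i, c) = pos x, row_of x = i & col_of x = c].
Proof.
by move=> /cell_exists[x [xi xc]]; exists x; split=> //; congr (_, _); apply/val_inj.
Qed.

Let ext_out T (i : 'I_m) (c : 'I_B) : (nth 0%N la i <= c)%N -> ext T (i, c) = m.+1 :> nat.
Proof.
move=> lac; rewrite ffunE; case: pickP => // x /eqP[xi xc].
by move: (col_lt_row x) lac; rewrite -xi -xc /= ltnNge => /negbTE ->.
Qed.

Let ext_lt T (i : 'I_m) (c : 'I_B) : (ext T (i, c) < m.+1)%N = (c < nth 0%N la i)%N.
Proof.
case: (ltnP c (nth 0%N la i)) => [/posP[x [-> _ _]]|/ext_out ->]; last by rewrite ltnn.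
by rewrite ext_pos ltn_ord.
Qed.

(** The type of cells depends on the shape, which is unsuited to an induction on shapes. [ext] and
    [restr] identify tableaux with arrays on a fixed box of m rows and la_0 columns, where the value
    m + 1 marks the outside. *)
Lemma filling_sum (F : fieldType) (p : F) :
  \sum_(T : filling la m | is_ssyt T) p ^+ (\sum_x (m - T x)) =
  box_sum m B m.+1 p m (nth 0%N la).
Proof.
rewrite /box_sum (reindex_onto ext restr) /=; last first.
  move=> T /box_ssytP[H1 H2 H3 H4]; apply/ffunP => -[i c]; apply/val_inj => /=.
  case: (ltnP c (nth 0%N la i)) => ila; last first.
    rewrite ext_out//; apply/eqP; have := H1 i c; rewrite (leq_gtF ila) => /negbT.
    by rewrite -leqNgt => mT; rewrite eqn_leq mT -ltnS ltn_ord.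
  have := H1 i c; rewrite ila; have [x [-> _ _]] := posP ila => TM.
  by rewrite ext_pos ffunE inordK. 
have restrK T : restr (ext T) = T.
  by apply/ffunP => x; rewrite ffunE; apply/val_inj; rewrite /= ext_pos inordK.
apply: eq_big => [T|T _]; last first.
  rewrite /box_weight expr_sum.
  rewrite (bigID (fun y => y \in pos @: [set: cell la])) /= [X in _ * X]big1 ?mulr1; last first.
    move=> -[i c] nxi; rewrite ext_lt; case: ifPn => // /posP[x [xE _ _]].
    by rewrite xE imset_f// inE in nxi.
  rewrite big_imset /=; last by move=> x y _ _ /pos_inj.
  apply: eq_big => [x|x _]; first by rewrite inE.
  by rewrite ext_pos ltn_ord.
rewrite restrK eqxx andbT; apply/and3P/box_ssytP => -[].
  move=> /forallP H1 /forallP H2 /forallP H3; split.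
  - exact: ext_lt.
  - move=> i c; rewrite ext_lt => /posP[x [-> _ _]]; rewrite ext_pos H1 /=.
    by rewrite -ltnS ltn_ord.
  - move=> i c c' cc'; case: (ltnP c' (nth 0%N la i)) => c'la; last first.
      by rewrite (ext_out T c'la) -ltnS ltn_ord.
    have [x [xE xi xc]] := posP (ltn_trans cc' c'la); have [y [yE yi yc]] := posP c'la.
    rewrite xE yE !ext_pos; move/forallP : (H2 x) => /(_ y)/implyP; apply.
    by rewrite xi yi xc yc eqxx.
  - move=> c i i' ii'; rewrite ext_lt => c'la; have [y [yE yi yc]] := posP c'la.
    have cla : (c < nth 0%N la i)%N.
      apply: leq_trans c'la _; have := ltnW ii'; elim: (val i') => [|j IH].
        by rewrite leqn0 => /eqP ->.
      rewrite leq_eqVlt => /orP[/eqP->//|/IH]; apply: leq_trans.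
      exact: is_partition_nth_le.
    have [x [xE xi xc]] := posP cla.
    rewrite xE yE !ext_pos; move/forallP : (H3 x) => /(_ y)/implyP; apply.
    by rewrite xi yi xc yc eqxx.
move=> H1 H2 H3 H4; split.
- apply/forallP => x; have := H2 (pos x).1 (pos x).2; rewrite -surjective_pairing ext_pos.
  by rewrite ltn_ord => /(_ isT)/andP[].
- apply/forallP => x; apply/forallP => y; apply/implyP => /andP[/eqP xy cxy].
  have := H3 (pos x).1 (pos x).2 (pos y).2 cxy; rewrite -surjective_pairing ext_pos.
  have -> : (pos x).1 = (pos y).1 by apply/val_inj.
  by rewrite -surjective_pairing ext_pos.
- apply/forallP => x; apply/forallP => y; apply/implyP => /andP[/eqP xy cxy].
  have := H4 (pos x).2 (pos x).1 (pos y).1 cxy; rewrite -surjective_pairing ext_pos.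
  have -> : (pos x).2 = (pos y).2 by apply/val_inj.
  by rewrite -surjective_pairing ext_pos ltn_ord; apply.
Qed.

End box_filling.

Local Open Scope classical_set_scope.
Local Open Scope ring_scope.

(** * Smooth functions and moment generating functions *)

Section smooth.
Variable R : realType.
Implicit Types (f g : R -> R) (n : nat).

(** [derive1n] is a total function, so the calculus of higher derivatives needs differentiability
    recorded separately; this predicate records it at every point and for every order up to n. *)
Fixpoint Ck n f : Prop :=
  if n is n'.+1 then (forall x, derivable f x 1) /\ Ck n' (derive1 f) else True.

Definition smooth f : Prop := forall n, Ck n f.

Lemma CkW n f : Ck n.+1 f -> Ck n f.
Proof.
by elim: n f => // n IH f [df Cf]; split => //; exact: IH.
Qed.

Lemma smooth_derivable f x : smooth f -> derivable f x 1.
Proof. by move=> /(_ 1%N)[]. Qed.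

Lemma smooth_derive1 f : smooth f -> smooth (derive1 f).
Proof. by move=> sf n; have [] := sf n.+1. Qed.

Lemma smooth_continuous f : smooth f -> continuous f.
Proof.
by move=> sf x; apply/differentiable_continuous/derivable1_diffP/smooth_derivable.
Qed.

Lemma derive1_eq f g : (forall x : R, is_derive x (1 : R) f (g x)) -> (derive1 f) = g.
Proof. by move=> h; apply/funext => x; rewrite derive1E; apply: derive_val. Qed.

Lemma Ck_is_derive n f g : (forall x : R, is_derive x (1 : R) f (g x)) -> Ck n g -> Ck n.+1 f.
Proof.
move=> h Cg; apply: conj; first by move=> x; have [] := h x.
by rewrite (derive1_eq h).
Qed.

Lemma derive1P f x : derivable f x 1 -> is_derive x (1 : R) f ((derive1 f) x).
Proof. by move=> df; rewrite derive1E; apply: derivableP. Qed.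

Lemma Ck_cst n c : Ck n (cst c).
Proof.
elim: n c => // n IH c.
by apply: (@Ck_is_derive _ _ (cst 0)).
Qed.

Lemma smooth_cst c : smooth (cst c). Proof. by move=> n; exact: Ck_cst. Qed.

Lemma smooth_id : smooth id.
Proof.
case=> // n; apply: (@Ck_is_derive _ _ (cst 1)); exact: smooth_cst.
Qed.

Lemma CkD n f g : Ck n f -> Ck n g -> Ck n (f \+ g).
Proof.
elim: n f g => // n IH f g [df Cf] [dg Cg].
apply: (@Ck_is_derive _ _ ((derive1 f) \+ (derive1 g))); last exact: IH.
by move=> x; apply: is_deriveD; exact: derive1P.
Qed.

Lemma smoothD f g : smooth f -> smooth g -> smooth (f \+ g).
Proof. by move=> sf sg n; exact: CkD. Qed.

Lemma CkM n f g : Ck n f -> Ck n g -> Ck n (f \* g).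
Proof.
elim: n f g => // n IH f g Cf Cg; have [df Cf'] := Cf; have [dg Cg'] := Cg.
apply: (@Ck_is_derive _ _ (((derive1 f) \* g) \+ (f \* (derive1 g)))).
  move=> x; have := is_deriveM (derive1P (df x)) (derive1P (dg x)).
  by move/is_derive_eq; apply; rewrite /= addrC [g x *: _]mulrC.
by apply: CkD; apply: IH => //; exact: CkW.
Qed.

Lemma smoothM f g : smooth f -> smooth g -> smooth (f \* g).
Proof. by move=> sf sg n; exact: CkM. Qed.

Lemma smoothN f : smooth f -> smooth (\- f).
Proof.
move=> sf; have -> : (\- f) = cst (-1) \* f.
  by apply/funext => x; rewrite /= mulN1r.
by apply: smoothM => //; exact: smooth_cst.
Qed.

Lemma smoothB f g : smooth f -> smooth g -> smooth (f \- g).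
Proof. by move=> sf sg; apply: (smoothD sf (smoothN sg)). Qed.

Lemma CkV n f : (forall x, f x != 0) -> Ck n f -> Ck n (fun x => (f x)^-1).
Proof.
move=> f0; elim: n => // n IH Cf; have [df Cf'] := Cf.
apply: (@Ck_is_derive _ _ (cst (-1) \* ((fun x => (f x)^-1) \* ((fun x => (f x)^-1) \* (derive1 f))))).
  move=> x; have := is_deriveV (f0 x) (derive1P (df x)).
  by move/is_derive_eq; apply; rewrite /= expr2 invfM mulN1r mulrA scaleNr.
by apply: CkM; [exact: Ck_cst|apply: CkM; [|apply: CkM => //]; apply: IH; exact: CkW].
Qed.

Lemma smoothV f : (forall x, f x != 0) -> smooth f -> smooth (fun x => (f x)^-1).
Proof. by move=> f0 sf n; exact: CkV. Qed.

Lemma derive1_ln f x : (forall x, 0 < f x) -> smooth f ->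
  is_derive x (1 : R) (fun x => ln (f x)) ((derive1 f) x / f x).
Proof.
move=> f0 sf.
have := is_derive1_comp (is_derive1_ln (f0 x)) (derive1P (smooth_derivable sf)).
by move/is_derive_eq; apply; rewrite mulrC.
Qed.

Lemma smooth_ln f : (forall x, 0 < f x) -> smooth f -> smooth (fun x => ln (f x)).
Proof.
move=> f0 sf [|n] //.
apply: (@Ck_is_derive _ _ ((derive1 f) \* (fun x => (f x)^-1))).
  by move=> x; exact: derive1_ln.
by apply: smoothM; [exact: smooth_derive1|apply: smoothV => // x; rewrite gt_eqF].
Qed.

Lemma Ck_scale n f a : Ck n f -> Ck n (fun x => f (a * x)).
Proof.
elim: n f => // n IH f [df Cf].
apply: (@Ck_is_derive _ _ (cst a \* (fun x => (derive1 f) (a * x)))).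
  move=> x; have ax : is_derive x 1 ( *%R a) a.
    by have := is_deriveZ a (is_derive_id x (1 : R)); move/is_derive_eq; apply; rewrite scaler1.
  have := is_derive1_comp (derive1P (df (a * x))) ax.
  by move/is_derive_eq; apply; rewrite /= mulrC.
by apply: CkM; [exact: Ck_cst|exact: IH].
Qed.

Lemma smooth_scale f a : smooth f -> smooth (fun x => f (a * x)).
Proof. by move=> sf n; exact: Ck_scale. Qed.

Lemma smooth_expR : smooth expR.
Proof.
by elim=> // n IH; apply: (@Ck_is_derive _ _ expR).
Qed.

(** This is n! times the n-th Taylor coefficient at 0, the normalization of [cumulant]. *)
Definition D0 n f : R := derive1n (n) f 0.

Lemma derive1Sn n f : derive1n (n.+1) f = derive1n n (derive1 f).
Proof. by rewrite /derive1n iterSr. Qed.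

Lemma D0S n f : D0 n.+1 f = D0 n (derive1 f).
Proof. by rewrite /D0 derive1Sn. Qed.

Lemma D0_is_derive n f g : (forall x : R, is_derive x (1 : R) f (g x)) -> D0 n.+1 f = D0 n g.
Proof. by move=> h; rewrite D0S (derive1_eq h). Qed.

Lemma D0_cst n c : D0 n (cst c) = if n == 0%N then c else 0.
Proof.
case: n => // n; rewrite (@D0_is_derive _ _ (cst 0)).
elim: n => // n IH; by rewrite (@D0_is_derive _ _ (cst 0)).
Qed.

Lemma D0_id n : D0 n id = (n == 1%N)%:R.
Proof.
case: n => // n; rewrite (@D0_is_derive _ _ (cst 1)).
by rewrite D0_cst; case: n.
Qed.

Lemma D0D n f g : smooth f -> smooth g -> D0 n (f \+ g) = D0 n f + D0 n g.
Proof.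
elim: n f g => // n IH f g sf sg.
have h (x : R) : is_derive x (1 : R) (f \+ g) ((derive1 f \+ derive1 g) x).
  by apply: is_deriveD; apply: derive1P; exact: smooth_derivable.
by rewrite (D0_is_derive n h) IH -?D0S//; exact: smooth_derive1.
Qed.

Lemma D0M n f g : smooth f -> smooth g ->
  D0 n (f \* g) = \sum_(k < n.+1) 'C(n, k)%:R * D0 k f * D0 (n - k) g.
Proof.
elim: n f g => [|n IH] f g sf sg.
  by rewrite big_ord_recl big_ord0 bin0 mul1r addr0.
have sf' := smooth_derive1 sf; have sg' := smooth_derive1 sg.
have h (x : R) : is_derive x (1 : R) (f \* g)
    (((derive1 f \* g) \+ (f \* derive1 g)) x).
  have := is_deriveM (derive1P (@smooth_derivable _ x sf)) (derive1P (@smooth_derivable _ x sg)).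
  by move/is_derive_eq; apply; rewrite /= addrC [g x *: _]mulrC.
rewrite (D0_is_derive n h).
rewrite D0D; [|exact: smoothM..].
rewrite !IH//.
rewrite [RHS]big_ord_recl /= bin0 subn0 mul1r.
rewrite [X in _ + X = _]big_ord_recl /= bin0 subn0 mul1r -D0S addrCA; congr (_ + _).
under [X in _ = X]eq_bigr => i _ do rewrite /bump /= add1n subSS binS natrD !mulrDl.
rewrite [RHS]big_split /= addrC; congr (_ + _).
  rewrite [RHS]big_ord_recr /= bin_small// !mul0r addr0.
  by apply: eq_bigr => i _; rewrite /bump /= add1n -D0S subnSK.
by apply: eq_bigr => i _; rewrite -D0S.
Qed.

Lemma D0Zl n c f : smooth f -> D0 n (fun x => c * f x) = c * D0 n f.
Proof.
move=> sf; rewrite -[LHS]/(D0 n (cst c \* f)) D0M//; last exact: smooth_cst.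
rewrite big_ord_recl /= bin0 mul1r D0_cst subn0 big1 ?addr0// => i _.
by rewrite D0_cst mulr0 mul0r.
Qed.

Lemma D0N n f : smooth f -> D0 n (\- f) = - D0 n f.
Proof.
move=> sf; have -> : (\- f) = fun x => (-1) * f x.
  by apply/funext => x; rewrite /= mulN1r.
by rewrite D0Zl// mulN1r.
Qed.

Lemma D0B n f g : smooth f -> smooth g -> D0 n (f \- g) = D0 n f - D0 n g.
Proof.
move=> sf sg; have -> : (f \- g) = (f \+ (\- g)) by apply/funext.
by rewrite D0D ?D0N//; exact: smoothN.
Qed.

Lemma D0_scale n f a : smooth f -> D0 n (fun x => f (a * x)) = a ^+ n * D0 n f.
Proof.
elim: n f => [|n IH] f sf; first by rewrite mul1r /D0 /= mulr0.
have h (x : R) : is_derive x (1 : R) (fun x => f (a * x)) (a * derive1 f (a * x)).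
  have ax : is_derive x (1 : R) ( *%R a) a.
    by have := is_deriveZ a (is_derive_id x (1 : R)); move/is_derive_eq; apply; rewrite scaler1.
  have := is_derive1_comp (derive1P (@smooth_derivable _ (a * x) sf)) ax.
  by move/is_derive_eq; apply; rewrite /= mulrC.
rewrite (D0_is_derive n h) D0Zl.
  by rewrite IH -?D0S ?exprS ?mulrA//; exact: smooth_derive1.
by apply: smooth_scale; exact: smooth_derive1.
Qed.

Lemma D0_expR n : D0 n expR = 1.
Proof.
elim: n => [|n IH]; first by rewrite /D0 /= expR0.
by rewrite (@D0_is_derive _ _ expR).
Qed.

Lemma smooth_sum (I : Type) (s : seq I) (P : pred I) (F : I -> R -> R) :
  (forall i, P i -> smooth (F i)) -> smooth (fun x => \sum_(i <- s | P i) F i x).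
Proof.
move=> sF; elim: s => [|i s IH].
  by rewrite (_ : (fun x => _) = cst 0)//; [exact: smooth_cst|apply/funext => x; rewrite big_nil].
case: (boolP (P i)) => Pi.
  rewrite (_ : (fun x => _) = F i \+ (fun x => \sum_(i <- s | P i) F i x)).
    by apply: smoothD => //; exact: sF.
  by apply/funext => x; rewrite big_cons Pi.
rewrite (_ : (fun x => _) = (fun x => \sum_(i <- s | P i) F i x))//.
by apply/funext => x; rewrite big_cons (negbTE Pi).
Qed.

Lemma smooth_prod (I : Type) (s : seq I) (P : pred I) (F : I -> R -> R) :
  (forall i, P i -> smooth (F i)) -> smooth (fun x => \prod_(i <- s | P i) F i x).
Proof.
move=> sF; elim: s => [|i s IH].
  by rewrite (_ : (fun x => _) = cst 1)//; [exact: smooth_cst|apply/funext => x; rewrite big_nil].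
case: (boolP (P i)) => Pi.
  rewrite (_ : (fun x => _) = F i \* (fun x => \prod_(i <- s | P i) F i x)).
    by apply: smoothM => //; exact: sF.
  by apply/funext => x; rewrite big_cons Pi.
rewrite (_ : (fun x => _) = (fun x => \prod_(i <- s | P i) F i x))//.
by apply/funext => x; rewrite big_cons (negbTE Pi).
Qed.

Lemma D0_sum n (I : Type) (s : seq I) (P : pred I) (F : I -> R -> R) :
  (forall i, P i -> smooth (F i)) ->
  D0 n (fun x => \sum_(i <- s | P i) F i x) = \sum_(i <- s | P i) D0 n (F i).
Proof.
move=> sF; elim: s => [|i s IH].
  rewrite big_nil (_ : (fun x => _) = cst 0) ?D0_cst ?if_same//.
  by apply/funext => x; rewrite big_nil.
rewrite big_cons; case: ifPn => Pi.
  rewrite (_ : (fun x => _) = F i \+ (fun x => \sum_(i <- s | P i) F i x)).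
    by rewrite D0D ?IH//; [exact: sF|exact: smooth_sum].
  by apply/funext => x; rewrite big_cons Pi.
rewrite (_ : (fun x => _) = (fun x => \sum_(i <- s | P i) F i x))//.
by apply/funext => x; rewrite big_cons (negbTE Pi).
Qed.

End smooth.

Lemma pow_le_expR (R : realType) (n : nat) (x : R) : 0 <= x -> x ^+ n <= n`!%:R * expR x.
Proof.
move=> x0; rewrite mulrC -ler_pdivrMr ?ltr0n ?fact_gt0//.
case: n => [|n].
  by rewrite expr0 fact0 divr1; apply: le_trans (expR_ge1Dx x); rewrite lerDl.
by apply: le_trans (expR_ge1Dxn n x0); rewrite lerDr.
Qed.

Lemma expR_norm_le (R : realType) (x : R) : expR `|x| <= expR x + expR (- x).
Proof. by case: (ger0P x) => _; rewrite (lerDl, lerDr) expR_ge0. Qed.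

(** * Exponential moments *)

Section moments.
Context (R : realType) (dp : measure_display) (T : measurableType dp)
  (P : probability T R) (X : {RV P >-> R}).

(** Asking for every real s makes the moment generating function smooth on the whole line, so no
    radius of convergence appears. *)
Definition exp_integrable : Prop :=
  forall s : R, P.-integrable [set: T] (EFin \o (fun w => expR (s * X w))).

Definition mgf (s : R) : R := fine ('M_P X s).

Lemma mgfE s : mgf s = \int[P]_w expR (s * X w).
Proof.
rewrite /mgf /mmt_gen_fun unlock /Rintegral; congr fine.
by apply: eq_integral => w _; rewrite /= mulrC.
Qed.

Definition moment (n : nat) : R := \int[P]_w (X w ^+ n).

Hypothesis eX : exp_integrable.

Lemma le_integrable_real (f g : T -> R) : measurable_fun setT f ->
  (forall w, `|f w| <= g w) -> P.-integrable setT (EFin \o g) ->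
  P.-integrable setT (EFin \o f).
Proof.
move=> mf fg; apply: le_integrable => //; first exact/measurable_EFinP.
by move=> w _; rewrite /= lee_fin (le_trans (fg w))// ler_norm.
Qed.

Lemma integrable_exp_norm (c : R) :
  P.-integrable setT (EFin \o (fun w => expR (c * `|X w|))).
Proof.
have : P.-integrable setT (EFin \o (fun w => expR (c * X w) + expR ((- c) * X w))).
  have := integrableD measurableT (eX c) (eX (- c)).
  by congr (_.-integrable _ _); apply/funext => w /=; rewrite EFinD.
apply: le_integrable_real.
  by apply: measurableT_comp => //; apply: measurable_funM => //; exact: measurableT_comp.
move=> w; rewrite ger0_norm ?expR_ge0//.
by case: (ger0P (X w)) => _; rewrite ?mulrN ?mulNr (lerDl, lerDr) expR_ge0.
Qed.

Lemma measurable_pow_exp n s : measurable_fun setT (fun w => X w ^+ n * expR (s * X w)).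
Proof.
apply: measurable_funM; first exact: measurable_funX.
by apply: measurableT_comp => //; exact: measurable_funM.
Qed.

Lemma pow_exp_le n s c w : `|s| <= c -> 
  `|X w ^+ n * expR (s * X w)| <= n`!%:R * expR ((c + 1) * `|X w|).
Proof.
move=> sc; rewrite normrM normrX (ger0_norm (expR_ge0 _)).
rewrite mulrDl mul1r addrC expRD mulrA ler_pM ?exprn_ge0 ?expR_ge0//.
  exact: pow_le_expR.
rewrite ler_expR (le_trans (ler_norm _))// normrM ler_wpM2r//.
Qed.

Lemma integrable_pow_exp n s :
  P.-integrable setT (EFin \o (fun w => X w ^+ n * expR (s * X w))).
Proof.
apply: (@le_integrable_real _ (fun w => n`!%:R * expR ((`|s| + 1) * `|X w|))).
- exact: measurable_pow_exp.
- by move=> w; exact: pow_exp_le.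
- have := integrableZl measurableT n`!%:R (integrable_exp_norm (`|s| + 1)).
  by congr (_.-integrable _ _).
Qed.

Lemma integrable_pow n : P.-integrable setT (EFin \o (fun w => X w ^+ n)).
Proof.
have := integrable_pow_exp n 0; congr (_.-integrable _ _).
by apply/funext => w /=; rewrite mul0r expR0 mulr1.
Qed.

Lemma is_derive_pow_exp n w (s : R) :
  is_derive s (1 : R) (fun s => X w ^+ n * expR (s * X w)) (X w ^+ n.+1 * expR (s * X w)).
Proof.
have ax : is_derive s (1 : R) (fun s : R => s * X w) (X w).
  rewrite (_ : (fun s => _) = X w \*: id).
    by have := is_deriveZ (X w) (is_derive_id s (1 : R)); move/is_derive_eq; apply; rewrite scaler1.
  by apply/funext => y; rewrite /= mulrC.
have := is_deriveZ (X w ^+ n) (@is_derive1_comp _ expR (fun s : R => s * X w) s _ _ (is_derive_expR (s * X w)) ax).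
by move/is_derive_eq; apply; rewrite exprSr -mulrA [_ * expR _]mulrC.
Qed.

Lemma is_derive_moment_exp n (s : R) :
  is_derive s (1 : R) (fun s => \int[P]_w (X w ^+ n * expR (s * X w)))
    (\int[P]_w (X w ^+ n.+1 * expR (s * X w))).
Proof.
(* For |x - s| < 1 one has |x| <= |s| + 1, and a second 1 in the exponent absorbs the power, as
   |X|^(n+1) <= (n+1)! e^|X|. *)
pose G w := n.+1`!%:R * expR ((`|s| + 1 + 1) * `|X w|).
have p1 : partial1of2 (fun s w => X w ^+ n * expR (s * X w)) =
    (fun s w => X w ^+ n.+1 * expR (s * X w)).
  by apply/funext => x; apply/funext => w; rewrite partial1of2E; apply: derive_val;
    exact: is_derive_pow_exp.
have Is : `]s - 1, s + 1[%classic s by rewrite /= in_itv /= ltrBlDr ltrDl ltr01.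
have intf x : `]s - 1, s + 1[%classic x ->
    P.-integrable setT (EFin \o (fun w => X w ^+ n * expR (x * X w))).
  by move=> _; exact: integrable_pow_exp.
have df x w : `]s - 1, s + 1[%classic x -> [set: T] w ->
    derivable ((fun s w => X w ^+ n * expR (s * X w))^~ w) x 1.
  by move=> _ _; have [] := is_derive_pow_exp n w x.
have G0 w : 0 <= G w by rewrite mulr_ge0// expR_ge0.
have iG : P.-integrable setT (EFin \o G).
  have := integrableZl measurableT n.+1`!%:R (integrable_exp_norm (`|s| + 1 + 1)).
  by congr (_.-integrable _ _).
have Gub x w : `]s - 1, s + 1[%classic x -> [set: T] w ->
    `|partial1of2 (fun s w => X w ^+ n * expR (s * X w)) x w| <= G w.
  rewrite /= in_itv /= => /andP[xs sx] _; rewrite p1; apply: pow_exp_le.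
  by have := ler_norm s; have := ler_norm (- s); rewrite normrN ler_norml; lra.
apply: DeriveDef.
  exact: (derivable_under_integral measurableT Is intf df G0 iG Gub).
rewrite -derive1E (differentiation_under_integral measurableT Is intf df G0 iG Gub).
by apply: eq_Rintegral => w _; rewrite p1.
Qed.

Lemma smooth_mgf : smooth mgf.
Proof.
have -> : mgf = fun s => \int[P]_w (X w ^+ 0 * expR (s * X w)).
  by apply/funext => s; rewrite mgfE; apply: eq_Rintegral => w _; rewrite mul1r.
move=> k; elim: k 0%N => // k IH n.
exact: (Ck_is_derive (@is_derive_moment_exp n)).
Qed.

Lemma D0_mgf n : D0 n mgf = moment n.
Proof.
have -> : mgf = fun s => \int[P]_w (X w ^+ 0 * expR (s * X w)).
  by apply/funext => s; rewrite mgfE; apply: eq_Rintegral => w _; rewrite mul1r.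
suff H k : D0 n (fun s => \int[P]_w (X w ^+ k * expR (s * X w))) = moment (k + n) by rewrite H.
elim: n k => [|n IH] k.
  by rewrite addn0; apply: eq_Rintegral => w _; rewrite mul0r expR0 mulr1.
by rewrite (D0_is_derive n (@is_derive_moment_exp k)) IH addSnnS.
Qed.

Lemma mgf0 : mgf 0 = 1.
Proof.
rewrite mgfE (@eq_Rintegral _ _ _ P _ (cst 1)).
  by rewrite Rintegral_cst//= probability_setT /= mulr1.
by move=> w _; rewrite mul0r expR0.
Qed.

(** Jensen's inequality, from the tangent of exp at c = s E[X]. It also gives the positivity
    required under the logarithm. *)
Lemma mgf_ge_expR s : expR (s * moment 1) <= mgf s.
Proof.
pose c := s * moment 1.
have iX : P.-integrable setT (EFin \o X).
  by have := integrable_pow 1; congr (_.-integrable _ _).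
have isX : P.-integrable setT (EFin \o (fun w => s * X w)).
  by have := integrableZl measurableT s iX; congr (_.-integrable _ _).
have i1 : P.-integrable setT (EFin \o (fun w => expR c * (1 - c) + 0 * X w)).
  have := finite_measure_integrable_cst P (expR c * (1 - c)) measurableT.
  by congr (_.-integrable _ _); apply/funext => w /=; rewrite mul0r addr0.
have i2 : P.-integrable setT (EFin \o (fun w => expR c * (s * X w))).
  by have := integrableZl measurableT (expR c) isX; congr (_.-integrable _ _).
have i3 : P.-integrable setT (EFin \o (fun w => (expR c * (1 - c) + 0 * X w) + expR c * (s * X w))).
  by have := integrableD measurableT i1 i2; congr (_.-integrable _ _).
have -> : expR (s * moment 1) =
    \int[P]_w ((expR c * (1 - c) + 0 * X w) + expR c * (s * X w)).
  rewrite RintegralD// RintegralZl// RintegralZl//.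
  rewrite (_ : \int[P]_w (_ + 0 * _) = expR c * (1 - c)).
    have -> : \int[P]_w X w = moment 1 by apply: eq_Rintegral => w _; rewrite expr1.
    by rewrite -/c mulrBr mulr1 subrK.
  rewrite (@eq_Rintegral _ _ _ P _ (cst (expR c * (1 - c)))).
    by rewrite Rintegral_cst//= probability_setT /= mulr1.
  by move=> w _ /=; rewrite mul0r addr0.
rewrite mgfE; apply: le_Rintegral => // w _.
rewrite mul0r addr0 -mulrDr.
have -> : expR (s * X w) = expR c * expR (s * X w - c) by rewrite -expRD addrC subrK.
by rewrite ler_wpM2l ?expR_ge0// (le_trans _ (expR_ge1Dx _))//; lra.
Qed.

Lemma mgf_gt0 s : 0 < mgf s.
Proof. exact: lt_le_trans (expR_gt0 _) (mgf_ge_expR s). Qed.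

End moments.

(** The identity turns a law on the line into a random variable, so that the results on random
    variables cover the uniform and normal laws. *)
Definition id_rv (R : realType) : measurableTypeR R -> R := idfun.

HB.instance Definition _ (R : realType) :=
  @isMeasurableFun.Build _ _ _ _ (@id_rv R) (@measurable_id _ _ setT).

(** * Uniform laws and Bernoulli numbers *)

Section uniform_mgf.
Variable R : realType.
Implicit Types a b s t x : R.

(* sinh(x/2) / (x/2); at x = t s this is the moment generating function of
   U[-t/2, t/2] at s. *)
Definition unif_mgf x : R := if x == 0 then 1 else (expR (x / 2) - expR (- (x / 2))) / x.

Lemma integral_expR_itv a b s : a < b -> s != 0 ->
  (\int[lebesgue_measure]_(x in `[a, b]) (expR (s * x))%:E =
   ((expR (s * b) - expR (s * a)) / s)%:E)%E.
Proof.
move=> ab s0.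
pose F x := expR (s * x) / s.
have dF x : is_derive x (1 : R) F (expR (s * x)).
  have ax : is_derive x (1 : R) ( *%R s) s.
    by have := is_deriveZ s (is_derive_id x (1 : R)); move/is_derive_eq; apply; rewrite scaler1.
  have := is_deriveZ s^-1 (@is_derive1_comp _ expR ( *%R s) x _ _ (is_derive_expR (s * x)) ax).
  rewrite (_ : s^-1 \*: (expR \o _) = F); last by apply/funext => y; rewrite /F mulrC.
  by move/is_derive_eq; apply; rewrite [LHS]mulrC mulfK.
have cF : continuous F.
  by move=> x; apply/differentiable_continuous/derivable1_diffP; have [] := dF x.
have ce : continuous (fun x => expR (s * x)).
  by move=> x; apply: continuous_comp; [exact: mulrl_continuous|exact: continuous_expR].
rewrite (@continuous_FTC2 _ _ F a b ab).
- by rewrite /F -EFinB mulrBl.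
- exact: continuous_subspaceT.
- split.
  + by move=> x _; have [] := dF x.
  + by apply: cvg_at_right_filter; exact: cF.
  + by apply: cvg_at_left_filter; exact: cF.
- by move=> x _; rewrite derive1E; exact: derive_val.
Qed.

Lemma integral_uniform_expR a b (ab : a < b) s :
  (\int[uniform_prob ab]_x (expR (s * x))%:E =
   (if s == 0 then 1 else (expR (s * b) - expR (s * a)) / (s * (b - a)))%:E)%E.
Proof.
have me : measurable_fun [set: R] (fun x => (expR (s * x))%:E : \bar R).
  apply/measurable_EFinP; apply: measurableT_comp => //; exact: measurable_funM.
rewrite integral_uniform//.
have [->|s0] := eqVneq s 0.
  rewrite (eq_integral (cst 1%E)); last by move=> x _; rewrite mul0r expR0.
  rewrite integral_cst//= mul1e lebesgue_measure_itv/= lte_fin ab -EFinB -EFinM.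
  by rewrite mulVf// gt_eqF// subr_gt0.
by rewrite integral_expR_itv// -EFinM mulrC -mulrA -invfM.
Qed.

Let half_lt : - (1 / 2) < 1 / 2 :> R. Proof. lra. Qed.
Let U : {RV (uniform_prob half_lt) >-> R} := @id_rv R.

Lemma uniform_exp_integrable a b (ab : a < b) :
  @exp_integrable R _ _ (uniform_prob ab) (@id_rv R).
Proof.
move=> s; apply/integrableP; split.
  apply/measurable_EFinP; apply: measurableT_comp => //; exact: measurable_funM.
under eq_integral => x _ do rewrite /= ger0_norm ?expR_ge0//.
by rewrite integral_uniform_expR ltry.
Qed.

Lemma integral_uniform_unif_mgf t s (ab : - (t / 2) < t / 2) :
  (\int[uniform_prob ab]_x (expR (s * x))%:E = (unif_mgf (t * s))%:E)%E.
Proof.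
rewrite integral_uniform_expR /unif_mgf mulf_eq0.
have t0 : t != 0 by move: ab; apply: contraTneq => ->; rewrite mul0r oppr0 ltxx.
rewrite (negbTE t0) /=; case: ifPn => // s0; congr (_%:E).
congr (_ / _); last by field.
by congr (expR _ - expR _); field.
Qed.

(** Being a moment generating function, [unif_mgf] is smooth and positive even at the removable
    singularity 0. *)
Lemma unif_mgfE : unif_mgf = mgf U.
Proof.
apply/funext => s; rewrite mgfE /Rintegral integral_uniform_expR /unif_mgf /=.
case: ifPn => // s0; congr (_ / _); last by field.
by congr (expR _ - expR _); field.
Qed.

Lemma smooth_unif_mgf : smooth unif_mgf.
Proof. by rewrite unif_mgfE; apply: smooth_mgf; exact: uniform_exp_integrable. Qed.

Lemma unif_mgf_gt0 x : 0 < unif_mgf x.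
Proof. by rewrite unif_mgfE; apply: mgf_gt0; exact: uniform_exp_integrable. Qed.

Lemma unif_mgfM x : x * unif_mgf x = expR (x / 2) - expR (- (x / 2)).
Proof.
rewrite /unif_mgf; case: eqP => [->|/eqP x0]; last by rewrite mulrC divfK.
by rewrite !mul0r oppr0 expR0 subrr.
Qed.

Lemma unif_mgfN x : unif_mgf (- x) = unif_mgf x.
Proof.
rewrite /unif_mgf oppr_eq0; case: ifPn => // x0.
by rewrite mulNr opprK invrN mulrN -mulNr opprB.
Qed.

Lemma unif_mgf0 : unif_mgf 0 = 1. Proof. by rewrite /unif_mgf eqxx. Qed.

(* Equal to (exp x - 1) / x. *)
Definition exp_mean x : R := expR (2^-1 * x) * unif_mgf x.

Lemma exp_mean_gt0 x : 0 < exp_mean x.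
Proof. by rewrite mulr_gt0 ?expR_gt0 ?unif_mgf_gt0. Qed.

Lemma smooth_exp_mean : smooth exp_mean.
Proof.
by apply: smoothM; [apply: (smooth_scale (f := expR)); exact: smooth_expR|exact: smooth_unif_mgf].
Qed.

Lemma exp_meanM x : x * exp_mean x = expR x - 1.
Proof.
rewrite mulrCA unif_mgfM mulrBr -!expRD.
have -> : 2^-1 * x + x / 2 = x by field.
have -> : 2^-1 * x + - (x / 2) = 0 by field.
by rewrite expR0.
Qed.

Lemma D0_idM n (f : R -> R) : smooth f -> D0 n.+1 (id \* f) = n.+1%:R * D0 n f.
Proof.
move=> sf; rewrite D0M//; last exact: smooth_id.
rewrite big_ord_recl [X in X + _](_ : _ = 0) ?add0r; last by rewrite D0_id mulr0 mul0r.
rewrite big_ord_recl big1 ?addr0 => [|i _]; last first.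
  by rewrite D0_id /bump /= mulr0 mul0r.
by rewrite D0_id /bump /= bin1 mulr1 subn1.
Qed.

Lemma D0_exp_mean n : D0 n exp_mean = n.+1%:R^-1.
Proof.
have := D0_idM n smooth_exp_mean.
have -> : id \* exp_mean = expR \- cst 1 by apply/funext => x; rewrite /= exp_meanM.
rewrite D0B; [|exact: smooth_expR|exact: smooth_cst].
rewrite D0_expR D0_cst /= subr0 => /esym /(congr1 ( *%R n.+1%:R^-1)).
by rewrite mulKf ?pnatr_eq0// mulr1.
Qed.

Lemma size_bernoulli_seq (F : fieldType) n : size (bernoulli_seq F n) = n.
Proof. by elim: n => //= n IH; rewrite size_rcons IH. Qed.

Lemma nth_bernoulli_seq (F : fieldType) n k : (k < n)%N ->
  (bernoulli_seq F n)`_k = bernoulli F k.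
Proof.
elim: n => // n IH kn; rewrite ltnS leq_eqVlt in kn.
case/orP: kn => [/eqP ->//|kn].
by rewrite /= nth_rcons size_bernoulli_seq kn IH.
Qed.

Lemma bernoulliE (F : fieldType) n : bernoulli F n =
  ((n == 0%N)%:R - \sum_(k < n) 'C(n.+1, k)%:R * bernoulli F k) / n.+1%:R.
Proof.
rewrite {1}/bernoulli /= nth_rcons size_bernoulli_seq ltnn eqxx.
by congr ((_ - _) / _); apply: eq_bigr => k _; rewrite nth_bernoulli_seq.
Qed.

(** The exponential generating function x / (e^x - 1) of the Bernoulli numbers. *)
Definition bernoulli_gf x : R := (exp_mean x)^-1.

Lemma smooth_bernoulli_gf : smooth bernoulli_gf.
Proof.
by apply: smoothV; [move=> x; rewrite gt_eqF ?exp_mean_gt0|exact: smooth_exp_mean].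
Qed.

(** The k-th coefficient of the product with (e^x - 1) / x is that of the constant 1. Multiplied by
    k + 1, and with (k+1) C(k,i) / (k-i+1) = C(k+1,i), this is the recursion defining the Bernoulli
    numbers. *)
Lemma D0_bernoulli_gf n : D0 n bernoulli_gf = bernoulli R n.
Proof.
have step k : \sum_(i < k.+1) 'C(k.+1, i)%:R * D0 i bernoulli_gf = (k == 0%N)%:R.
  transitivity (k.+1%:R * D0 k (bernoulli_gf \* exp_mean)).
    rewrite D0M; [|exact: smooth_bernoulli_gf|exact: smooth_exp_mean].
    rewrite mulr_sumr; apply: eq_bigr => i _; rewrite D0_exp_mean.
    have ik : (i <= k)%N by rewrite -ltnS.
    have := mul_bin_down k.+1 i; rewrite /= subSn// => /(congr1 (fun m : nat => m%:R : R)).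
    rewrite !natrM => h; rewrite mulrA mulrA h mulrAC.
    by rewrite [_ * 'C(_, _)%:R]mulrC mulfK ?pnatr_eq0.
  have -> : bernoulli_gf \* exp_mean = cst 1 by apply/funext => x; rewrite /= mulVf// gt_eqF ?exp_mean_gt0.
  by rewrite D0_cst; case: k => [|k]; rewrite ?mulr1 ?mulr0.
elim/ltn_ind: n => n IH.
have := step n; rewrite big_ord_recr /= binSn => h; rewrite bernoulliE.
have <- : \sum_(k < n) 'C(n.+1, k)%:R * D0 k bernoulli_gf = \sum_(k < n) 'C(n.+1, k)%:R * bernoulli R k.
  by apply: eq_bigr => k _; rewrite IH.
have -> : (n == 0%N)%:R - \sum_(k < n) 'C(n.+1, k)%:R * D0 k bernoulli_gf = n.+1%:R * D0 n bernoulli_gf.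
  by rewrite -h; ring.
by rewrite mulrC mulKf ?pnatr_eq0.
Qed.

Definition ln_unif_mgf x : R := ln (unif_mgf x).

Lemma smooth_ln_unif_mgf : smooth ln_unif_mgf.
Proof. by apply: smooth_ln; [exact: unif_mgf_gt0|exact: smooth_unif_mgf]. Qed.

(** With E = (e^x - 1) / x, the logarithm of [unif_mgf] is log E - x/2, and x E'/E = x - 1 + x /
    (e^x - 1), whose coefficients are known. Removing the factor x divides by the order, hence B_n /
    n. *)
Lemma D0_ln_unif_mgf n : D0 n ln_unif_mgf = if (n < 2)%N then 0 else bernoulli R n / n%:R.
Proof.
case: n => [|n]; first by rewrite /D0 /= /ln_unif_mgf unif_mgf0 ln1.
have gE : ln_unif_mgf = (fun x => ln (exp_mean x)) \- (fun x => 2^-1 * x).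
  apply/funext => x; rewrite /ln_unif_mgf /= /exp_mean lnM ?posrE ?expR_gt0 ?unif_mgf_gt0//.
  by rewrite expRK addrAC subrr add0r.
have sl : smooth (fun x => ln (exp_mean x)) by apply: smooth_ln; [exact: exp_mean_gt0|exact: smooth_exp_mean].
have sh : smooth (fun x : R => 2^-1 * x) by apply: (smooth_scale (f := id)); exact: smooth_id.
rewrite gE D0B// D0Zl; last exact: smooth_id.
pose u x : R := derive1 exp_mean x * bernoulli_gf x.
have su : smooth u.
  by apply: smoothM; [apply: smooth_derive1; exact: smooth_exp_mean|exact: smooth_bernoulli_gf].
have h (x : R) : is_derive x (1 : R) (fun x => ln (exp_mean x)) (u x).
  by apply: derive1_ln; [exact: exp_mean_gt0|exact: smooth_exp_mean].
rewrite (D0_is_derive n h) D0_id.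
have uE : id \* u = (id \- cst 1) \+ bernoulli_gf.
  apply/funext => x; have e0 : exp_mean x != 0 by rewrite gt_eqF ?exp_mean_gt0.
  have d1 : is_derive x (1 : R) (id \* exp_mean) (x * derive1 exp_mean x + exp_mean x).
    have := is_deriveM (is_derive_id x (1 : R)) (derive1P (@smooth_derivable _ _ x smooth_exp_mean)).
    by move/is_derive_eq; apply; rewrite scaler1.
  have d2 : is_derive x (1 : R) (expR \- cst 1) (expR x - 0).
    exact: is_deriveB.
  have E12 : id \* exp_mean = expR \- cst 1 by apply/funext => y; rewrite /= exp_meanM.
  have : x * derive1 exp_mean x + exp_mean x = expR x.
    have [_ <-] := d1; rewrite E12; have [_ ->] := d2; exact: subr0.
  move=> h0; have h1 : x * derive1 exp_mean x = expR x - exp_mean x by rewrite -h0 addrK.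
  have h2 := exp_meanM x.
  have h3 : expR x = x * exp_mean x + 1 by rewrite h2 subrK.
  by rewrite /= /u /bernoulli_gf mulrA h1 h3; field.
have := D0_idM n su; rewrite uE D0D; [|apply: smoothB; [exact: smooth_id|exact: smooth_cst]|exact: smooth_bernoulli_gf].
rewrite D0B; [|exact: smooth_id|exact: smooth_cst].
rewrite D0_id D0_cst D0_bernoulli_gf subr0 => /esym /(congr1 ( *%R n.+1%:R^-1)).
rewrite mulKf ?pnatr_eq0// => ->.
(* In order 1 the term x adds 1 to B_1 = -1/2, and the sum 1/2 is cancelled by the derivative of
   x/2. *)
case: n => [|n] /=; last by rewrite add0r mulr0 subr0 mulrC.
have -> : bernoulli R 1 = - 2^-1.
  by rewrite bernoulliE big_ord_recl big_ord0 bernoulliE big_ord0 /= bin0; field.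
by rewrite /= invr1; lra.
Qed.

(* [(x/2) coth(x/2)] satisfies a Riccati equation; comparing Taylor coefficients,
   the numbers B_(2k) alternate in sign. *)

Let half_coth x : R := bernoulli_gf x + 2^-1 * x.

Let smooth_half_coth : smooth half_coth.
Proof.
by apply: smoothD; [exact: smooth_bernoulli_gf|apply: (smooth_scale (f := id)); exact: smooth_id].
Qed.

Let D0_half_coth n : (2 <= n)%N -> D0 n half_coth = bernoulli R n.
Proof.
move=> n2; rewrite D0D; [|exact: smooth_bernoulli_gf|apply: (smooth_scale (f := id)); exact: smooth_id].
rewrite D0_bernoulli_gf D0Zl; last exact: smooth_id.
by rewrite D0_id; case: n n2 => [|[|n]]//= _; rewrite mulr0 addr0.
Qed.

Let half_cothN x : half_coth (- x) = half_coth x.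
Proof.
have e0 : exp_mean x != 0 by rewrite gt_eqF ?exp_mean_gt0.
have e1 : exp_mean (- x) != 0 by rewrite gt_eqF ?exp_mean_gt0.
rewrite /half_coth /bernoulli_gf.
have ee : exp_mean (- x) = exp_mean x * expR (- x).
  by rewrite /exp_mean unif_mgfN mulrAC -expRD; congr (expR _ * _); field.
rewrite ee invfM expRN invrK.
have -> : expR x = x * exp_mean x + 1 by rewrite exp_meanM subrK.
by field.
Qed.

Let D0_half_coth_odd n : odd n -> D0 n half_coth = 0.
Proof.
move=> on; have := D0_scale n (-1) smooth_half_coth.
have -> : (fun x => half_coth (-1 * x)) = half_coth by apply/funext => x; rewrite mulN1r half_cothN.
rewrite -signr_odd on expr1 mulN1r => /eqP; rewrite -addr_eq0 -mulr2n mulrn_eq0 /=.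
by move/eqP.
Qed.

Let half_coth_ode x : x * derive1 half_coth x = half_coth x - half_coth x * half_coth x + 4^-1 * (x * x).
Proof.
have e0 : exp_mean x != 0 by rewrite gt_eqF ?exp_mean_gt0.
have d1 : is_derive x (1 : R) (id \* exp_mean) (x * derive1 exp_mean x + exp_mean x).
  have := is_deriveM (is_derive_id x (1 : R)) (derive1P (@smooth_derivable _ _ x smooth_exp_mean)).
  by move/is_derive_eq; apply; rewrite scaler1.
have d2 : is_derive x (1 : R) (expR \- cst 1) (expR x - 0) by exact: is_deriveB.
have E12 : id \* exp_mean = expR \- cst 1 by apply/funext => y; rewrite /= exp_meanM.
have h1 : x * derive1 exp_mean x + exp_mean x = x * exp_mean x + 1.
  by have [_ <-] := d1; rewrite E12; have [_ ->] := d2; rewrite exp_meanM subrK subr0.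
have d3 : is_derive x (1 : R) half_coth (- (exp_mean x) ^- 2 * derive1 exp_mean x + 2^-1).
  apply: is_deriveD.
    exact: (is_deriveV e0 (derive1P (@smooth_derivable _ _ x smooth_exp_mean))).
  by have := is_deriveZ (2^-1 : R) (is_derive_id x (1 : R)); move/is_derive_eq; apply; rewrite scaler1.
have -> : derive1 half_coth x = - (exp_mean x) ^- 2 * derive1 exp_mean x + 2^-1.
  by rewrite derive1E; have [_ ->] := d3.
have -> : x * (- (exp_mean x) ^- 2 * derive1 exp_mean x + 2^-1) =
    - (exp_mean x) ^- 2 * (x * derive1 exp_mean x + exp_mean x) + (exp_mean x)^-1 + 2^-1 * x.
  by field.
by rewrite h1 /half_coth /bernoulli_gf; field.
Qed.

(** The two extreme Leibniz terms of f^2 both equal c_n, because c_0 = 1. Thus n c_n = c_n - 2 c_n -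
    ..., and the coefficient on the left becomes n + 1. *)
Let D0_half_coth_rec n : (0 < n)%N -> n.+1%:R * D0 n half_coth =
  (n == 2%N)%:R / 2 - \sum_(k < n.-1) 'C(n, k.+1)%:R * D0 k.+1 half_coth * D0 (n - k.+1) half_coth.
Proof.
case: n => // n _.
have c0 : D0 0 half_coth = 1.
  by rewrite /D0 /= /half_coth /bernoulli_gf /exp_mean mulr0 expR0 unif_mgf0 mul1r invr1 addr0.
have ode : id \* derive1 half_coth = (half_coth \- (half_coth \* half_coth)) \+ (fun x => 4^-1 * (id \* id) x).
  by apply/funext => x; rewrite /= half_coth_ode.
have s1 := smooth_derive1 smooth_half_coth.
have s2 := smoothM smooth_half_coth smooth_half_coth.
have s3 : smooth (id \* id : R -> R) by apply: smoothM; exact: smooth_id.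
have s4 : smooth (fun x : R => 4^-1 * (id \* id) x).
  by apply: (smoothM (f := cst 4^-1) (g := id \* id)) => //; exact: smooth_cst.
have := D0_idM n s1; rewrite ode D0D//; last exact: smoothB.
rewrite D0B// D0Zl// D0_idM; last exact: smooth_id.
rewrite D0_id -D0S D0M// big_ord_recl big_ord_recr /= bin0 /bump /= add1n binn !mul1r.
rewrite subn0 subnn c0 mul1r mulr1.
set S := \sum_(i < n) _ => h.
suff : n.+2%:R * D0 n.+1 half_coth = (n.+1 == 2%N)%:R / 2 - S by [].
have h4 : 4^-1 * (n.+1%:R * (n == 1%N)%:R) = (n == 1%N)%:R / 2 :> R.
  by case: n {h S} => [|[|n]] /=; rewrite ?mulr0 ?mul0r ?mulr1//; field.
rewrite h4 in h; rewrite -natr1 mulrDl -h eqSS; ring.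
Qed.

(** By induction the term with indices 2j and 2(k-j) has sign (-1)^(j+1) (-1)^(k-j+1) = (-1)^k, the
    odd terms vanish, and the minus sign of the recursion gives (-1)^(k+1). Nothing can cancel. *)
Let D0_half_coth_sign k : (0 < k)%N -> 0 < (-1) ^+ k.+1 * D0 k.*2 half_coth.
Proof.
elim/ltn_ind: k => k IH k0.
have k20 : (0 < k.*2)%N by rewrite double_gt0.
rewrite -(pmulr_rgt0 _ (ltr0Sn R k.*2)) mulrCA D0_half_coth_rec//.
have [->|k1] := eqVneq k 1%N.
  rewrite big_ord_recl big_ord0 /= (@D0_half_coth_odd 1)//.
  by rewrite sqrrN expr1n; lra.
have {}k1 : (1 < k)%N by rewrite ltn_neqAle eq_sym k1.
have -> : (k.*2 == 2%N) = false by apply/negbTE; rewrite neq_ltn; apply/orP; right; rewrite -[2%N]/(1.*2) ltn_double.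
rewrite mul0r sub0r mulrN -mulNr mulr_sumr.
have n1 : (0 < k.*2.-1)%N by rewrite -ltnS prednK// -[1%N]/(0.*2.+1) ltn_Sdouble.
have kk : (k.*2.-1.+1 = k.*2)%N by rewrite prednK.
have sgn j : (0 < j)%N -> (j < k)%N ->
    0 < - (-1) ^+ k.+1 * ('C(k.*2, j.*2)%:R * D0 j.*2 half_coth * D0 (k.*2 - j.*2) half_coth).
  move=> j0 jk; have kj0 : (0 < k - j)%N by rewrite subn_gt0.
  have kjk : (k - j < k)%N by rewrite ltn_subrL j0 k0.
  have Hj := IH j jk j0; have Hkj := IH (k - j)%N kjk kj0.
  have -> : - (-1) ^+ k.+1 = (-1) ^+ j.+1 * (-1) ^+ (k - j).+1 :> R.
    by rewrite -exprD addSn addnS subnKC 1?ltnW// [in RHS]exprS mulN1r.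
  rewrite -doubleB; set a := D0 _ _ in Hj *; set b := D0 _ _ in Hkj *.
  have -> : forall x y c : R, x * y * (c * a * b) = c * (x * a) * (y * b) by move=> x y c; ring.
  apply: mulr_gt0 => //; apply: mulr_gt0 => //.
  by rewrite ltr0n bin_gt0 leq_double ltnW.
have T0 (j : 'I_(k.*2.-1)) : 0 <= - (-1) ^+ k.+1 *
    ('C(k.*2, j.+1)%:R * D0 j.+1 half_coth * D0 (k.*2 - j.+1) half_coth).
  case: (boolP (odd j.+1)) => oj; first by rewrite (D0_half_coth_odd oj) mulr0 mul0r mulr0.
  have jE : j.+1 = j.+1./2.*2 by rewrite -[LHS]odd_double_half (negbTE oj).
  have jk : (j.+1 < k.*2)%N by have := ltn_ord j; rewrite -ltnS kk.
  rewrite jE; apply/ltW/sgn; first by rewrite -double_gt0 -jE.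
  by rewrite -ltn_double -jE.
(* The summand of index 1 is the term of order 2; it exists for k > 1 and makes the sum strictly
   positive. *)
have j1 : (1 < k.*2.-1)%N by rewrite -ltnS kk -[2%N]/(1.*2) ltn_double.
rewrite (bigD1 (Ordinal j1))//= ltr_pwDl//; first exact: (sgn 1%N).
by apply: sumr_ge0 => j _; exact: T0.
Qed.

Lemma bernoulli_even_neq0 k : (0 < k)%N -> bernoulli R k.*2 != 0.
Proof.
move=> k0; have := D0_half_coth_sign k0; rewrite D0_half_coth; last by rewrite -[2%N]/(1.*2) leq_double.
by apply: contraTneq => ->; rewrite mulr0 ltxx.
Qed.

End uniform_mgf.

Section unif_mgf_bounds.
Variable R : realType.
Implicit Types x z : R.

(** By evenness, x may be replaced by -x to make x times the mean nonnegative; Jensen's inequality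
    then gives the bound whatever the mean is. *)
Lemma unif_mgf_ge1 x : 1 <= unif_mgf x.
Proof.
have h12 : - (1 / 2) < 1 / 2 :> R by lra.
have H (y : R) :
    expR (y * moment (@id_rv R : {RV (uniform_prob h12) >-> R}) 1) <= unif_mgf y.
  have -> : unif_mgf y = mgf (@id_rv R : {RV (uniform_prob h12) >-> R}) y.
    by rewrite mgfE /Rintegral integral_uniform_unif_mgf /= ?mul1r.
  by apply: mgf_ge_expR; exact: uniform_exp_integrable.
set mu := moment _ _ in H.
have [xm|xm] := leP 0 (x * mu).
  by apply: le_trans (H x); rewrite -[leLHS]expR0 ler_expR.
rewrite -unif_mgfN; apply: le_trans (H (- x)); rewrite -[leLHS]expR0 ler_expR mulNr.
by rewrite oppr_ge0 ltW.
Qed.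

(** The linear term is odd: it drops out on averaging over z and -z, leaving a subgaussian bound.
    For z <= 1/2 use e^z <= 1 / (1 - z), for z > 1/2 use z <= 2 z^2. *)
Lemma expR_le_sqr z : expR z <= z + expR (2 * z ^+ 2).
Proof.
have [z2|z2] := leP z (1 / 2).
  apply: (@le_trans _ _ (z + (1 + 2 * z ^+ 2))); last by rewrite lerD2l expR_ge1Dx.
  have z1 : 0 < 1 - z by lra.
  have h : expR z <= (1 - z)^-1.
    rewrite -[z in leLHS]opprK expRN lef_pV2 ?posrE ?expR_gt0//.
    exact: expR_ge1Dx.
  apply: (le_trans h); rewrite -[leLHS]mul1r ler_pdivrMr//.
  have : 0 <= z ^+ 2 * (1 - 2 * z) by rewrite mulr_ge0 ?sqr_ge0//; lra.
  by move=> h3; rewrite -subr_ge0 (_ : _ - _ = z ^+ 2 * (1 - 2 * z))//; ring.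
have : expR z <= expR (2 * z ^+ 2) by rewrite ler_expR; nra.
lra.
Qed.

(** Average [expR_le_sqr] over x u and - x u with |u| <= 1/2, so that 2 (x u)^2 <= x^2 / 2. *)
Lemma unif_mgf_le_expR x : unif_mgf x <= expR (x ^+ 2 / 2).
Proof.
have h12 : - (1 / 2) < 1 / 2 :> R by lra.
have me (y : R) : measurable_fun [set: R] (fun u => (expR (y * u))%:E : \bar R).
  by apply/measurable_EFinP; apply: measurableT_comp => //; exact: measurable_funM.
have hE (y : R) : ((unif_mgf y)%:E = \int[lebesgue_measure]_(u in `[(- (1 / 2))%R, (1 / 2)%R]) (expR (y * u))%:E)%E.
  rewrite -[y in LHS]mul1r -(integral_uniform_unif_mgf y h12) (integral_uniform h12 (me y))//.
  by rewrite opprK (_ : 1 / 2 + 1 / 2 = 1) ?invr1 ?mul1e//; lra.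
have H : ((unif_mgf x + unif_mgf (- x))%:E <= (2 * expR (x ^+ 2 / 2))%:E)%E.
  rewrite EFinD !hE -ge0_integralD//; last 2 first.
  - exact: (measurable_funTS (me _)).
  - exact: (measurable_funTS (me _)).
  apply: (@le_trans _ _ (\int[lebesgue_measure]_(u in `[(- (1 / 2))%R, (1 / 2)%R]) (2 * expR (x ^+ 2 / 2))%:E)%E).
    apply: ge0_le_integral => //.
    - by move=> u _; rewrite lee_fin addr_ge0 ?expR_ge0.
    - by apply: emeasurable_funD; exact: (measurable_funTS (me _)).
    - move=> u; rewrite /= in_itv /= => /andP[u1 u2]; rewrite -EFinD lee_fin.
      have h1 := expR_le_sqr (x * u); have h2 := expR_le_sqr (- x * u).
      have : expR (2 * (x * u) ^+ 2) <= expR (x ^+ 2 / 2).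
        rewrite ler_expR exprMn.
        have : u ^+ 2 <= 1 / 4 by nra.
        by have x2 := sqr_ge0 x; nra.
      have -> : expR (2 * (x * u) ^+ 2) = expR (2 * (- x * u) ^+ 2) by congr expR; ring.
      by move: h1 h2; rewrite !mulNr sqrrN; lra.
  by rewrite integral_cst//= lebesgue_measure_itv/= lte_fin h12 -EFinB -EFinM lee_fin; lra.
by move: H; rewrite lee_fin unif_mgfN; lra.
Qed.

End unif_mgf_bounds.

(** * The moment generating function of the normal law *)

Section normal_mgf.
Variable R : realType.

(** The Radon-Nikodym derivative of the normal law and its density have the same integral over every
    measurable set, so they agree almost everywhere. *)
Lemma ge0_integral_normal (m s : R) (f : R -> \bar R) :
  measurable_fun [set: R] f -> (forall x, 0 <= f x)%E ->
  (\int[normal_prob m s]_x f x =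
   \int[lebesgue_measure]_x (f x * (normal_pdf m s x)%:E))%E.
Proof.
move=> mf f0; have dom := @normal_prob_dominates R m s.
rewrite -(Radon_Nikodym_SigmaFinite.change_of_variables dom f0 measurableT mf).
have mg := measurable_int _ (Radon_Nikodym_SigmaFinite.f_integrable dom).
have mpdf : measurable_fun [set: R] (fun x => (normal_pdf m s x)%:E).
  by apply/measurable_EFinP; exact: measurable_normal_pdf.
apply: ae_eq_integral => //.
- exact: emeasurable_funM.
- exact: emeasurable_funM.
- apply: ae_eqe_mul2l => /=; apply: integral_ae_eq => //=.
    exact: Radon_Nikodym_SigmaFinite.f_integrable.
  by move=> E _ mE; rewrite -Radon_Nikodym_SigmaFinite.f_integral.
Qed.

(** Completing the square: e^(s x) times the density of N(0,1) is e^(s^2/2) times the density of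
    N(s,1). *)
Lemma integral_normal_expR (s : R) :
  (\int[normal_prob 0 1]_x (expR (s * x))%:E = (expR (s ^+ 2 / 2))%:E)%E.
Proof.
have me : measurable_fun [set: R] (fun x => (expR (s * x))%:E : \bar R).
  by apply/measurable_EFinP; apply: measurableT_comp => //; exact: measurable_funM.
rewrite ge0_integral_normal//.
transitivity (\int[lebesgue_measure]_x ((expR (s ^+ 2 / 2))%:E * (normal_pdf s 1 x)%:E))%E.
  apply: eq_integral => x _; rewrite -!EFinM /normal_pdf oner_eq0; congr (_%:E).
  rewrite [LHS]mulrCA [RHS]mulrCA; congr (_ * _).
  by rewrite /normal_fun -!expRD; congr expR; field.
rewrite ge0_integralZl//.
- by rewrite integral_normal_pdf mule1.
- by apply/measurable_EFinP; exact: measurable_normal_pdf.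
- by move=> x _; rewrite lee_fin normal_pdf_ge0.
Qed.

Lemma normal_exp_integrable :
  @exp_integrable R _ _ (normal_prob 0 1) (@id_rv R).
Proof.
move=> s; apply/integrableP; split.
  by apply/measurable_EFinP; apply: measurableT_comp => //; exact: measurable_funM.
under eq_integral => x _ do rewrite /= ger0_norm ?expR_ge0//.
by rewrite integral_normal_expR ltry.
Qed.

Lemma mgf_normal s : mgf (@id_rv R : {RV (normal_prob 0 1) >-> R}) s = expR (s ^+ 2 / 2).
Proof. by rewrite mgfE /Rintegral integral_normal_expR. Qed.

End normal_mgf.

(** * Convergence of cumulants implies convergence in law *)

Section trig_series.
Variable R : realType.
Implicit Types x y l : R.

Lemma series_exp_le y n : 0 <= y -> series (exp_coeff y) n <= expR y.
Proof.
move=> y0; apply: nondecreasing_cvgn_le; last exact: is_cvg_series_exp_coeff.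
apply: nondecreasing_series => k _ _; rewrite /exp_coeff /= divr_ge0// exprn_ge0//.
Qed.

(** For k >= n, |y|^k <= 2^-n (2|y|)^k, so the tail is at most 2^-n times part of an exponential
    series. In expectation, such a bound is controlled by the moment generating function. *)
Lemma exp_tail_bound (c : R^nat) y l n :
  (forall k, `|c k| <= `|y| ^+ k / k`!%:R) -> series c @ \oo --> l ->
  `|l - series c n| <= 2 ^- n * expR (2 * `|y|).
Proof.
move=> cy cl.
have : `|series c k - series c n| @[k --> \oo] --> `|l - series c n|.
  by apply: cvg_norm; apply: cvgB => //; exact: cvg_cst.
move/cvg_lim => <- //; apply: limr_le.
  by apply/cvg_ex; exists `|l - series c n|; apply: cvg_norm; apply: cvgB => //; exact: cvg_cst.
near=> k; have nk : (n <= k)%N by near: k; exact: nbhs_infty_ge.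
rewrite /series /= (big_cat_nat _ (n := n))//= addrAC subrr add0r.
apply: (le_trans (ler_norm_sum _ _ _)).
apply: (@le_trans _ _ (\sum_(n <= i < k) 2 ^- n * exp_coeff (2 * `|y|) i)).
  apply: ler_sum_nat => i /andP[ni _]; apply: (le_trans (cy i)).
  rewrite /exp_coeff /= exprMn mulrA mulrA ler_wpM2r ?invr_ge0//.
  rewrite -[leLHS]mul1r ler_wpM2r ?exprn_ge0//.
  by rewrite mulrC ler_pdivlMr ?exprn_gt0// mul1r ler_weXn2l//; lra.
rewrite -mulr_sumr ler_wpM2l ?invr_ge0 ?exprn_ge0//.
apply: (@le_trans _ _ (series (exp_coeff (2 * `|y|)) k)); last by apply: series_exp_le; rewrite mulr_ge0.
rewrite /series /= [leRHS](big_cat_nat _ (n := n))//= lerDr.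
by apply: sumr_ge0 => i _; rewrite /exp_coeff /= divr_ge0// exprn_ge0// mulr_ge0.
Unshelve. all: by end_near. Qed.

Lemma cos_coeff_norm y k : `|cos_coeff y k| <= `|y| ^+ k / k`!%:R.
Proof.
rewrite /cos_coeff /= !normrM normfV !normr_nat !normrX normrN normr1 expr1n mulr1.
by case: odd; rewrite /= ?mul0r ?mul1r// divr_ge0// exprn_ge0.
Qed.

Lemma sin_coeff_norm y k : `|sin_coeff y k| <= `|y| ^+ k / k`!%:R.
Proof.
rewrite /sin_coeff /= !normrM normfV !normr_nat !normrX normrN normr1 expr1n mulr1.
by case: odd; rewrite /= ?mul0r ?mul1r// divr_ge0// exprn_ge0.
Qed.

Lemma cos_taylor y n : `|cos y - series (cos_coeff y) n| <= 2 ^- n * expR (2 * `|y|).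
Proof.
apply: exp_tail_bound; first exact: cos_coeff_norm.
have -> : cos y = limn (series (cos_coeff y)) by rewrite cosE cos_coeffE.
exact: is_cvg_series_cos_coeff.
Qed.

Lemma sin_taylor y n : `|sin y - series (sin_coeff y) n| <= 2 ^- n * expR (2 * `|y|).
Proof.
apply: exp_tail_bound; first exact: sin_coeff_norm.
have -> : sin y = limn (series (sin_coeff y)) by rewrite sinE sin_coeffE.
exact: is_cvg_series_sin_coeff.
Qed.

(** The phase v includes the sines, and by the addition formulas a product of cosines is again a sum
    of cosines; hence polynomials in a cosine belong to the class. *)
Inductive trigpoly : (R -> R) -> Prop :=
| trigpoly_cos u v : trigpoly (fun x => cos (u * x + v))
| trigpolyD f g of trigpoly f & trigpoly g : trigpoly (fun x => f x + g x)
| trigpolyZ c f of trigpoly f : trigpoly (fun x => c * f x).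

Lemma trigpoly_cst c : trigpoly (fun=> c).
Proof.
have := trigpolyZ c (trigpoly_cos 0 0); congr trigpoly.
by apply/funext => x; rewrite mul0r addr0 cos0 mulr1.
Qed.

Lemma trigpolyM f g : trigpoly f -> trigpoly g -> trigpoly (fun x => f x * g x).
Proof.
move=> tf tg; elim: tf => [u v|f1 f2 _ h1 _ h2|c f1 _ h1]; last 2 first.
- have := trigpolyD h1 h2; congr trigpoly; apply/funext => x; ring.
- have := trigpolyZ c h1; congr trigpoly; apply/funext => x; ring.
elim: tg => [u' v'|f1 f2 _ h1 _ h2|c f1 _ h1]; last 2 first.
- have := trigpolyD h1 h2; congr trigpoly; apply/funext => x; ring.
- have := trigpolyZ c h1; congr trigpoly; apply/funext => x; ring.
have := trigpolyZ 2^-1 (trigpolyD (trigpoly_cos (u + u') (v + v')) (trigpoly_cos (u - u') (v - v'))).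
congr trigpoly; apply/funext => x.
have -> : (u + u') * x + (v + v') = (u * x + v) + (u' * x + v') by ring.
have -> : (u - u') * x + (v - v') = (u * x + v) - (u' * x + v') by ring.
by rewrite cosD cosB; field.
Qed.

Lemma trigpolyX f n : trigpoly f -> trigpoly (fun x => f x ^+ n).
Proof.
move=> tf; elim: n => [|n IH].
  by have := trigpoly_cst 1; congr trigpoly; apply/funext => x; rewrite expr0.
by have := trigpolyM tf IH; congr trigpoly; apply/funext => x; rewrite exprS.
Qed.

Lemma trigpoly_measurable f : trigpoly f -> measurable_fun [set: R] f.
Proof.
elim=> [u v|f1 f2 _ h1 _ h2|c f1 _ h1].
- apply: measurableT_comp; first exact: continuous_measurable_fun (@continuous_cos R).
  by apply: measurable_funD => //; exact: measurable_funM.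
- exact: measurable_funD.
- exact: measurable_funM.
Qed.

Lemma trigpoly_bounded f : trigpoly f -> exists B, forall x, `|f x| <= B.
Proof.
elim=> [u v|f1 f2 _ [B1 h1] _ [B2 h2]|c f1 _ [B1 h1]].
- by exists 1 => x; exact: cos_max.
- by exists (B1 + B2) => x; rewrite (le_trans (ler_normD _ _))// lerD.
- by exists (`|c| * B1) => x; rewrite normrM ler_wpM2l.
Qed.

Lemma expr_cvg0 (q e : R) : 0 <= q < 1 -> 0 < e -> exists n : nat, q ^+ n <= e.
Proof.
move=> /andP[q0 q1] e0.
have /cvgrPdist_le/(_ e e0)[n _ /(_ n (leqnn n))] : (fun n => q ^+ n) @ \oo --> (0 : R).
  by apply: cvg_expr; rewrite ger0_norm.
by move=> h; exists n; move: h; rewrite /= sub0r normrN ger0_norm// exprn_ge0.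
Qed.

Lemma bernoulli_ineq (z : R) n : 0 <= z <= 1 -> 1 - n%:R * z <= (1 - z) ^+ n.
Proof.
move=> /andP[z0 z1]; elim: n => [|n IH]; first by rewrite mul0r subr0 expr0.
have z1' : 0 <= 1 - z by lra.
have := ler_wpM2l z1' IH; rewrite -exprS; apply: le_trans.
have : 0 <= n%:R * z ^+ 2 by rewrite mulr_ge0 ?sqr_ge0.
by rewrite -natr1; nra.
Qed.

(* (1 - y^n)^(2^n) is close to 1 for y < 1/2 and close to 0 for y > 1/2 *)
Lemma step_poly_lt (d e : R) : 0 < d -> 0 < e -> exists n0 : nat, forall n, (n0 <= n)%N ->
  forall y, 0 <= y <= 1 / 2 - d -> 1 - e <= (1 - y ^+ n) ^+ (2 ^ n).
Proof.
move=> d0 e0; have [d2|d2] := ltP (1/2) d.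
  by exists 0%N => n _ y /andP[y0 y1]; lra.
have [n0 hn0] := @expr_cvg0 (1 - 2 * d) e ltac:(lra) e0.
exists n0 => n nn y /andP[y0 y1].
have yn : 0 <= y ^+ n <= 1 by rewrite exprn_ge0// exprn_ile1//; lra.
apply: le_trans (bernoulli_ineq _ yn); rewrite lerD2l lerN2 natrX -exprMn.
apply: (@le_trans _ _ ((1 - 2 * d) ^+ n)).
  by apply: lerXn2r; rewrite ?nnegrE; lra.
by apply: le_trans hn0; apply: ler_wiXn2l => //; lra.
Qed.

(** With z = y^n and M = 2^n, (1 - z)^M (1 + z)^M <= 1 and (1 + z)^M >= 1 + M z >= (2 y)^n >= (1 + 2
    d)^n. *)
Lemma step_poly_gt (d e : R) : 0 < d -> 0 < e -> exists n0 : nat, forall n, (n0 <= n)%N ->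
  forall y, 1 / 2 + d <= y <= 1 -> (1 - y ^+ n) ^+ (2 ^ n) <= e.
Proof.
move=> d0 e0.
have q0 : 0 < 1 + 2 * d by lra.
have [n0 hn0] := @expr_cvg0 (1 + 2 * d)^-1 e ltac:(rewrite invr_ge0 ltW//= invf_lt1//; lra) e0.
exists n0 => n nn y /andP[y0 y1].
have yp : 0 <= y by lra.
have yn0 : 0 <= y ^+ n by rewrite exprn_ge0.
have yn1 : y ^+ n <= 1 by rewrite exprn_ile1.
apply: (@le_trans _ _ ((1 + 2 * d)^-1 ^+ n)); last first.
  apply: le_trans hn0; apply: ler_wiXn2l => //; first by rewrite invr_ge0 ltW.
  by rewrite invf_le1//; lra.
rewrite exprVn -[leRHS]mul1r ler_pdivlMr ?exprn_gt0//.
apply: (@le_trans _ _ ((1 - y ^+ n) ^+ (2 ^ n) * (1 + y ^+ n) ^+ (2 ^ n))).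
  apply: ler_wpM2l; first by rewrite exprn_ge0//; lra.
  apply: (@le_trans _ _ (1 + (2 ^ n)%:R * y ^+ n)).
    rewrite natrX -exprMn; apply: (@le_trans _ _ ((2 * y) ^+ n)); last by rewrite lerDr.
    by apply: lerXn2r; rewrite ?nnegrE; lra.
  elim: (2 ^ n)%N => [|k IH]; first by rewrite mul0r addr0 expr0.
  rewrite exprS -natr1; have := ler_wpM2l (_ : 0 <= 1 + y ^+ n) IH.
  move=> /(_ ltac:(lra)); apply: le_trans.
  have : 0 <= k%:R * (y ^+ n * y ^+ n) by rewrite mulr_ge0// mulr_ge0.
  by nra.
rewrite -exprMn; apply: exprn_ile1; last by nra.
by nra.
Qed.

(** Trigonometric polynomials are almost periodic, so smallness off the enlarged interval is claimed
    on a window |x| <= Lam only; outside it, values in [0, 1] are paired with a small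
    probability. *)
Lemma trigpoly_bump (a b eta Lam e : R) : a <= b -> 0 < eta -> 0 < e ->
  exists f, [/\ trigpoly f, forall x, 0 <= f x <= 1,
    forall x, a <= x <= b -> 1 - e <= f x &
    forall x, `|x| <= Lam -> (x <= a - eta) || (b + eta <= x) -> f x <= e].
Proof.
move=> ab eta0 e0.
pose c := (a + b) / 2; pose r := (b - a) / 2; pose w := r + eta / 2.
(* With this scale |x - c| / L <= 1 on the window, a range where the cosine decreases. *)
pose L := `|Lam| + `|c| + r + eta + 1.
have r0 : 0 <= r by rewrite /r; lra.
have Lc : 0 < L by rewrite /L; have := normr_ge0 Lam; have := normr_ge0 c; lra.
(* [y] is above 1/2 for |x - c| < w and below it for larger distances up to L; the division by 4
   keeps it in [0, 1]. *)
pose y x : R := 1 / 2 + (cos (L^-1 * x + - (c / L)) - cos (w / L)) / 4.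
have cosE x : cos (L^-1 * x + - (c / L)) = cos (`|x - c| / L).
  rewrite -[LHS]cos_norm; congr cos.
  rewrite (_ : L^-1 * x + - (c / L) = (x - c) / L); last by field; lra.
  by rewrite normrM [ `|L^-1| ]gtr0_norm// invr_gt0.
have pi2 := @pi_ge2 R.
have cos_le s t : 0 <= s -> s <= t -> t <= L -> cos (t / L) <= cos (s / L).
  move=> s0 st tL; have tL1 : t / L <= 1 by rewrite ler_pdivrMr// mul1r.
  have sL : s / L <= t / L by rewrite ler_wpM2r// invr_ge0 ltW.
  have sL0 : 0 <= s / L by rewrite divr_ge0// ltW.
  by rewrite leNgt ltr_cos ?in_itv/= -?leNgt//; apply/andP; split; lra.
have cos_lt s t : 0 <= s -> s < t -> t <= L -> cos (t / L) < cos (s / L).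
  move=> s0 st tL; have tL1 : t / L <= 1 by rewrite ler_pdivrMr// mul1r.
  have sL : s / L < t / L by rewrite ltr_pM2r// invr_gt0.
  have sL0 : 0 <= s / L by rewrite divr_ge0// ltW.
  by rewrite ltr_cos ?in_itv//=; apply/andP; split; lra.
(* The margin by which [y] clears 1/2 at the distances r and r + eta from c. *)
pose d := Num.min ((cos (r / L) - cos (w / L)) / 4) ((cos (w / L) - cos ((r + eta) / L)) / 4).
have LL : r + eta <= L by rewrite /L; have := normr_ge0 Lam; have := normr_ge0 c; lra.
have d0 : 0 < d.
  rewrite lt_min; apply/andP; split.
    by have := @cos_lt r w r0 ltac:(rewrite /w; lra) ltac:(rewrite /w; lra); lra.
  by have := @cos_lt w (r + eta) ltac:(rewrite /w; lra) ltac:(rewrite /w; lra) LL; lra.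
have y01 x : 0 <= y x <= 1.
  rewrite /y; have := cos_le1 (L^-1 * x + - (c / L)); have := cos_geN1 (L^-1 * x + - (c / L)).
  by have := cos_le1 (w / L); have := cos_geN1 (w / L); lra.
have [n1 h1] := step_poly_lt d0 e0; have [n2 h2] := step_poly_gt d0 e0.
pose n := maxn n1 n2.
exists (fun x => 1 + (- 1) * (1 + (-1) * y x ^+ n) ^+ (2 ^ n)); split.
- apply: trigpolyD; first exact: trigpoly_cst.
  apply: trigpolyZ; apply: trigpolyX; apply: trigpolyD; first exact: trigpoly_cst.
  apply: trigpolyZ; apply: trigpolyX.
  have := trigpolyD (trigpoly_cst (1 / 2 - cos (w / L) / 4)) (trigpolyZ 4^-1 (trigpoly_cos L^-1 (- (c / L)))).
  by congr trigpoly; apply/funext => x; rewrite /y; field.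
- move=> x; rewrite !mulN1r; have /andP[yx0 yx1] := y01 x.
  have z0 : 0 <= y x ^+ n by rewrite exprn_ge0.
  have z1 : y x ^+ n <= 1 by rewrite exprn_ile1.
  have t0 : 0 <= (1 - y x ^+ n) ^+ (2 ^ n) by rewrite exprn_ge0//; lra.
  have t1 : (1 - y x ^+ n) ^+ (2 ^ n) <= 1 by rewrite exprn_ile1//; lra.
  by apply/andP; split; lra.
- move=> x /andP[ax xb]; rewrite !mulN1r lerD2l lerN2; apply: h2; first exact: leq_maxr.
  have /andP[_ ->] := y01 x; rewrite andbT /y cosE.
  have xc : `|x - c| <= r by rewrite ler_norml /c /r; lra.
  have := @cos_le `|x - c| r (normr_ge0 _) xc ltac:(lra).
  have : d <= (cos (r / L) - cos (w / L)) / 4 by rewrite ge_min lexx.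
  lra.
- move=> x xL xab; rewrite !mulN1r lerBlDr -lerBlDl; apply: h1; first exact: leq_maxl.
  have /andP[-> _] := y01 x; rewrite /= /y cosE.
  have xc : r + eta <= `|x - c|.
    by case/orP: xab => h; rewrite ler_normr /c /r; apply/orP; [right|left]; lra.
  have xcL : `|x - c| <= L.
    rewrite (le_trans (ler_normB _ _))// /L; have := ler_norm Lam; lra.
  have := @cos_le (r + eta) `|x - c| ltac:(lra) xc xcL.
  have : d <= (cos (w / L) - cos ((r + eta) / L)) / 4 by rewrite ge_min lexx orbT.
  lra.
Qed.

End trig_series.

Section expect.
Context (R : realType) (dp : measure_display) (T : measurableType dp)
  (P : probability T R) (X : {RV P >-> R}).
Implicit Types (f g : R -> R) (A B : set R).

Definition expect f : R := \int[P]_w f (X w).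

Definition prb A : R := fine (P (X @^-1` A)).

Lemma bounded_integrable f (B : R) : measurable_fun [set: R] f -> (forall x, `|f x| <= B) ->
  P.-integrable setT (EFin \o (fun w => f (X w))).
Proof.
move=> mf fB; apply: (@le_integrable_real _ _ _ P _ (cst B)).
- exact: measurableT_comp.
- by move=> w; exact: fB.
- by have := finite_measure_integrable_cst P B measurableT; congr (_.-integrable _ _).
Qed.

Lemma prbE A : measurable A -> prb A = expect \1_A.
Proof.
move=> mA; rewrite /expect /Rintegral (eq_integral (EFin \o \1_(X @^-1` A))); last first.
  by move=> w _; rewrite /= !indicE; congr ((_ : bool)%:R)%:E; apply/idP/idP; rewrite !inE.
rewrite integral_indic// ?setIT// -[X in measurable X]setTI.
exact: measurable_funP.
Qed.

Lemma measurable_preim A : measurable A -> measurable (X @^-1` A).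
Proof. by move=> mA; rewrite -[X in measurable X]setTI; exact: measurable_funP. Qed.

Lemma prb_fin A : measurable A -> (prb A)%:E = P (X @^-1` A).
Proof. by move=> mA; rewrite fineK// fin_num_measure//; exact: measurable_preim. Qed.

Lemma le_prb A B : measurable A -> measurable B -> A `<=` B -> prb A <= prb B.
Proof.
move=> mA mB AB; rewrite -lee_fin !prb_fin//; apply: le_measure; rewrite ?inE.
- exact: measurable_preim.
- exact: measurable_preim.
- exact: preimage_subset.
Qed.

Lemma prbU A B : measurable A -> measurable B -> prb (A `|` B) <= prb A + prb B.
Proof.
move=> mA mB; rewrite -lee_fin EFinD !prb_fin//; last exact: measurableU.
by rewrite preimage_setU; apply: measureU2; exact: measurable_preim.
Qed.

Lemma prbC A : measurable A -> prb (~` A) = 1 - prb A.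
Proof.
move=> mA; apply: EFin_inj; rewrite EFinB !prb_fin//; last exact: measurableC.
by rewrite preimage_setC probability_setC//; exact: measurable_preim.
Qed.

Lemma expect_le f g (B C : R) : measurable_fun [set: R] f -> measurable_fun [set: R] g ->
  (forall x, `|f x| <= B) -> (forall x, `|g x| <= C) -> (forall x, f x <= g x) ->
  expect f <= expect g.
Proof.
by move=> mf mg fB gC fg; apply: le_Rintegral => //; [exact: bounded_integrable fB|exact: bounded_integrable gC].
Qed.

Lemma expectD f g (B C : R) : measurable_fun [set: R] f -> measurable_fun [set: R] g ->
  (forall x, `|f x| <= B) -> (forall x, `|g x| <= C) ->
  expect (fun x => f x + g x) = expect f + expect g.
Proof.
move=> mf mg fB gC; apply: RintegralD => //.
- exact: bounded_integrable fB.
- exact: bounded_integrable gC.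
Qed.

Lemma expectZ c f (B : R) : measurable_fun [set: R] f -> (forall x, `|f x| <= B) ->
  expect (fun x => c * f x) = c * expect f.
Proof. by move=> mf fB; apply: RintegralZl => //; exact: bounded_integrable fB. Qed.

Lemma norm_indic_le1 A x : `|\1_A x : R| <= 1.
Proof. by rewrite indicE; case: (_ \in _); rewrite ?normr1 ?normr0. Qed.

Hypothesis eX : exp_integrable X.

Lemma prb_tail (A : R) : 0 < A -> prb [set x | A <= `|x|] <= moment X 2 / A ^+ 2.
Proof.
move=> A0.
have mA : measurable [set x : R | A <= `|x|].
  rewrite (_ : [set x | _] = (fun x : R => `|x|) @^-1` `[A, +oo[%classic); last first.
    by apply/seteqP; split => x /=; rewrite in_itv /= andbT.
  by rewrite -[X in measurable X]setTI; exact: normr_measurable.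
rewrite prbE// mulrC /moment -RintegralZl//; last exact: integrable_pow.
apply: le_Rintegral => //.
- exact: (bounded_integrable _ (@norm_indic_le1 _)).
- have := integrableZl measurableT (A ^- 2) (integrable_pow eX 2).
  by congr (_.-integrable _ _).
- move=> w _; rewrite indicE; case: (boolP (_ \in _)); rewrite ?inE /= => Aw.
    by rewrite mulrC ler_pdivlMr ?exprn_gt0// mul1r -[leRHS]real_normK ?num_real// lerXn2r// ?nnegrE ltW.
  by apply: mulr_ge0; [rewrite invr_ge0 exprn_ge0// ltW|exact: sqr_ge0].
Qed.

(** The expectation of the Taylor polynomial involves only moments, and the remainder is integrated
    with e^(2|u X|) <= e^(2 u X) + e^(-2 u X). *)
Lemma expect_wave (f : R -> R) (a : nat -> R) (u : R) n :
  measurable_fun [set: R] f -> (forall x, `|f x| <= 1) ->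
  (forall y, `|f y - \sum_(0 <= k < n) a k * y ^+ k| <= 2 ^- n * expR (2 * `|y|)) ->
  `|expect (fun x => f (u * x)) - \sum_(0 <= k < n) a k * u ^+ k * moment X k| <=
  2 ^- n * (mgf X (2 * u) + mgf X (- (2 * u))).
Proof.
move=> mf f1 fa.
have i1 : P.-integrable setT (EFin \o (fun w => f (u * X w))).
  have := @bounded_integrable (fun x => f (u * x)) 1.
  by apply => //; apply: measurableT_comp => //; exact: measurable_funM.
have ik k : P.-integrable setT (EFin \o (fun w => a k * u ^+ k * X w ^+ k)).
  by have := integrableZl measurableT (a k * u ^+ k) (integrable_pow eX k); congr (_.-integrable _ _).
have isum m : P.-integrable setT (EFin \o (fun w => \sum_(0 <= k < m) a k * u ^+ k * X w ^+ k)) /\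
    \int[P]_w (\sum_(0 <= k < m) a k * u ^+ k * X w ^+ k) =
    \sum_(0 <= k < m) a k * u ^+ k * moment X k.
  elim: m => [|m [IH1 IH2]].
    split; last first.
      rewrite big_geq// (@eq_Rintegral _ _ _ P _ (cst 0)) ?Rintegral_cst ?mul0r//.
      by move=> w _; rewrite big_geq.
    have := finite_measure_integrable_cst P 0 measurableT; congr (_.-integrable _ _).
    by apply/funext => w /=; rewrite big_geq.
  split.
    have := integrableD measurableT IH1 (ik m); congr (_.-integrable _ _).
    by apply/funext => w /=; rewrite big_nat_recr.
  rewrite big_nat_recr//= -IH2 -RintegralZl//; last exact: integrable_pow.
  rewrite -RintegralD//; apply: eq_Rintegral => w _.
  by rewrite big_nat_recr.
have [is_ <-] := isum n.
rewrite /expect -RintegralB//.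
apply: (le_trans (le_normr_Rintegral _ _)) => //.
  by have := integrableB measurableT i1 is_; congr (_.-integrable _ _).
rewrite !mgfE -RintegralD//; [|exact: eX..].
have i3 : P.-integrable setT (EFin \o (fun w => expR (2 * u * X w) + expR (- (2 * u) * X w))).
  by have := integrableD measurableT (eX (2 * u)) (eX (- (2 * u))); congr (_.-integrable _ _).
rewrite -RintegralZl//; apply: le_Rintegral => //.
- have := integrable_abse (integrableB measurableT i1 is_); congr (_.-integrable _ _).
- by have := integrableZl measurableT (2 ^- n) i3; congr (_.-integrable _ _).
move=> w _.
have := fa (u * X w); under eq_bigr => k _ do rewrite exprMn mulrA.
move=> /le_trans; apply; rewrite ler_wpM2l ?invr_ge0 ?exprn_ge0//.
have := expR_norm_le (2 * (u * X w)).
by rewrite normrM (ger0_norm (ler0n _ 2)) mulrA mulNr.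
Qed.

End expect.

(** * Convergence of moments implies convergence of distribution functions *)

Section continuity_theorem.
Context (R : realType) (F : set_system nat) (FF : ProperFilter F).
Context (d : nat -> measure_display) (T : forall N, measurableType (d N))
  (P : forall N, probability (T N) R) (X : forall N, {RV (P N) >-> R}).
Context (dq : measure_display) (TQ : measurableType dq) (Q : probability TQ R)
  (Y : {RV Q >-> R}).
Hypotheses (eX : forall N, exp_integrable (X N)) (eY : exp_integrable Y).
Hypothesis mgf_bound : forall s, exists C, \forall N \near F, mgf (X N) s <= C.
Hypothesis moment_cvg : forall k, moment (X N) k @[N --> F] --> moment Y k.

(** The degree n is fixed first, from the uniform bound on the moment generating functions; only
    then do the finitely many moments of order below n converge. *)
Let wave_cvg (f : R -> R) (a : nat -> R) (u : R) :
  measurable_fun [set: R] f -> (forall x, `|f x| <= 1) ->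
  (forall n y, `|f y - \sum_(0 <= k < n) a k * y ^+ k| <= 2 ^- n * expR (2 * `|y|)) ->
  expect (X N) (fun x => f (u * x)) @[N --> F] --> expect Y (fun x => f (u * x)).
Proof.
move=> mf f1 fa; apply/cvgrPdist_le => e e0.
have [C1 hC1] := mgf_bound (2 * u); have [C2 hC2] := mgf_bound (- (2 * u)).
pose C := `|C1| + `|C2| + mgf Y (2 * u) + mgf Y (- (2 * u)) + 1.
have g1 : 0 < mgf Y (2 * u) by exact: mgf_gt0.
have g2 : 0 < mgf Y (- (2 * u)) by exact: mgf_gt0.
have C0 : 0 < C by rewrite /C; have := normr_ge0 C1; have := normr_ge0 C2; lra.
have eC : 0 < e / 3 / C by rewrite divr_gt0// divr_gt0.
have h12 : 0 <= (2^-1 : R) < 1 by lra.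
have [n hn] := expr_cvg0 h12 eC.
have nC D : D <= C -> 2 ^- n * D <= e / 3.
  move=> DC; rewrite -exprVn; apply: (@le_trans _ _ (2^-1 ^+ n * C)).
    by rewrite ler_wpM2l// exprn_ge0// invr_ge0.
  by rewrite -ler_pdivlMr.
have hY := expect_wave eY u mf f1 (fa n).
have /nC hY' : mgf Y (2 * u) + mgf Y (- (2 * u)) <= C.
  by rewrite /C; have := normr_ge0 C1; have := normr_ge0 C2; lra.
have /cvgrPdist_le/(_ (e / 3) ltac:(lra)) hs :
    \sum_(0 <= k < n) a k * u ^+ k * moment (X N) k @[N --> F] -->
    \sum_(0 <= k < n) a k * u ^+ k * moment Y k.
  elim: (n) => [|m IH].
    rewrite big_geq//; under eq_fun => N do rewrite big_geq//; exact: cvg_cst.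
  rewrite big_nat_recr//=; under eq_fun => N do rewrite big_nat_recr//=.
  by apply: cvgD => //; apply: cvgM => //; exact: cvg_cst.
near=> N.
have hN := expect_wave (eX N) u mf f1 (fa n).
have h1 : mgf (X N) (2 * u) <= C1 by near: N.
have h2 : mgf (X N) (- (2 * u)) <= C2 by near: N.
have /nC hN' : mgf (X N) (2 * u) + mgf (X N) (- (2 * u)) <= C.
  by rewrite /C; have := ler_norm C1; have := ler_norm C2; lra.
have h3 : `|\sum_(0 <= k < n) a k * u ^+ k * moment Y k -
            \sum_(0 <= k < n) a k * u ^+ k * moment (X N) k| <= e / 3.
  by near: N; exact: hs.
move: h3 (le_trans hN hN') (le_trans hY hY'); rewrite !ler_norml; lra.
Unshelve. all: by end_near. Qed.

Let cos_cvg (u : R) :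
  expect (X N) (fun x => cos (u * x)) @[N --> F] --> expect Y (fun x => cos (u * x)).
Proof.
apply: (@wave_cvg _ (fun k => (~~ odd k)%:R * (-1) ^+ k./2 * (k`!%:R)^-1)).
- exact: continuous_measurable_fun (@continuous_cos R).
- exact: cos_max.
- by move=> n y; have := cos_taylor y n; rewrite cos_coeffE.
Qed.

Let sin_cvg (u : R) :
  expect (X N) (fun x => sin (u * x)) @[N --> F] --> expect Y (fun x => sin (u * x)).
Proof.
apply: (@wave_cvg _ (fun k => (odd k)%:R * (-1) ^+ k.-1./2 * (k`!%:R)^-1)).
- exact: continuous_measurable_fun (@continuous_sin R).
- exact: sin_max.
- by move=> n y; have := sin_taylor y n; rewrite sin_coeffE.
Qed.

Let trigpoly_cvg (f : R -> R) : trigpoly f ->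
  expect (X N) f @[N --> F] --> expect Y f.
Proof.
elim=> [u v|f1 f2 t1 h1 t2 h2|c f1 t1 h1].
- have mc : measurable_fun [set: R] (fun x => cos (u * x)).
    apply: measurableT_comp; first exact: continuous_measurable_fun (@continuous_cos R).
    exact: measurable_funM.
  have ms : measurable_fun [set: R] (fun x => sin (u * x)).
    apply: measurableT_comp; first exact: continuous_measurable_fun (@continuous_sin R).
    exact: measurable_funM.
  have bc x : `|cos (u * x)| <= 1 by exact: cos_max.
  have bs x : `|sin (u * x)| <= 1 by exact: sin_max.
  have bs' x : `|- sin v * sin (u * x)| <= `|- sin v| * 1 by rewrite normrM ler_wpM2l.
  have bc' x : `|cos v * cos (u * x)| <= `|cos v| * 1 by rewrite normrM ler_wpM2l.
  have E (dd : measure_display) (TT : measurableType dd) (PP : probability TT R) (Z : {RV PP >-> R}) :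
      expect Z (fun x => cos (u * x + v)) =
      cos v * expect Z (fun x => cos (u * x)) + - sin v * expect Z (fun x => sin (u * x)).
    rewrite -(expectZ Z _ mc bc) -(expectZ Z _ ms bs).
    rewrite -(@expectD _ _ _ _ Z _ _ _ _ _ _ bc' bs'); [|exact: measurable_funM..].
    by apply: eq_Rintegral => w _; rewrite cosD; ring.
  rewrite E; under eq_fun => N do rewrite E.
  by apply: cvgD; apply: cvgM => //; exact: cvg_cst.
- have [B1 b1] := trigpoly_bounded t1; have [B2 b2] := trigpoly_bounded t2.
  have m1 := trigpoly_measurable t1; have m2 := trigpoly_measurable t2.
  rewrite (expectD Y m1 m2 b1 b2).
  under eq_fun => N do rewrite (expectD (X N) m1 m2 b1 b2).
  exact: cvgD.
- have [B1 b1] := trigpoly_bounded t1; have m1 := trigpoly_measurable t1.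
  rewrite (expectZ Y c m1 b1).
  under eq_fun => N do rewrite (expectZ (X N) c m1 b1).
  by apply: cvgM => //; exact: cvg_cst.
Qed.

Let measurable_tail (A : R) : measurable [set x : R | A <= `|x|].
Proof.
rewrite (_ : [set x | _] = (fun x : R => `|x|) @^-1` `[A, +oo[%classic); last first.
  by apply/seteqP; split => x /=; rewrite in_itv /= andbT.
by rewrite -[X in measurable X]setTI; exact: normr_measurable.
Qed.

(** Chebyshev's inequality; along F the second moments are eventually below that of Y plus 1. *)
Let tail_small (e : R) : 0 < e -> exists A0, 0 < A0 /\ forall A : R, A0 <= A ->
  prb Y [set x | A <= `|x|] <= e /\ \forall N \near F, prb (X N) [set x | A <= `|x|] <= e.
Proof.
move=> e0; pose K := moment Y 2 + 1.
have K0 : 0 < K.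
  by rewrite /K ltr_wpDl//; apply: Rintegral_ge0 => w _; exact: sqr_ge0.
have hA (A : R) : 1 + K / e <= A -> K / A ^+ 2 <= e.
  move=> hA; have Ke : 0 < K / e by rewrite divr_gt0.
  rewrite ler_pdivrMr ?exprn_gt0//; last lra.
  have : K = e * (K / e) by field; lra.
  move=> ->; rewrite ler_pM2l//; nra.
exists (1 + K / e); split; first by rewrite addr_gt0// divr_gt0.
move=> A AA; have A0 : 0 < A by apply: lt_le_trans AA; rewrite addr_gt0// divr_gt0.
have A20 : 0 < A ^+ 2 by rewrite exprn_gt0.
split.
  apply: le_trans (hA _ AA); apply: (le_trans (prb_tail eY A0)).
  by rewrite ler_pM2r ?invr_gt0// /K lerDl.
have /cvgrPdist_le/(_ 1 ltr01) := @moment_cvg 2%N.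
apply: filterS => N hN; apply: le_trans (hA _ AA); apply: (le_trans (prb_tail (eX N) A0)).
by rewrite ler_pM2r ?invr_gt0// /K; move: hN; rewrite ler_norml; lra.
Qed.

(** The bump function is at least 1 - e/5 on [a, b] and at most e/5 off the enlarged interval within
    the window; beyond the window the tail bound for Y takes over. *)
Let itv_upper (a b eta e : R) : a <= b -> 0 < eta -> 0 < e ->
  \forall N \near F, prb (X N) `[a, b]%classic <= prb Y `[(a - eta), (b + eta)]%classic + e.
Proof.
move=> ab eta0 e0.
have [L [L0 hL]] := @tail_small (e / 5) ltac:(lra).
have [hYL _] := hL L (lexx _).
have [f [tf f01 f1 f0]] := @trigpoly_bump R a b eta L (e / 5) ab eta0 ltac:(lra).
have mf := trigpoly_measurable tf.
have bf x : `|f x| <= 1 by have /andP[h0 h1] := f01 x; rewrite ger0_norm.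
have /cvgrPdist_le/(_ (e / 5) ltac:(lra)) := trigpoly_cvg tf.
apply: filterS => N hN.
have mi (u v : R) : measurable_fun [set: R] (\1_`[u, v] : R -> R) by exact: measurable_indic.
have mt : measurable_fun [set: R] (\1_[set x : R | L <= `|x|] : R -> R).
  exact: measurable_indic.
have hX : prb (X N) `[a, b]%classic <= expect (X N) f + e / 5.
  have mc : measurable_fun [set: R] (cst (e / 5)) by [].
  have bc (x : R) : `|cst (e / 5) x| <= e / 5 by rewrite /= ger0_norm//; lra.
  have -> : e / 5 = expect (X N) (cst (e / 5)).
    by rewrite /expect Rintegral_cst//= probability_setT /= mulr1.
  rewrite -(expectD (X N) mf mc bf bc) prbE//.
  apply: (@expect_le _ _ _ _ (X N) _ _ 1 (1 + e / 5)) => //.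
  - exact: measurable_funD.
  - by move=> x; exact: norm_indic_le1.
  - move=> x; apply: (le_trans (ler_normD _ _)); apply: lerD => //.
  - move=> x; rewrite indicE /=; case: (boolP (_ \in _)) => [|_].
      by rewrite inE /= in_itv /= => /f1; lra.
    rewrite /=; have /andP[h0 _] := f01 x; lra.
have hY : expect Y f <= prb Y `[(a - eta), (b + eta)]%classic +
    (prb Y [set x | L <= `|x|] + e / 5).
  have mc : measurable_fun [set: R] (cst (e / 5)) by [].
  have bc (x : R) : `|cst (e / 5) x| <= e / 5 by rewrite /= ger0_norm//; lra.
  have -> : e / 5 = expect Y (cst (e / 5)).
    by rewrite /expect Rintegral_cst//= probability_setT /= mulr1.
  rewrite !prbE//.
  rewrite -(expectD Y mt mc (@norm_indic_le1 _ _) bc).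
  have mtc := measurable_funD mt mc.
  have btc (x : R) : `|\1_[set x : R | L <= `|x|] x + cst (e / 5) x| <= 1 + e / 5.
    by apply: (le_trans (ler_normD _ _)); apply: lerD => //; exact: norm_indic_le1.
  rewrite -(expectD Y (mi _ _) mtc (@norm_indic_le1 _ _) btc).
  apply: (@expect_le _ _ _ _ Y _ _ 1 (1 + (1 + e / 5))) => //.
  - by apply: measurable_funD.
  - by move=> x; apply: (le_trans (ler_normD _ _)); apply: lerD; [exact: norm_indic_le1|exact: btc].
  - move=> x; rewrite /= !indicE /=.
    have /andP[h0 h1] := f01 x.
    case: (boolP (x \in `[(a - eta), (b + eta)]%classic)) => /= xi.
      have : 0 <= ((x \in [set x0 : R | L <= `|x0|])%:R : R) by [].
      lra.
    case: (boolP (x \in [set x0 : R | L <= `|x0|])) => /= xL.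
      lra.
    rewrite !add0r; apply: f0.
      by move: xL; rewrite notin_setE /= => /negP; rewrite -ltNge => /ltW.
    move: xi; rewrite notin_setE /= in_itv /= => /negP; rewrite negb_and -!ltNge.
    by case/orP => /ltW ->; rewrite ?orbT.
by move: hN; rewrite ler_norml; lra.
Qed.

(** Each of ]-oo, x] and its complement is covered by an interval and a tail. Upper bounds for both
    give a two-sided estimate because the probabilities add up to 1, and continuity at x absorbs the
    margins. *)
Theorem cdf_cvg_of_moments (x : R) :
  {for x, continuous (fun y : R => distribution Q Y `]-oo, y]%classic)} ->
  cdf (X N) x @[N --> F] --> distribution Q Y `]-oo, x]%classic.
Proof.
move=> cx.
have finE dd (TT : measurableType dd) (PP : probability TT R) (Z : {RV PP >-> R}) (y : R) :
    distribution PP Z `]-oo, y]%classic = (prb Z `]-oo, y]%classic)%:E.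
  by rewrite prb_fin.
rewrite finE (_ : (fun N => cdf (X N) x) = (fun N => (prb (X N) `]-oo, x]%classic)%:E)); last first.
  by apply/funext => N; rewrite -finE.
apply: cvg_EFin; first exact: nearW.
have cx' : {for x, continuous (fun y : R => prb Y `]-oo, y]%classic)}.
  have : distribution Q Y `]-oo, y]%classic @[y --> x] --> (prb Y `]-oo, x]%classic)%:E.
    by rewrite -finE; exact: cx.
  by move/fine_cvg.
apply/cvgrPdist_le => e e0.
have e4 : 0 < e / 4 by lra.
have /cvgrPdist_le/(_ _ e4) := cx'.
move=> /nbhs_ballP[del /= del0 hdel].
(* Both x + D and x - 2 D are compared with x. The second appears because a closed interval starting
   at x - D has to avoid a half-line closed at its end. *)
pose D := del / 3.
have D0 : 0 < D by rewrite /D; lra.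
have hD y : `|y - x| <= 2 * D -> `|prb Y `]-oo, x]%classic - prb Y `]-oo, y]%classic| <= e / 4.
  move=> xy; apply: hdel; rewrite /ball /= distrC (le_lt_trans xy)// /D; lra.
have [A0 [A00 hA0]] := tail_small e4.
pose A := A0 + `|x| + 1.
have AA : A0 <= A by rewrite /A; have := normr_ge0 x; lra.
have [_ hA] := hA0 A AA.
have xA : x <= A by rewrite /A; have := ler_norm x; lra.
have Ax : - A <= x by rewrite /A; have := ler_norm (- x); rewrite normrN; lra.
have U1 := itv_upper Ax D0 e4; have U2 := itv_upper xA D0 e4.
near=> N.
have hAN : prb (X N) [set x | A <= `|x|] <= e / 4 by near: N.
have h1 : prb (X N) `[(- A), x]%classic <= prb Y `[(- A - D), (x + D)]%classic + e / 4 by near: N.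
have h2 : prb (X N) `[x, A]%classic <= prb Y `[(x - D), (A + D)]%classic + e / 4 by near: N.
have k1 : prb (X N) `]-oo, x]%classic <= prb (X N) [set x | A <= `|x|] + prb (X N) `[(- A), x]%classic.
  apply: le_trans (prbU _ _ _) => //; apply: le_prb => //; first exact: measurableU.
  move=> y /=; rewrite !in_itv /= => yx; have [yA|yA] := leP (- A) y; [right|left].
    by rewrite yx.
  by rewrite ler_normr; apply/orP; right; lra.
have k2 : prb (X N) (~` `]-oo, x]%classic) <= prb (X N) [set x | A <= `|x|] + prb (X N) `[x, A]%classic.
  apply: le_trans (prbU _ _ _) => //; apply: le_prb => //; [exact: measurableC|exact: measurableU|].
  move=> y /=; rewrite !in_itv /= => /negP; rewrite -ltNge => yx.
  have [yA|yA] := leP y A; [right|left]; first by rewrite (ltW yx).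
  by rewrite ler_normr ltW.
have k3 : prb Y `[(- A - D), (x + D)]%classic <= prb Y `]-oo, (x + D)]%classic.
  by apply: le_prb => //= y /=; rewrite !in_itv /= => /andP[].
have k4 : prb Y `[(x - D), (A + D)]%classic <= prb Y (~` `]-oo, (x - 2 * D)]%classic).
  apply: le_prb => //=; first exact: measurableC.
  by move=> y /=; rewrite !in_itv /= => /andP[h _]; apply/negP; rewrite -ltNge; lra.
rewrite prbC// in k2; rewrite prbC// in k4.
have d1 := hD (x + D) ltac:(rewrite (_ : x + D - x = D) ?ger0_norm; lra).
have d2 := hD (x - 2 * D) ltac:(rewrite (_ : x - 2 * D - x = - (2 * D)) ?normrN ?ger0_norm; lra).
move: d1 d2; rewrite !ler_norml; lra.
Unshelve. all: by end_near. Qed.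

End continuity_theorem.

Section cumulants_moments.
Context (R : realType) (dp : measure_display) (T : measurableType dp)
  (P : probability T R) (X : {RV P >-> R}).
Hypothesis eX : exp_integrable X.

Lemma cumulantE n : cumulant n X = D0 n (fun t => ln (mgf X t)).
Proof. by []. Qed.

Lemma moment0 : moment X 0 = 1.
Proof. by rewrite -D0_mgf// /D0 /= mgf0. Qed.

(** The Leibniz rule for M' = M (log M)'. The moment of order n + 1 is a polynomial in the cumulants
    up to that order, so convergence passes from cumulants to moments. *)
Lemma moment_rec n : moment X n.+1 =
  \sum_(k < n.+1) 'C(n, k)%:R * moment X k * cumulant (n - k).+1 X.
Proof.
have s1 := smooth_mgf eX.
have s2 : smooth (fun t => ln (mgf X t)) by apply: smooth_ln => // x; exact: mgf_gt0.
have h : derive1 (mgf X) = mgf X \* derive1 (fun t => ln (mgf X t)).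
  apply/funext => t; rewrite /=.
  have [_ ] := derive1_ln t (mgf_gt0 eX) s1.
  rewrite -derive1E => ->; rewrite mulrC divfK// gt_eqF//; exact: mgf_gt0.
rewrite -D0_mgf// D0S h D0M//; last exact: smooth_derive1.
by apply: eq_bigr => k _; rewrite D0_mgf// -D0S.
Qed.

Lemma cumulant1E : cumulant 1 X = moment X 1.
Proof. by rewrite moment_rec big_ord_recl big_ord0 bin0 moment0 !mul1r addr0. Qed.

Lemma cumulant2E : cumulant 2 X = moment X 2 - moment X 1 ^+ 2.
Proof.
rewrite (moment_rec 1) big_ord_recl big_ord_recl big_ord0 moment0 /= bin0 bin1.
by rewrite cumulant1E /bump /=; ring.
Qed.

End cumulants_moments.

Section cumulant_convergence.
Context (R : realType) (F : set_system nat) (FF : ProperFilter F).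
Context (d : nat -> measure_display) (T : forall N, measurableType (d N))
  (P : forall N, probability (T N) R) (X : forall N, {RV (P N) >-> R}).
Context (dq : measure_display) (TQ : measurableType dq) (Q : probability TQ R)
  (Y : {RV Q >-> R}).
Hypotheses (eX : forall N, exp_integrable (X N)) (eY : exp_integrable Y).
Hypothesis mgf_bound : forall s, exists C, \forall N \near F, mgf (X N) s <= C.
Hypothesis cumulant_cvg : forall k, (0 < k)%N -> cumulant k (X N) @[N --> F] --> cumulant k Y.

Theorem cdf_cvg_of_cumulants (x : R) :
  {for x, continuous (fun y : R => distribution Q Y `]-oo, y]%classic)} ->
  cdf (X N) x @[N --> F] --> distribution Q Y `]-oo, x]%classic.
Proof.
apply: cdf_cvg_of_moments => //; elim/ltn_ind => -[|k] IH.
  rewrite moment0//; under eq_fun => N do rewrite moment0//; exact: cvg_cst.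
rewrite moment_rec//; under eq_fun => N do rewrite moment_rec//.
suff H m : (m <= k.+1)%N ->
    \sum_(i < m) 'C(k, i)%:R * moment (X N) i * cumulant (k - i).+1 (X N) @[N --> F] -->
    \sum_(i < m) 'C(k, i)%:R * moment Y i * cumulant (k - i).+1 Y by exact: H.
elim: m => [|m IHm] mk.
  rewrite big_ord0; under eq_fun => N do rewrite big_ord0; exact: cvg_cst.
rewrite big_ord_recr; under eq_fun => N do rewrite big_ord_recr.
apply: cvgD; first exact: IHm (ltnW mk).
apply: cvgM; last exact: cumulant_cvg.
by apply: cvgM; [exact: cvg_cst|exact: IH].
Qed.

End cumulant_convergence.

Section borel_valued.
Context (R : realType) (dp : measure_display) (T : measurableType dp)
  (P : probability T R) (X : {RV P >-> R}).

(* R and measurableTypeR R carry the same sigma-algebra under two displays. *)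
Definition borel_rv : T -> measurableTypeR R := X.

Lemma measurable_borel_rv : measurable_fun [set: T] borel_rv.
Proof. by move=> mT B mB; have := measurable_funPT X mT B mB. Qed.

HB.instance Definition _ :=
  @isMeasurableFun.Build _ _ T (measurableTypeR R) borel_rv measurable_borel_rv.

Definition borel_law : probability (measurableTypeR R) R := distribution P borel_rv.

End borel_valued.

(** * Distribution functions determine laws *)

Section law_uniqueness.
Context (R : realType) (dp : measure_display) (T : measurableType dp)
  (P : probability T R) (X : {RV P >-> R}).
Context (dq : measure_display) (TQ : measurableType dq) (Q : probability TQ R)
  (Y : {RV Q >-> R}).

Lemma countable_compl_itv (C : set R) (a b : R) : countable C -> a < b ->
  exists2 x, a < x < b & ~ C x.
Proof.
move=> cC ab; apply: contrapT => h.
have sub : `]a, b[%classic `<=` C.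
  move=> x /=; rewrite in_itv /= => xab; apply: contrapT => nCx; apply: h.
  by exists x.
have := countable_lebesgue_measure0 (sub_countable (subset_card_le sub) cC).
rewrite lebesgue_measure_itv /= lte_fin ab -EFinB => /eqP; rewrite eqe.
by rewrite gt_eqF// subr_gt0.
Qed.

(** The half-open intervals around x shrink to {x}, so their probabilities tend to 0, and these
    bound the increments near x. *)
Lemma cdf_continuous_of_noatom (x : R) : distribution P X [set x] = 0%E ->
  {for x, continuous (fun y : R => distribution P X `]-oo, y]%classic)}.
Proof.
move=> x0; pose A n := `]x - n.+1%:R^-1, x + n.+1%:R^-1]%classic.
have finE (y : R) : distribution P X `]-oo, y]%classic = (prb X `]-oo, y]%classic)%:E.
  by rewrite prb_fin.
have capA : \bigcap_n A n = [set x].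
  apply/seteqP; split=> [y h|y -> n _] /=; last first.
    rewrite /A /= in_itv /=; have : 0 < n.+1%:R^-1 :> R by rewrite invr_gt0.
    by move: (_^-1) => i ?; apply/andP; split; lra.
  apply/eqP; rewrite -subr_eq0 -normr_le0 leNgt; apply/negP => yx.
  pose n := Num.trunc (`|y - x|^-1).
  have := h n I; rewrite /A /= in_itv /= => /andP[h1 h2].
  have : `|y - x|^-1 < n.+1%:R by rewrite /n truncnS_gt.
  rewrite invf_plt ?posrE// => hn.
  have : `|y - x| <= n.+1%:R^-1.
    by move: h1 h2; rewrite ler_norml; move: (n.+1%:R^-1) => i ? ?; apply/andP; split; lra.
  by rewrite leNgt hn.
have mA n : measurable (X @^-1` A n) by apply: measurable_preim; rewrite /A.
have cA : P (X @^-1` A n) @[n --> \oo] --> 0%E.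
  rewrite -x0 /distribution /pushforward -capA preimage_bigcap.
  apply: nonincreasing_cvg_mu => //.
  - by rewrite -ge0_fin_numE// fin_num_measure.
  - by apply: bigcapT_measurable.
  - move=> m n mn; apply/subsetPset; apply: preimage_subset => y; rewrite /A /= !in_itv /=.
    have : n.+1%:R^-1 <= m.+1%:R^-1 :> R by rewrite lef_pV2 ?posrE// ler_nat.
    by move: (_^-1) (_^-1) => i j ? /andP[? ?]; apply/andP; split; lra.
rewrite (_ : (fun y => _) = (fun y => (prb X `]-oo, y]%classic)%:E)); last first.
  by apply/funext => y; rewrite finE.
rewrite /continuous_at.
apply: cvg_EFin; first exact: nearW.
apply/cvgrPdist_le => e e0.
have /fine_cvgP[_ /cvgrPdist_le/(_ e e0)[n _ /(_ n (leqnn n))]] := cA.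
rewrite /= sub0r normrN => hn.
have n0 : 0 < n.+1%:R^-1 :> R by rewrite invr_gt0.
have {}hn : prb X (A n) <= e by apply: le_trans hn; exact: ler_norm.
apply/nbhs_ballP; exists n.+1%:R^-1 => //= y; rewrite /ball /= ltr_norml => /andP[h1 h2].
have mAn : measurable (A n) by rewrite /A.
have k1 : prb X `]-oo, y]%classic <= prb X `]-oo, x]%classic + prb X (A n).
  apply: le_trans (prbU _ _ _) => //; apply: le_prb => //; first exact: measurableU.
  move=> z; rewrite /A /= !in_itv /= => zy; have [zx|zx] := leP z x; [by left|right].
  by move: h1 h2; move: (n.+1%:R^-1) => i ? ?; apply/andP; split; lra.
have k2 : prb X `]-oo, x]%classic <= prb X `]-oo, y]%classic + prb X (A n).
  apply: le_trans (prbU _ _ _) => //; apply: le_prb => //; first exact: measurableU.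
  move=> z; rewrite /A /= !in_itv /= => zy; have [zx|zx] := leP z y; [by left|right].
  by move: h1 h2; move: (n.+1%:R^-1) => i ? ?; apply/andP; split; lra.
by rewrite ler_norml; apply/andP; split; lra.
Qed.

Lemma countable_atoms : countable [set x | distribution P X [set x] != 0%E].
Proof.
apply: sub_countable (pmf_gt0_countable X); apply: subset_card_le => x /= h.
rewrite /pmf lt_neqAle; apply/andP; split; last exact: fine_ge0.
rewrite eq_sym; apply: contra h; rewrite fine_eq0//.
exact: fin_num_measure (measurable_preim _ _).
Qed.

(** The complement of a countable set is dense, so right continuity extends the equality to all
    points. [C] will hold the atoms of two limit laws, where convergence in law gives no
    information. *)
Lemma distribution_eq (C : set R) : countable C ->
  (forall x, ~ C x -> distribution P X `]-oo, x]%classic = distribution Q Y `]-oo, x]%classic) ->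
  forall A, measurable A -> distribution P X A = distribution Q Y A.
Proof.
move=> cC XY.
have XYT (x : R) : cdf X x = cdf Y x.
  have good n : exists y, x < y < x + n.+1%:R^-1 /\ ~ C y.
    have xn : x < x + n.+1%:R^-1 by rewrite ltrDl invr_gt0.
    by have [y ? ?] := countable_compl_itv cC xn; exists y.
  have [y hy] := choice good.
  have cy : y n @[n --> \oo] --> x.
    apply/cvgrPdist_le => e e0; near=> n.
    have [/andP[y1 y2] _] := hy n.
    have : n.+1%:R^-1 < e by near: n; exact: (near_infty_natSinv_lt (PosNum e0)).
    by move: y2; move: (n.+1%:R^-1) => i ? ?; rewrite distrC ger0_norm; lra.
  have cright (d' : measure_display) (T' : measurableType d') (P' : probability T' R)
      (Z : {RV P' >-> R}) : cdf Z (y n) @[n --> \oo] --> cdf Z x.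
    have cf : cdf Z x \is a fin_num by exact: fin_num_measure.
    have : cdf Z r @[r --> x^'+] --> (fine (cdf Z x))%:E.
      by rewrite fineK//; exact: cdf_right_continuous.
    move/cvge_at_rightP => /(_ y); rewrite fineK//; apply; split => // n.
    by have [/andP[]] := hy n.
  have h1 := cright _ _ _ X; have h2 := cright _ _ _ Y.
  have h3 : (fun n => cdf X (y n)) = (fun n => cdf Y (y n)).
    by apply/funext => n; apply: XY; have [] := hy n.
  by rewrite h3 in h1; exact: cvg_unique h1 h2.
move=> A mA.
suff : borel_law X A = borel_law Y A by [].
rewrite -(lebesgue_stieltjes_cdf_id (borel_law X) mA).
apply: lebesgue_stieltjes_measure_unique => // I [[a b]] _ <-.
have mI : measurable `]a, b]%classic by [].
rewrite lebesgue_stieltjes_cdf_id//= -/(distribution P X _) -/(distribution Q Y _).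
have [ab|ba] := leP a b; last first.
  by rewrite set_itv_ge ?measure0// bnd_simp -leNgt ltW.
have itvE (d' : measure_display) (T' : measurableType d') (P' : probability T' R)
    (Z : {RV P' >-> R}) : distribution P' Z `]a, b]%classic = (cdf Z b - cdf Z a)%E.
  have -> : `]a, b]%classic = `]-oo, b] `\` `]-oo, a] :> set R.
    by rewrite -[RHS]setCK setCD setCitvl setUC -[LHS]setCK setCitv.
  rewrite measureD ?setIidr//; first exact: subset_itvl.
  by rewrite -ge0_fin_numE// fin_num_measure.
by have := itvE _ _ _ X; rewrite !XYT -(itvE _ _ _ Y).
Unshelve. all: by end_near. Qed.

End law_uniqueness.

Section mgf_law.
Context (R : realType) (dp : measure_display) (T : measurableType dp)
  (P : probability T R) (X : {RV P >-> R}).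
Context (dq : measure_display) (TQ : measurableType dq) (Q : probability TQ R)
  (Y : {RV Q >-> R}).

Lemma mgf_eq_of_law : (forall A, measurable A -> distribution P X A = distribution Q Y A) ->
  mgf X = mgf Y.
Proof.
move=> h; apply/funext => s; rewrite !mgfE /Rintegral; congr fine.
have me : measurable_fun [set: R] (fun x => (expR (s * x))%:E : \bar R).
  by apply/measurable_EFinP; apply: measurableT_comp => //; exact: measurable_funM.
have e0 (x : R) : (0 <= (expR (s * x))%:E)%E by rewrite lee_fin expR_ge0.
transitivity (\int[distribution P X]_x (expR (s * x))%:E)%E.
  by rewrite ge0_integral_distribution.
rewrite (@eq_measure_integral _ _ _ setT (distribution Q Y)).
  by rewrite ge0_integral_distribution.
by move=> A mA _; exact: h.
Qed.

End mgf_law.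

(** * Sums of independent uniform variables *)

Section rv_of.
Context (R : realType) (dp : measure_display) (T : measurableType dp)
  (f : T -> R) (mf : measurable_fun [set: T] f).

Definition rv_of_fun : T -> R := f.

HB.instance Definition _ := isMeasurableFun.Build _ _ _ _ rv_of_fun mf.

Definition rv_of : {mfun T >-> R} := rv_of_fun.

End rv_of.

Section uniform_sums.
Variable R : realType.

Lemma unif_law_exists (t : R) : 0 <= t ->
  exists V : probability (measurableTypeR R) R,
    (forall A, measurable A -> V A = unif_law (- (t / 2)) (t / 2) A) /\
    forall s, (\int[V]_x (expR (s * x))%:E = (unif_mgf (t * s))%:E)%E.
Proof.
move=> t0; rewrite /unif_law; case: pselect => [ab|nab].
  by exists (uniform_prob ab); split => // s; exact: integral_uniform_unif_mgf.
have -> : t = 0 by apply/eqP; rewrite eq_le t0 andbT leNgt; apply/negP => t1; apply: nab; lra.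
exists (dirac (- (0 / 2) : measurableTypeR R) : probability (measurableTypeR R) R); split=> // s.
rewrite integral_dirac//.
  by rewrite diracT mul1e !mul0r unif_mgf0 oppr0 mulr0 expR0.
by apply/measurable_EFinP; apply: measurableT_comp => //; exact: measurable_funM.
Qed.

(** One factor of a product space is added per variable. From index n on the variables are
    constantly 0, so the whole sequence lives on a finite product; this serves sequences t of finite
    support. *)
Lemma indep_unif_exists (t : R^nat) (n : nat) : (forall k, 0 <= t k) ->
  exists (dp : measure_display) (T : measurableType dp) (P : probability T R)
    (U : nat -> {RV P >-> R}),
    [/\ mutually_independent U,
        forall k (A : set R), (k < n)%N -> measurable A ->
          distribution P (U k) A = unif_law (- (t k / 2)) (t k / 2) A,
        forall k w, (n <= k)%N -> U k w = 0
      & forall s, (\int[P]_w (expR (s * \sum_(k < n) U k w))%:E =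
                   (\prod_(k < n) unif_mgf (t k * s))%:E)%E].
Proof.
move=> t0; elim: n => [|n [dp [T [P [U [indU lawU U0 mU]]]]]].
  exists _, (measurableTypeR R), (dirac (0 : measurableTypeR R)),
    (fun=> rv_of (@measurable_cst _ _ _ _ setT (0 : R))).
  split=> //.
  - move=> J B mB.
    have [allJ|] := pselect (forall k, k \in J -> B k 0).
      rewrite (_ : \bigcap_(k in _) _ = setT); last first.
        by apply/seteqP; split=> // w _ k /= kJ; exact: allJ.
      rewrite probability_setT big_seq big1// => k kJ.
      rewrite (_ : _ @^-1` _ = setT) ?probability_setT//.
      by apply/seteqP; split=> // w _ /=; exact: allJ.
    move=> /existsNP[k /not_implyP[kJ nB]].
    have B0 : rv_of (@measurable_cst _ _ (measurableTypeR R) R setT (0 : R)) @^-1` B k = set0.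
      by apply/seteqP; split=> // w /=.
    rewrite (big_fsetD1 k)//= B0 measure0 mul0e.
    rewrite (_ : \bigcap_(k in _) _ = set0) ?measure0//.
    by apply/seteqP; split=> // w h; exact: (nB (h k kJ)).
  - move=> s; rewrite big_ord0 (eq_integral (cst 1%E)).
      by rewrite integral_cst//= probability_setT mul1e.
    by move=> w _; rewrite big_ord0 mulr0 expR0.
have [V [lawV mV]] := unif_law_exists (t0 n).
pose P' := [the probability (T * measurableTypeR R)%type R of (P \x V)%E].
have mf k : measurable_fun [set: T * measurableTypeR R]
    (fun w => if k == n then w.2 else U k w.1 : R).
  case: eqP => _; first by move=> mT B mB; have := @measurable_snd _ _ T (measurableTypeR R) mT B mB.
  exact: (measurableT_comp (measurable_funPT (U k)) measurable_fst).
pose U' k : {RV P' >-> R} := rv_of (mf k).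
have preU k (B : set R) : k != n -> U' k @^-1` B = (U k @^-1` B) `*` setT.
  move=> kn; apply/seteqP; split=> -[w v] /=; rewrite /rv_of_fun /= (negbTE kn); first by [].
  by case.
have preV (B : set R) : U' n @^-1` B = setT `*` B.
  by apply/seteqP; split=> -[w v] /=; rewrite /rv_of_fun /= eqxx; [|case].
have PE (A : set T) (B : set (measurableTypeR R)) : measurable A -> measurable B ->
  P' (A `*` B) = (P A * V B)%E by exact: product_measure1E.
have mU' k (B : set R) : measurable B -> measurable (U k @^-1` B).
  exact: measurable_preim.
have PU k (B : set R) : k != n -> measurable B -> P' (U' k @^-1` B) = P (U k @^-1` B).
  by move=> kn mB; rewrite preU// PE//; [rewrite probability_setT mule1|exact: mU'].
have PV (B : set R) : measurable B -> P' (U' n @^-1` B) = V B.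
  by move=> mB; rewrite preV PE// probability_setT mul1e.
exists _, (T * measurableTypeR R)%type, P', U'; split.
- move=> J B mB.
  (* A possible condition on index n concerns the new coordinate only, so the event is a
     rectangle. *)
  have capE : \bigcap_(k in [set` J]) (U' k @^-1` B k) =
      (\bigcap_(k in [set` (J `\ n)%fset]) (U k @^-1` B k)) `*`
      (if n \in J then B n else setT).
    apply/seteqP; split=> -[w v] /=.
      move=> h; split=> /=.
        move=> k /=; rewrite !inE => /andP[kn kJ].
        by have : (U' k @^-1` B k) (w, v) := h k kJ; rewrite preU// => -[].
      by case: ifPn => // nJ; have : (U' n @^-1` B n) (w, v) := h n nJ; rewrite preV => -[].
    move=> [h1 h2] k /= kJ; suff : (U' k @^-1` B k) (w, v) by [].
    have [kn|kn] := eqVneq k n.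
      by rewrite kn preV; move: h2; rewrite -kn kJ.
    by rewrite preU//; split=> //; apply: h1; rewrite /= !inE kn.
  rewrite capE PE; last 2 first.
  + by apply: fin_bigcap_measurable => // k _; exact: mU'.
  + by case: ifP => _; [exact: mB|exact: measurableT].
  rewrite indU//.
  have prodE : (\prod_(k <- (J `\ n)%fset) P (U k @^-1` B k) =
      \prod_(k <- (J `\ n)%fset) P' (U' k @^-1` B k))%E.
    by rewrite big_seq [RHS]big_seq; apply: eq_bigr => k; rewrite !inE => /andP[kn _]; rewrite PU.
  rewrite prodE; case: ifPn => nJ.
    by rewrite [RHS](big_fsetD1 n)//= PV// muleC.
  by rewrite probability_setT mule1 mem_fsetD1.
- move=> k A; rewrite ltnS leq_eqVlt => /orP[/eqP ->|kn] mA.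
    by rewrite /distribution /pushforward PV// lawV.
  by rewrite /distribution /pushforward PU// ?ltn_eqF//; exact: lawU.
- move=> k [w v] nk; rewrite /= /rv_of_fun gtn_eqF//=; exact: U0 (ltnW nk).
- move=> s.
  have sumE (w : T * measurableTypeR R) :
      expR (s * \sum_(k < n.+1) U' k w) = expR (s * \sum_(k < n) U k w.1) * expR (s * w.2).
    rewrite -expRD -mulrDr big_ord_recr /= /rv_of_fun /= eqxx; congr (expR (s * (_ + _))).
    by apply: eq_bigr => k _; rewrite ltn_eqF.
  have mS : measurable_fun [set: T] (fun w => expR (s * \sum_(k < n) U k w)).
    apply: measurableT_comp => //; apply: measurable_funM => //.
    by apply: measurable_sum.
  have mE : measurable_fun [set: measurableTypeR R] (fun x : R => expR (s * x)).
    by apply: measurableT_comp => //; exact: measurable_funM.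
  under eq_integral => w _ do rewrite sumE.
  rewrite [LHS](_ : _ = \int[(P \x V)%E]_w (expR (s * \sum_(k < n) U k w.1) * expR (s * w.2))%:E)%E//.
  rewrite fubini_tonelli1//=; last first.
    apply/measurable_EFinP; apply: measurable_funM.
      exact: (measurableT_comp mS measurable_fst).
    exact: (measurableT_comp mE measurable_snd).
  rewrite /fubini_F /=.
  have inner (c : R) : 0 <= c ->
      (\int[V]_v (c * expR (s * v))%:E = c%:E * (unif_mgf (t n * s))%:E)%E.
    move=> c0; under eq_integral => v _ do rewrite EFinM.
    rewrite ge0_integralZl//; first by rewrite mV.
      exact/measurable_EFinP.
  under eq_integral => w _ do rewrite inner ?expR_ge0//.
  rewrite ge0_integralZr//; last 2 first.
  + exact/measurable_EFinP.
  + by rewrite lee_fin ltW// unif_mgf_gt0.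
  by rewrite mU -EFinM big_ord_recr.
Qed.

Lemma unif_sum_exists (t : R^nat) (K : nat) : (forall k, 0 <= t k) ->
  (forall k, (K <= k)%N -> t k = 0) ->
  exists (dp : measure_display) (T : measurableType dp) (P : probability T R)
    (S : {RV P >-> R}),
    [/\ is_unif_sum t S, exp_integrable S & forall s, mgf S s = \prod_(k < K) unif_mgf (t k * s)].
Proof.
move=> t0 tK; have [dp [T [P [U [indU lawU U0 mU]]]]] := indep_unif_exists K t0.
have mS : measurable_fun [set: T] (fun w => \sum_(k < K) U k w) by exact: measurable_sum.
pose S : {RV P >-> R} := rv_of mS.
exists dp, T, P, S; split.
- exists U; split=> //.
    move=> k A mA; have [kK|kK] := ltnP k K; first exact: lawU.
    (* From index K on the interval is a point, [unif_law] is the mass at 0, and the variable is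
       constantly 0. *)
    rewrite tK// mul0r oppr0 /unif_law; case: pselect => [ab|_]; first by exfalso; rewrite ltxx in ab.
    rewrite /distribution /pushforward diracE.
    have [A0|nA0] := pselect (A 0).
      rewrite mem_set// (_ : _ @^-1` _ = setT) ?probability_setT//.
      by apply/seteqP; split=> // w _ /=; rewrite U0.
    rewrite memNset// (_ : _ @^-1` _ = set0) ?measure0//.
    by apply/seteqP; split=> // w /=; rewrite U0.
  apply: aeW => w; apply: cvg_near_cst; near=> N.
  rewrite /series /= (big_cat_nat _ (n := K))//=; last by near: N; exact: nbhs_infty_ge.
  rewrite [X in _ + X]big_nat_cond [X in _ + X]big1 ?addr0; last first.
    by move=> k /andP[/andP[Kk _] _]; rewrite U0.
  by rewrite big_mkord.
- move=> s; apply/integrableP; split.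
    by apply/measurable_EFinP; apply: measurableT_comp => //; exact: measurable_funM.
  under eq_integral => x _ do rewrite /= ger0_norm ?expR_ge0//.
  by rewrite mU ltry.
- by move=> s; rewrite mgfE /Rintegral mU.
Unshelve. all: by end_near. Qed.

End uniform_sums.

(** * Cumulants of the rank *)

Section standardization.
Context (R : realType) (dp : measure_display) (T : measurableType dp)
  (P : probability T R) (X : {RV P >-> R}).
Hypothesis eX : exp_integrable X.

Let mu := fine ('E_P[X])%E.
Let sigma := Num.sqrt (fine ('V_P[X])%E).

Lemma fine_expectation : fine ('E_P[X])%E = moment X 1.
Proof.
rewrite unlock /moment /Rintegral; congr fine; apply: eq_integral => w _.
Qed.

Lemma fine_variance : fine ('V_P[X])%E = cumulant 2 X.
Proof.
rewrite cumulant2E//.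
have i1 : P.-integrable setT (EFin \o X).
  by have := integrable_pow eX 1; congr (_.-integrable _ _).
have Em : ('E_P[X] = (moment X 1)%:E)%E.
  by rewrite -fine_expectation fineK// unlock; exact: integrable_fin_num.
rewrite /variance unlock /covariance.body Em unlock.
pose m := moment X 1.
transitivity (\int[P]_w (X w ^+ 2 + ((- (2 * m)) * X w + m ^+ 2))).
  rewrite /Rintegral; congr fine; apply: eq_integral => w _; congr (_%:E).
  by rewrite !fctE /= -/m; ring.
have i2 : P.-integrable setT (EFin \o (fun w => - (2 * m) * X w)).
  by have := integrableZl measurableT (- (2 * m)) i1; congr (_.-integrable _ _).
have i3 : P.-integrable setT (EFin \o (fun w : T => m ^+ 2)).
  by have := finite_measure_integrable_cst P (m ^+ 2) measurableT; congr (_.-integrable _ _).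
have i4 : P.-integrable setT (EFin \o (fun w => - (2 * m) * X w + m ^+ 2)).
  by have := integrableD measurableT i2 i3; congr (_.-integrable _ _).
rewrite RintegralD//; last exact: integrable_pow.
rewrite RintegralD// RintegralZl// Rintegral_cst//= probability_setT /= mulr1.
rewrite (_ : \int[P]_w X w = m); last by apply: eq_Rintegral => w _; rewrite expr1.
by rewrite -/m -/(moment X 2); ring.
Qed.

Lemma standardize_expR s w :
  expR (s * standardize X w) = expR (- (mu / sigma) * s) * expR (sigma^-1 * s * X w).
Proof. by rewrite -expRD; congr expR; rewrite /= /standardize_fun -/mu -/sigma; ring. Qed.

Lemma standardize_exp_integrable : exp_integrable (standardize X).
Proof.
move=> s.
have := integrableZl measurableT (expR (- (mu / sigma) * s)) (eX (sigma^-1 * s)).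
congr (_.-integrable _ _); apply/funext => w.
by rewrite [in RHS]/comp standardize_expR EFinM.
Qed.

Lemma mgf_standardize s :
  mgf (standardize X) s = expR (- (mu / sigma) * s) * mgf X (sigma^-1 * s).
Proof.
rewrite !mgfE -(RintegralZl _ measurableT (eX _)).
by apply: eq_Rintegral => w _; rewrite standardize_expR.
Qed.

Lemma cumulant_standardize d : (2 <= d)%N ->
  cumulant d (standardize X) = (Num.sqrt (cumulant 2 X))^-1 ^+ d * cumulant d X.
Proof.
move=> d2; rewrite -fine_variance -/sigma !cumulantE.
have sl : smooth (fun t => ln (mgf X t)).
  by apply: smooth_ln; [move=> x; exact: mgf_gt0|exact: smooth_mgf].
rewrite (_ : (fun t => ln (mgf (standardize X) t)) =
   (fun t => - (mu / sigma) * id t) \+ (fun t => ln (mgf X (sigma^-1 * t)))); last first.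
  apply/funext => t; rewrite mgf_standardize lnM ?posrE ?expR_gt0//; last exact: mgf_gt0.
  by rewrite expRK.
rewrite D0D; last 2 first.
- by apply: (smooth_scale (f := id)); exact: smooth_id.
- exact: (smooth_scale (f := fun t => ln (mgf X t))).
rewrite D0Zl; last exact: smooth_id.
rewrite D0_id (D0_scale d sigma^-1 sl).
by case: d d2 => [|[|d]]//= _; rewrite mulr0 add0r.
Qed.

Lemma cumulant1_standardize : cumulant 1 (standardize X) = 0.
Proof.
rewrite cumulant1E; last exact: standardize_exp_integrable.
have i1 : P.-integrable setT (EFin \o X).
  by have := integrable_pow eX 1; congr (_.-integrable _ _).
have i3 : P.-integrable setT (EFin \o (fun w : T => - (mu / sigma))).
  by have := finite_measure_integrable_cst P (- (mu / sigma)) measurableT; congr (_.-integrable _ _).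
have i2 : P.-integrable setT (EFin \o (fun w => sigma^-1 * X w)).
  by have := integrableZl measurableT sigma^-1 i1; congr (_.-integrable _ _).
transitivity (\int[P]_w (sigma^-1 * X w + - (mu / sigma))).
  by apply: eq_Rintegral => w _; rewrite expr1 /= /standardize_fun -/mu -/sigma; ring.
rewrite RintegralD// RintegralZl// Rintegral_cst//= probability_setT /= mulr1.
rewrite (_ : \int[P]_w X w = mu); first by ring.
by rewrite /mu fine_expectation; apply: eq_Rintegral => w _; rewrite expr1.
Qed.

End standardization.

(** * Uniform tableaux and their rank *)

Section finite_space.
Variables (R : realType) (la : seq nat) (m : nat).

Lemma integral_filling (P : probability (filling la m) R) (f : filling la m -> R) :
  (forall T, 0 <= f T) ->
  (\int[P]_T (f T)%:E = \sum_T (f T)%:E * P [set T])%E.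
Proof.
move=> f0.
rewrite (eq_integral (fun T => \sum_(T0 <- index_enum (filling la m)) ((f T0) * \1_[set T0] T)%:E)%E); last first.
  move=> T _; rewrite sumEFin; congr (_%:E).
  rewrite (bigD1 T)//= indicE mem_set// mulr1 big1 ?addr0// => T0 T0T.
  by rewrite indicE memNset ?mulr0// => /esym/eqP; rewrite (negbTE T0T).
rewrite ge0_integral_sum//; last by move=> T0 T _; rewrite lee_fin mulr_ge0.
apply: eq_bigr => T _.
under eq_integral => T0 _ do rewrite EFinM.
rewrite ge0_integralZl//; last by rewrite lee_fin.
by rewrite integral_indic// setIT.
Qed.

Lemma filling_exp_integrable (P : probability (filling la m) R) (X : {RV P >-> R}) :
  exp_integrable X.
Proof.
move=> s; apply/integrableP; split; first by [].
under eq_integral => x _ do rewrite /= ger0_norm ?expR_ge0//.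
rewrite integral_filling; last by move=> T; exact: expR_ge0.
rewrite (eq_bigr (fun T => (expR (s * X T) * fine (P [set T]))%:E)).
  by rewrite sumEFin ltry.
by move=> T _; rewrite EFinM fineK// fin_num_measure.
Qed.

Lemma ssyt_prob_set1 : (exists T0 : filling la m, is_ssyt T0) ->
  exists K : R, forall T : filling la m,
    ssyt_prob R la m [set T] = (if is_ssyt T then K else 0)%:E.
Proof.
move=> [T0 sT0].
pose mu := mrestr (@counting (filling la m) R) (measurable_SSYT la m).
have muT : mu setT = @counting (filling la m) R (SSYT la m) by rewrite /mu /mrestr setTI.
have fin_mu : mu setT \is a fin_num.
  by rewrite muT /counting asboolT//; exact: finite_finset.
have mu1 T : mu [set T] = (if is_ssyt T then 1 else 0)%:E.
  rewrite /mu /mrestr; case: ifPn => sT.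
    have -> : [set T] `&` SSYT la m = [set T].
      by apply/seteqP; split=> [x []//|x ->]; split.
    by rewrite /counting asboolT// fset_set1 cardfs1.
  rewrite (_ : _ `&` _ = set0) ?measure0//.
  by apply/seteqP; split=> // x [/= ->]; rewrite /SSYT /= (negbTE sT).
have mu0 : mu setT != 0%E.
  rewrite gt_eqF//; apply: (@lt_le_trans _ _ (mu [set T0])).
    by rewrite mu1 sT0 lte_fin.
  by apply: le_measure; rewrite ?inE.
exists (fine (mu setT))^-1 => T.
transitivity (mu [set T] * (fine (mu setT))^-1%:E)%E; last first.
  by rewrite mu1; case: ifP => _; rewrite ?mul1e ?mul0e.
rewrite /ssyt_prob /= /mnormalize ifN//.
apply/norP; split; first exact: mu0.
by apply: contraTneq fin_mu => h; rewrite [mu _]h.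
Qed.

Lemma mgf_rank_sum : (exists T0 : filling la m, is_ssyt T0) ->
  exists K : R, forall s,
    mgf (rank_var R la m) s = K * \sum_(T : filling la m | is_ssyt T) expR (s * (rank T)%:R).
Proof.
move=> /ssyt_prob_set1[K hK]; exists K => s.
rewrite mgfE /Rintegral integral_filling; last by move=> T; exact: expR_ge0.
rewrite (eq_bigr (fun T : filling la m => (if is_ssyt T then K * expR (s * (rank T)%:R) else 0)%:E)).
  by rewrite sumEFin -big_mkcond /= mulr_sumr.
move=> T _; rewrite -[ssyt_prob R la m [set T]]/(ssyt_prob R la m [set T]) hK -EFinM; congr (_%:E).
by rewrite /rank_fun; case: ifP => _; rewrite ?mulr0// mulrC.
Qed.

Lemma rank_cells (T : filling la m) : rank T = (\sum_x (T x - 1))%N.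
Proof.
have contentE (i : nat) : Defs.content T i = (\sum_(x : cell la) (T x == i :> nat))%N.
  apply: (etrans (esym (sum1_card _))); rewrite big_mkcond /=; apply: eq_bigr => x _; rewrite inE.
  by case: eqP.
rewrite /rank; under eq_bigr => i _ do rewrite contentE big_distrr /=.
rewrite exchange_big /=; apply: eq_bigr => x _.
have [->|Tx0] := posnP (T x).
  by rewrite big1_seq// => i /andP[_]; rewrite mem_index_iota => /andP[i0 _]; rewrite ltn_eqF ?muln0.
rewrite (bigD1_seq (T x : nat))/= ?iota_uniq//; last by rewrite mem_index_iota Tx0 ltn_ord.
by rewrite eqxx muln1 big1 ?addn0// => i; rewrite eq_sym => /negbTE ->; rewrite muln0.
Qed.

(** Tableau sums carry the exponents m - T x, the rank the exponents T x - 1. They add up to m - 1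
    per cell because the entries are positive. *)
Lemma rank_compl (T : filling la m) : is_ssyt T ->
  (rank T + \sum_x (m - T x) = (m - 1) * #|{: cell la}|)%N.
Proof.
move=> /and3P[/forallP T0 _ _]; rewrite rank_cells -big_split /=.
rewrite (eq_bigr (fun=> (m - 1)%N)); first by rewrite sum_nat_const mulnC.
move=> x _; rewrite addnC addnBA// subnK//.
by rewrite -ltnS ltn_ord.
Qed.

End finite_space.

Section rank_mgf.
Variables (R : realType).

(** With p = e^(-s), a difference of powers splits into an exponential at the midpoint of the
    exponents and a factor 2 sinh((a - b) s / 2). *)
Lemma expR_sub_unif_mgf (s : R) (a b : nat) : (b <= a)%N ->
  expR (- s) ^+ b - expR (- s) ^+ a =
  expR (- ((a + b)%:R / 2) * s) * ((a - b)%:R * s * unif_mgf ((a - b)%:R * s)).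
Proof.
move=> ba; rewrite unif_mgfM mulrBr -!expRD -!expRM_natl natrB// natrD.
by congr (expR _ - expR _); field.
Qed.

Definition gap (la : seq nat) (i j : nat) : nat := (nth 0 la i - nth 0 la j + (j - i))%N.

Lemma nth_partition_le la i j : is_partition la -> (i <= j)%N -> (nth 0 la j <= nth 0 la i)%N.
Proof.
move=> pla; elim: j => [|j IH]; first by rewrite leqn0 => /eqP ->.
rewrite leq_eqVlt => /orP[/eqP ->//|/IH]; apply: leq_trans.
exact: is_partition_nth_le.
Qed.

(** The power of s is kept apart because it is the same for all shapes and cancels in the quotient
    by the empty shape. *)
Lemma qvandermonde_unif_mgf (m : nat) (lam : nat -> nat) :
  (forall i j, (i <= j)%N -> (lam j <= lam i)%N) ->
  exists c C : R, C != 0 /\ forall s, s != 0 ->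
    qvandermonde (expR (- s)) m lam =
    C * (\prod_(i < m) \prod_(j < m | (i < j)%N) s) * expR (c * s) *
    \prod_(i < m) \prod_(j < m | (i < j)%N) unif_mgf ((lam i - lam j + (j - i))%:R * s).
Proof.
move=> lamS.
pose l (i : nat) := (lam i + (m.-1 - i))%N.
exists (\sum_(i < m) \sum_(j < m | (i < j)%N) - ((l i + l j)%:R / 2)),
  (\prod_(i < m) \prod_(j < m | (i < j)%N) (lam i - lam j + (j - i))%:R); split.
  apply/prodf_neq0 => i _; apply/prodf_neq0 => j ij.
  by rewrite pnatr_eq0 -lt0n addn_gt0 [(0 < j - i)%N]subn_gt0 ij orbT.
move=> s s0.
rewrite mulr_suml expR_sum -!big_split /=; apply: eq_bigr => i _.
rewrite mulr_suml expR_sum -!big_split /=; apply: eq_bigr => j ij.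
have jm : (j <= m.-1)%N by rewrite -ltnS (leq_trans (ltn_ord j))// leqSpred.
have lE : (l i - l j = lam i - lam j + (j - i))%N.
  by have := lamS i j (ltnW ij); rewrite /l; lia.
rewrite expR_sub_unif_mgf; last by rewrite leq_add// ?lamS ?leq_sub2l// ltnW.
by rewrite lE -/(l i) -/(l j) ; ring.
Qed.

(** The exponent c stays unspecified, since standardization removes it. The substitution p = e^(-s)
    excludes s = 0, where p = 1; at that point both sides are 1. *)
Lemma rank_mgf (la : seq nat) (m : nat) : is_partition la -> (size la <= m)%N ->
  exists c : R, forall s, mgf (rank_var R la m) s =
    expR (c * s) * (\prod_(i < m) \prod_(j < m | (i < j)%N)
       (unif_mgf ((gap la i j)%:R * s) / unif_mgf ((j - i)%:R * s))).
Proof.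
move=> pla lam; pose n := #|{: cell la}|.
have [c1 [C1 [C10 h1]]] := qvandermonde_unif_mgf m (fun i j => @nth_partition_le la i j pla).
have [c2 [C2 [C20 h2]]] := @qvandermonde_unif_mgf m (fun=> 0%N) (fun _ _ _ => leqnn 0).
pose Hn s := \prod_(i < m) \prod_(j < m | (i < j)%N) unif_mgf ((gap la i j)%:R * s) : R.
pose Hd s := \prod_(i < m) \prod_(j < m | (i < j)%N) unif_mgf ((j - i)%:R * s) : R.
have Hd0 s : Hd s != 0.
  by apply/prodf_neq0 => i _; apply/prodf_neq0 => j _; rewrite gt_eqF ?unif_mgf_gt0.
have Hn0 s : Hn s != 0.
  by apply/prodf_neq0 => i _; apply/prodf_neq0 => j _; rewrite gt_eqF ?unif_mgf_gt0.
have sumE s : s != 0 -> \sum_(T : filling la m | is_ssyt T) expR (- s) ^+ (\sum_x (m - T x)) =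
    C1 / C2 * expR ((c1 - c2) * s) * (Hn s / Hd s).
  move=> s0; rewrite (filling_sum pla lam).
  have p0 : expR (- s) != 0 by rewrite gt_eqF ?expR_gt0.
  have pe e : (0 < e <= m)%N -> expR (- s) ^+ e != 1.
    move=> /andP[e0 _]; rewrite -expRM_natl -[X in _ != X]expR0; apply/eqP => /expR_inj /eqP.
    by rewrite mulf_eq0 pnatr_eq0 oppr_eq0 (negbTE s0) orbF (gtn_eqF e0).
  have := @box_sum_qvandermonde _ _ m (nth 0%N la 0) m.+1 (nth 0%N la) p0 pe (ltnSn m)
    (fun i => is_partition_nth_le i pla) (fun i => is_partition_nth_le0 i pla)
    (fun i mi => nth_default 0%N (leq_trans lam mi)).
  rewrite h1// h2//.
  rewrite (_ : \prod_(i < m) \prod_(j < m | (i < j)%N) unif_mgf _ = Hd s) // => hb.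
  rewrite mulrBl expRD.
  set V := \prod_(i < m) \prod_(j < m | (i < j)%N) s in hb.
  have V0 : V != 0 by apply/prodf_neq0 => i _; apply/prodf_neq0.
  have e1 : expR (c2 * s) != 0 by rewrite gt_eqF ?expR_gt0.
  have e2 : expR (- (c2 * s)) = (expR (c2 * s))^-1 by rewrite expRN.
  set bs := box_sum _ _ _ _ _ _ in hb *.
  have -> : bs = C1 * V * expR (c1 * s) * Hn s / (C2 * V * expR (c2 * s) * Hd s).
    by rewrite -hb mulfK// !mulf_neq0.
  rewrite e2; field; by rewrite C20 V0 e1 Hd0.
(* The right-hand side of [sumE] is nonzero at s = 1, so the sum has a term and a tableau exists. *)
have ex : exists T0 : filling la m, is_ssyt T0.
  apply: contrapT => nex; have := sumE 1 (oner_neq0 R).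
  rewrite big1; last by move=> T sT; exfalso; apply: nex; exists T.
  move=> /esym/eqP; apply/negP; rewrite !mulf_neq0// ?invr_eq0//.
  by rewrite gt_eqF ?expR_gt0.
have [K hK] := mgf_rank_sum R ex.
pose c := ((m - 1) * n)%:R + (c1 - c2) : R.
have mE s : s != 0 -> mgf (rank_var R la m) s = K * (C1 / C2) * (expR (c * s) * (Hn s / Hd s)).
  move=> s0; rewrite hK -!mulrA; congr (K * _).
  rewrite (eq_bigr (fun T : filling la m => expR (((m - 1) * n)%:R * s) * expR (- s) ^+ (\sum_x (m - T x)))).
    by rewrite -mulr_sumr sumE// /c [in RHS]mulrDl expRD; ring.
  move=> T sT; rewrite -(rank_compl sT) -expRM_natl -expRD; congr expR.
  by rewrite natrD; ring.
have sHn : smooth Hn.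
  by apply: smooth_prod => i _; apply: smooth_prod => j _; apply: smooth_scale; exact: smooth_unif_mgf.
have sHd : smooth Hd.
  by apply: smooth_prod => i _; apply: smooth_prod => j _; apply: smooth_scale; exact: smooth_unif_mgf.
have cont : {for 0, continuous (fun s => expR (c * s) * (Hn s / Hd s))}.
  apply: smooth_continuous; apply: smoothM; first by apply: (smooth_scale (f := expR)); exact: smooth_expR.
  by apply: smoothM => //; exact: smoothV.
have H0 : expR (c * 0) * (Hn 0 / Hd 0) = 1.
  rewrite mulr0 expR0 mul1r /Hn /Hd big1 ?big1 ?divr1//.
    by move=> i _; apply: big1 => j _; rewrite mulr0 unif_mgf0.
  by move=> i _; apply: big1 => j _; rewrite mulr0 unif_mgf0.
(* The constants are not known separately; letting s tend to 0 in [mE] gives 1 for their product. *)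
have KC : K * (C1 / C2) = 1.
  have eX := filling_exp_integrable (rank_var R la m).
  have cm : mgf (rank_var R la m) s @[s --> 0^'] --> (1 : R).
    have := @smooth_continuous _ _ (smooth_mgf eX) 0; rewrite /continuous_at mgf0.
    exact: cvg_within_filter.
  have cr : mgf (rank_var R la m) s @[s --> 0^'] --> K * (C1 / C2) * 1.
    apply: (@cvg_trans _ (K * (C1 / C2) * (expR (c * s) * (Hn s / Hd s)) @[s --> (0 : R)^'])).
      apply: near_eq_cvg; near=> s; rewrite mE//.
      by near: s; exact: nbhs_dnbhs_neq.
    apply: cvgM; first exact: cvg_cst.
    rewrite -H0; apply: cvg_within_filter; exact: cont.
  by have := cvg_unique _ cr cm; rewrite mulr1; apply.
exists c => s.
have -> : \prod_(i < m) \prod_(j < m | (i < j)%N) (unif_mgf ((gap la i j)%:R * s) / unif_mgf ((j - i)%:R * s)) = Hn s / Hd s.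
  rewrite /Hn /Hd -prodf_div; apply: eq_bigr => i _.
  by rewrite -prodf_div.
have [->|s0] := eqVneq s 0.
  by rewrite H0 mgf0//; exact: filling_exp_integrable.
by rewrite mE// KC mul1r.
Unshelve. all: by end_near. Qed.

End rank_mgf.

Section cumulants_of_products.
Variables (R : realType).

Lemma ln_prod (I : Type) (s : seq I) (P : pred I) (F : I -> R) :
  (forall i, P i -> 0 < F i) ->
  ln (\prod_(i <- s | P i) F i) = \sum_(i <- s | P i) ln (F i).
Proof.
move=> F0.
suff [] : 0 < \prod_(i <- s | P i) F i /\ ln (\prod_(i <- s | P i) F i) = \sum_(i <- s | P i) ln (F i) by [].
apply: (@big_rec2 _ _ (fun x y => 0 < x /\ ln x = y)); first by rewrite ltr01 ln1.
by move=> i x y Pi [x0 <-]; split; [rewrite mulr_gt0// F0|rewrite lnM ?posrE ?F0].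
Qed.

Lemma D0_ln_unif_mgf_ge2 d : (2 <= d)%N -> D0 d (@ln_unif_mgf R) = bernoulli R d / d%:R.
Proof. by move=> d2; rewrite D0_ln_unif_mgf ltnNge d2. Qed.

Context (dp : measure_display) (T : measurableType dp) (P : probability T R)
  (X : {RV P >-> R}).

Lemma cumulant_unif_sum (t : R^nat) (K d : nat) :
  (forall s, mgf X s = \prod_(k < K) unif_mgf (t k * s)) ->
  cumulant d X = D0 d (@ln_unif_mgf R) * \sum_(k < K) t k ^+ d.
Proof.
move=> hX; rewrite cumulantE (_ : (fun s => _) = (fun s => \sum_(k < K) ln_unif_mgf (t k * s))); last first.
  by apply/funext => s; rewrite hX ln_prod// => k _; exact: unif_mgf_gt0.
rewrite D0_sum => [|k _]; last by apply: smooth_scale; exact: smooth_ln_unif_mgf.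
rewrite mulr_sumr; apply: eq_bigr => k _.
by rewrite (D0_scale _ _ (@smooth_ln_unif_mgf R)) mulrC.
Qed.

End cumulants_of_products.

Section rank_cumulants.
Variables (R : realType) (la : seq nat) (m : nat).
Hypotheses (pla : is_partition la) (lam : (size la <= m)%N).

Definition gap_sum (d : nat) : R :=
  \sum_(i < m) \sum_(j < m | (i < j)%N) ((gap la i j)%:R ^+ d - (j - i)%:R ^+ d).

(** One c serves both formulas: in order 1 the Bernoulli part vanishes, so c is the mean, and
    centring cancels the exponential in [mgf_rank_std]. *)
Lemma cumulant_rankE : exists2 c : R,
  forall s, mgf (rank_var R la m) s =
    expR (c * s) * (\prod_(i < m) \prod_(j < m | (i < j)%N)
       (unif_mgf ((gap la i j)%:R * s) / unif_mgf ((j - i)%:R * s))) &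
  forall d, cumulant d (rank_var R la m) = c * (d == 1%N)%:R + D0 d (@ln_unif_mgf R) * gap_sum d.
Proof.
have [c hc] := rank_mgf R pla lam; exists c => // d.
pose g i j := (fun s : R => ln_unif_mgf ((gap la i j)%:R * s)) \- (fun s => ln_unif_mgf ((j - i)%:R * s)).
have sg (a : R) : smooth (fun s : R => ln_unif_mgf (a * s)) by apply: smooth_scale; exact: smooth_ln_unif_mgf.
have sgij i j : smooth (g i j) by exact: smoothB.
have s2 i : smooth (fun s => \sum_(j < m | (i < j)%N) g i j s) by exact: smooth_sum.
have scs : smooth (fun s : R => c * s) by apply: (smooth_scale (f := idfun)); exact: smooth_id.
rewrite cumulantE (_ : (fun s => _) = (fun s => c * s) \+
    (fun s => \sum_(i < m) \sum_(j < m | (i < j)%N) g i j s)); last first.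
  apply/funext => s; rewrite hc lnM ?posrE ?expR_gt0//; last first.
    by apply: prodr_gt0 => i _; apply: prodr_gt0 => j _; rewrite divr_gt0// unif_mgf_gt0.
  rewrite expRK ln_prod; last by move=> i _; apply: prodr_gt0 => j _; rewrite divr_gt0// unif_mgf_gt0.
  congr (_ + _); apply: eq_bigr => i _.
  rewrite ln_prod; last by move=> j _; rewrite divr_gt0// unif_mgf_gt0.
  by apply: eq_bigr => j _; rewrite ln_div ?posrE ?unif_mgf_gt0.
rewrite D0D//; last exact: smooth_sum.
rewrite (D0Zl _ _ (@smooth_id R)) D0_id; congr (_ + _).
rewrite D0_sum// /gap_sum mulr_sumr; apply: eq_bigr => i _.
rewrite D0_sum// mulr_sumr; apply: eq_bigr => j _.
rewrite D0B// !(D0_scale _ _ (@smooth_ln_unif_mgf R)).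
by rewrite mulrBr; congr (_ - _); rewrite mulrC.
Qed.

Lemma cumulant_rank d : (2 <= d)%N ->
  cumulant d (rank_var R la m) = bernoulli R d / d%:R * gap_sum d.
Proof.
by move=> d2; have [c _ ->] := cumulant_rankE; rewrite gtn_eqF// mulr0 add0r D0_ln_unif_mgf_ge2.
Qed.

Lemma bernoulli2 : bernoulli R 2 = 6^-1.
Proof.
have B0 : bernoulli R 0 = 1 by rewrite bernoulliE big_ord0 subr0 divr1.
have B1 : bernoulli R 1 = - 2^-1.
  by rewrite bernoulliE big_ord_recl big_ord0 /= B0 bin0 sub0r addr0 mulr1 mulN1r.
rewrite bernoulliE !big_ord_recl big_ord0 /= B0 [bump 0 0]/= B1 bin0 bin1.
by field.
Qed.

(** B_2 / 2 = 1/12 is the origin of the factor sqrt 12 in the rescaled multiset. *)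
Lemma cumulant2_rank : cumulant 2 (rank_var R la m) = gap_sum 2 / 12.
Proof. by rewrite cumulant_rank// bernoulli2; field. Qed.

Lemma cumulant_rank_std d : (2 <= d)%N ->
  cumulant d (standardize (rank_var R la m)) =
  bernoulli R d / d%:R * (gap_sum d * (Num.sqrt (gap_sum 2 / 12))^-1 ^+ d).
Proof.
move=> d2; rewrite cumulant_standardize//; last exact: filling_exp_integrable.
by rewrite cumulant2_rank cumulant_rank// mulrC mulrA.
Qed.

Lemma mgf_rank_std s (u := (Num.sqrt (gap_sum 2 / 12))^-1 * s) :
  mgf (standardize (rank_var R la m)) s =
  \prod_(i < m) \prod_(j < m | (i < j)%N) (unif_mgf ((gap la i j)%:R * u) / unif_mgf ((j - i)%:R * u)).
Proof.
have eX := filling_exp_integrable (rank_var R la m).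
rewrite mgf_standardize// fine_variance// cumulant2_rank -/u fine_expectation -cumulant1E//.
have [c -> ->] := cumulant_rankE; rewrite D0_ln_unif_mgf mul0r addr0 mulr1 mulrA -expRD.
by rewrite [X in expR X](_ : _ = 0) ?expR0 ?mul1r// /u; ring.
Qed.

Lemma cumulant1_rank_std : cumulant 1 (standardize (rank_var R la m)) = 0.
Proof. by apply: cumulant1_standardize; exact: filling_exp_integrable. Qed.

End rank_cumulants.

(** * Distance multisets *)

Section multisets.
Variable R : realType.
Implicit Types (t : R^nat) (s : seq R).

Lemma psum_widen t (K K' d : nat) : (0 < d)%N -> (forall k, (K <= k)%N -> t k = 0) ->
  (K <= K')%N -> \sum_(k < K') t k ^+ d = \sum_(k < K) t k ^+ d.
Proof.
move=> d0 tK KK'; rewrite (big_ord_widen K' (fun k => t k ^+ d) KK') [LHS](bigID (fun k : 'I__ => (k < K)%N)) /=.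
by rewrite [X in _ + X]big1 ?addr0// => k; rewrite -leqNgt => /tK ->; rewrite expr0n gtn_eqF.
Qed.

Lemma pnormE t (K d : nat) : (0 < d)%N -> (forall k, 0 <= t k) ->
  (forall k, (K <= k)%N -> t k = 0) ->
  fine (pnorm d%:R t) = (\sum_(k < K) t k ^+ d) `^ d%:R^-1.
Proof.
move=> d0 t0 tK; rewrite /pnorm (nneseries_split 0 K); last by move=> k _; rewrite lee_fin powR_ge0.
rewrite add0n (eseries0 (f := fun k => (t k `^ d%:R)%:E)) ?adde0; last first.
  by move=> k Kk _; rewrite tK// powR0// pnatr_eq0 -lt0n.
rewrite big_mkord sumEFin poweR_EFin /=; congr (_ `^ _).
by apply: eq_bigr => k _; rewrite powR_mulrn.
Qed.

Lemma pnorm_pow t (K d : nat) : (0 < d)%N -> (forall k, 0 <= t k) ->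
  (forall k, (K <= k)%N -> t k = 0) ->
  fine (pnorm d%:R t) ^+ d = \sum_(k < K) t k ^+ d.
Proof.
move=> d0 t0 tK; rewrite (pnormE d0 t0 tK) -powR_mulrn ?powR_ge0// -powRrM mulVf ?pnatr_eq0 -?lt0n//.
by rewrite powRr1//; apply: sumr_ge0 => k _; exact: exprn_ge0.
Qed.

Lemma pnorm2E t (K : nat) : (forall k, 0 <= t k) -> (forall k, (K <= k)%N -> t k = 0) ->
  fine (pnorm 2 t) = Num.sqrt (\sum_(k < K) t k ^+ 2).
Proof.
move=> t0 tK; rewrite (pnormE (d := 2) _ t0 tK)// powR12_sqrt//.
by apply: sumr_ge0 => k _; exact: exprn_ge0.
Qed.

Lemma multiset_default s k : (size s <= k)%N -> multiset s k = 0.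
Proof. by move=> sk; rewrite /multiset nth_default// size_sort. Qed.

Lemma multiset_sum s d : \sum_(k < size s) multiset s k ^+ d = \sum_(x <- s) x ^+ d.
Proof.
have /(perm_big _) <- : perm_eq (sort >=%R s) s by rewrite perm_sort.
by rewrite (big_nth 0) size_sort big_mkord.
Qed.

Lemma multisetP s : all (>= 0) s -> is_multiset (multiset s).
Proof.
move=> s0; have s0' : all (>= 0) (sort >=%R s) by rewrite all_sort.
have h k : 0 <= multiset s k.
  have [sk|ks] := leqP (size s) k; first by rewrite multiset_default.
  by have /all_nthP -> := s0'; rewrite ?size_sort.
split=> // k; have [sk|ks] := leqP (size s) k.+1; first by rewrite (multiset_default sk).
have sS : sorted >=%R (sort >=%R s) by apply: sort_sorted => x y; exact: ge_total.
by have /sortedP := sS; apply; rewrite size_sort.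
Qed.

Definition dist_sum (t : seq R) (d : nat) : R :=
  \sum_(i < size t) \sum_(j < size t | (i < j)%N) (t`_i - t`_j) ^+ d.

(** A crude count, enough to bound the number of nonzero entries by M^2 when m <= M. *)
Lemma size_distance_multiset (t : seq R) : (size (distance_multiset t) <= size t * size t)%N.
Proof.
rewrite size_allpairs_dep; apply: (@leq_trans (\sum_(i <- iota 0 (size t)) size t)).
  rewrite sumnE big_map big_seq [leqRHS]big_seq; apply: leq_sum => i.
  by rewrite mem_iota size_iota => /andP[_ /ltnW].
by rewrite big_const_seq count_predT size_iota iter_addn_0.
Qed.

Lemma distance_multiset_sum (t : seq R) d :
  \sum_(x <- distance_multiset t) x ^+ d = dist_sum t d.
Proof.
rewrite big_allpairs_dep /= -[size t]subn0 -/(index_iota 0 (size t)) big_mkord /dist_sum.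
rewrite (eq_bigr (fun j : 'I_(size t) => \sum_(i < size t | (i < j)%N) (t`_i - t`_j) ^+ d)).
  rewrite (exchange_big_dep predT)//=.
move=> j _; rewrite -{1}[val j]subn0 -/(index_iota 0 j) big_mkord.
by rewrite (big_ord_widen (size t) (fun i => (t`_i - t`_j) ^+ d))// ltnW.
Qed.

Lemma distance_multiset_ge0 (t : seq R) : sorted >=%R t -> all (>= 0) (distance_multiset t).
Proof.
move=> st; apply/allP => _ /allpairsPdep[j [i [+ + ->]]].
rewrite !mem_iota !add0n => /andP[_ jt] /andP[_ ij].
rewrite subr_ge0; have /= := sorted_leq_nth (rev_trans le_trans) (fun x => lexx x) 0 st.
by apply; rewrite ?inE ?(ltn_trans ij)// ltnW.
Qed.

Section hat_dist.
Variable t : seq R.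
Hypothesis st : sorted >=%R t.
Let K := size (distance_multiset t).
Let mt := multiset (distance_multiset t).

Lemma mt_ge0 k : 0 <= mt k.
Proof. by have [] := multisetP (distance_multiset_ge0 st). Qed.

Lemma hat_distE k : hat_dist t k = Num.sqrt 12 / Num.sqrt (dist_sum t 2) * mt k.
Proof.
rewrite /hat_dist /hat (@pnorm2E _ K) => [||j]; [|exact: mt_ge0|exact: multiset_default].
by rewrite multiset_sum distance_multiset_sum mulrAC.
Qed.

Lemma hat_dist_multiset : is_multiset (hat_dist t).
Proof.
have [_ mtS] := multisetP (distance_multiset_ge0 st).
split=> k; rewrite !hat_distE.
  by rewrite mulr_ge0 ?mt_ge0// divr_ge0// sqrtr_ge0.
by rewrite ler_wpM2l ?mtS// divr_ge0// sqrtr_ge0.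
Qed.

Lemma hat_dist_default k : (K <= k)%N -> hat_dist t k = 0.
Proof. by move=> Kk; rewrite hat_distE /mt multiset_default ?mulr0. Qed.

Lemma hat_dist_sum d : \sum_(k < K) hat_dist t k ^+ d =
  (Num.sqrt 12 / Num.sqrt (dist_sum t 2)) ^+ d * dist_sum t d.
Proof.
rewrite -(distance_multiset_sum t d) -multiset_sum mulr_sumr.
by apply: eq_bigr => k _; rewrite hat_distE exprMn.
Qed.

Lemma dist_sum_ge0 d : 0 <= dist_sum t d.
Proof.
rewrite -distance_multiset_sum big_seq; apply: sumr_ge0 => x xt; apply: exprn_ge0.
by have /allP/(_ _ xt) := distance_multiset_ge0 st.
Qed.

Lemma hat_dist_sum2 : 0 < dist_sum t 2 -> \sum_(k < K) hat_dist t k ^+ 2 = 12.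
Proof.
move=> d0; rewrite hat_dist_sum expr_div_n !sqr_sqrtr//; last exact: ltW.
by rewrite mulfVK// gt_eqF.
Qed.

(** The squares add up to 12; the resulting bound puts every entry in a compact interval. *)
Lemma hat_dist_le k : hat_dist t k <= Num.sqrt 12.
Proof.
have [d0|d0] := ltP 0 (dist_sum t 2); last first.
  (* When the norm vanishes, division by 0 makes every entry 0. *)
  by rewrite hat_distE (ler0_sqrtr d0) invr0 mulr0 mul0r sqrtr_ge0.
have [kK|Kk] := ltnP k K; last by rewrite hat_dist_default// sqrtr_ge0.
have [h0 _] := hat_dist_multiset.
rewrite -(ger0_norm (h0 k)) -sqrtr_sqr ler_wsqrtr// -(hat_dist_sum2 d0).
rewrite (bigD1 (Ordinal kK))//= lerDl; apply: sumr_ge0 => i _; exact: exprn_ge0.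
Qed.

End hat_dist.
End multisets.

Section power_sums.
Variable R : realType.
Implicit Types (s t : R^nat).

Lemma is_multiset_le t i j : is_multiset t -> (i <= j)%N -> t j <= t i.
Proof.
move=> [_ tS]; elim: j => [|j IH]; first by rewrite leqn0 => /eqP ->.
by rewrite leq_eqVlt => /orP[/eqP ->//|/IH]; exact: le_trans.
Qed.

(* The largest entry in which two sequences differ dominates the high power sums. *)
Lemma even_power_sums_le s t (K n : nat) : is_multiset s -> is_multiset t ->
  (forall j, (0 < j)%N -> \sum_(k < K) s k ^+ j.*2 <= \sum_(k < K) t k ^+ j.*2) ->
  (n < K)%N -> (forall k, (k < n)%N -> s k = t k) -> s n <= t n.
Proof.
move=> ms mt st nK eq_st; rewrite leNgt; apply/negP => ts.
have [s0 _] := ms; have [t0 _] := mt.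
have sn0 : 0 < s n by apply: le_lt_trans ts.
(* The first n entries agree and cancel; each remaining entry of t is at most [t n]. *)
have tail j : (0 < j)%N -> s n ^+ j.*2 <= K%:R * t n ^+ j.*2.
  move=> j0; have := st _ j0.
  rewrite (bigID (fun k : 'I_K => (k < n)%N)) /= [in leRHS](bigID (fun k : 'I_K => (k < n)%N)) /=.
  rewrite (eq_bigr (fun k : 'I_K => t k ^+ j.*2)); last by move=> k /eq_st ->.
  rewrite lerD2l => h; apply: le_trans (le_trans _ h) _.
    rewrite (bigD1 (Ordinal nK)) /= ?ltnn// lerDl; apply: sumr_ge0 => k _; exact: exprn_ge0.
  apply: (@le_trans _ _ (\sum_(k < K) t n ^+ j.*2)); last by rewrite sumr_const card_ord mulr_natl.
  rewrite big_mkcond; apply: ler_sum => k _; case: ifP => [|_]; last exact: exprn_ge0.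
  by rewrite -leqNgt => nk; rewrite lerXn2r ?nnegrE//; exact: is_multiset_le.
(* If [t n < s n], then q < 1, whereas [tail] reads 1 <= K q^j for all j > 0; a large j contradicts
   this. *)
pose q := (t n / s n) ^+ 2.
have q01 : 0 <= q < 1.
  rewrite /q sqr_ge0 expr_lt1//; last by rewrite divr_ge0// ltW.
  by rewrite ltr_pdivrMr// mul1r.
have qK j : (0 < j)%N -> 1 <= K%:R * q ^+ j.
  move=> j0; rewrite /q -exprM mul2n expr_div_n mulrA ler_pdivlMr ?exprn_gt0// mul1r.
  exact: tail.
have : K%:R * q ^+ j @[j --> \oo] --> (0 : R).
  by rewrite -(mulr0 K%:R); apply: cvgM; [exact: cvg_cst|apply: cvg_expr; rewrite ger0_norm; case/andP: q01].
move=> /cvgrPdist_lt /(_ _ ltr01) [j0 _ /(_ j0.+1)] /= /(_ (leqnSn j0)).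
rewrite sub0r normrN ltNge => /negP; apply; apply: (le_trans (qK j0.+1 _)) => //.
exact: ler_norm.
Qed.

Lemma even_power_sums_inj s t (K : nat) : is_multiset s -> is_multiset t ->
  (forall k, (K <= k)%N -> s k = 0) -> (forall k, (K <= k)%N -> t k = 0) ->
  (forall j, (0 < j)%N -> \sum_(k < K) s k ^+ j.*2 = \sum_(k < K) t k ^+ j.*2) ->
  s = t.
Proof.
move=> ms mt sK tK st; apply/funext; elim/ltn_ind => n IH.
have [nK|Kn] := ltnP n K; last by rewrite sK ?tK.
apply/le_anti/andP; split; apply: (even_power_sums_le (K := K)) => //.
- by move=> j j0; rewrite st.
- by move=> j j0; rewrite st.
- by move=> k /IH ->.
Qed.

End power_sums.

(** * The effect of the shifts for one partition *)

Section one_partition.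
Variables (R : realType).

(** These are the 2^(d+1) - 2 mixed terms of the binomial expansion, each with one factor c <= m and
    d further factors at most L. *)
Lemma pow_gap_bound (a c m L : R) (d : nat) :
  0 <= a <= L -> 0 <= c <= m -> m <= L ->
  0 <= (a + c) ^+ d.+1 - c ^+ d.+1 - a ^+ d.+1 <= (2 ^+ d.+1 - 2) * (m * L ^+ d).
Proof.
move=> /andP[a0 aL] /andP[c0 cm] mL.
have L0 : 0 <= L by exact: le_trans aL.
have m0 : 0 <= m by exact: le_trans cm.
elim: d => [|d /andP[IH0 IH]]; first by rewrite !expr1 subrr mul0r; apply/andP; split; lra.
set D := _ - a ^+ d.+1 in IH0 IH.
have -> : (a + c) ^+ d.+2 - c ^+ d.+2 - a ^+ d.+2 =
    (a + c) * D + (a * c ^+ d.+1 + c * a ^+ d.+1).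
  by rewrite /D !(exprS _ d.+1); ring.
have ac0 : 0 <= a + c by lra.
apply/andP; split.
  by rewrite !addr_ge0// mulr_ge0// exprn_ge0.
have h1 : (a + c) * D <= (2 * L) * ((2 ^+ d.+1 - 2) * (m * L ^+ d)).
  by apply: ler_pM => //; lra.
have h2 : a * c ^+ d.+1 <= L * (m * L ^+ d).
  apply: ler_pM => //; first exact: exprn_ge0.
  rewrite exprS ler_pM ?exprn_ge0// lerXn2r ?nnegrE//; lra.
have h3 : c * a ^+ d.+1 <= m * (L * L ^+ d).
  by rewrite ler_pM ?exprn_ge0// -exprS lerXn2r ?nnegrE.
rewrite [2 ^+ d.+2]exprS [L ^+ d.+1]exprS.
apply: (le_trans (lerD h1 (lerD h2 h3))); rewrite le_eqVlt; apply/orP; left; apply/eqP.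
ring.
Qed.

Variables (la : seq nat) (m : nat).
Hypotheses (pla : is_partition la) (lam : (size la < m)%N).
Local Notation L := (nth 0%N la 0).

Definition pow_sum (d : nat) : R :=
  \sum_(i < m) \sum_(j < m | (i < j)%N) (nth 0%N la i - nth 0%N la j)%:R ^+ d.

Lemma sub_ord_le (i j : nat) : (nth 0%N la i - nth 0%N la j <= L)%N.
Proof. by apply: leq_trans (leq_subr _ _) (nth_partition_le pla (leq0n i)). Qed.

(** Since [size la < m], the last of the m parts is 0, so the first and last rows alone contribute
    L^d. *)
Lemma pow_sum_ge d : (0 < L)%N -> L%:R ^+ d <= pow_sum d.
Proof.
move=> L0; have m1 : (1 < m)%N by apply: leq_ltn_trans lam; case: (la) L0.
have m0 : (0 < m)%N by exact: ltnW.
have mm : (m.-1 < m)%N by rewrite prednK.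
rewrite /pow_sum (bigD1 (Ordinal m0))//= (bigD1 (Ordinal mm))/=; last by rewrite -ltnS prednK.
have lam1 : (size la <= m.-1)%N by rewrite -ltnS prednK.
rewrite [nth 0%N la m.-1]nth_default// subn0 -addrA lerDl addr_ge0//.
  by apply: sumr_ge0 => j _; exact: exprn_ge0.
by apply: sumr_ge0 => i _; apply: sumr_ge0 => j _; exact: exprn_ge0.
Qed.

(** One factor m comes from [pow_gap_bound], the other two from the number of pairs. *)
Lemma gap_sum_bound d : (m <= L)%N ->
  0 <= gap_sum R la m d.+1 - pow_sum d.+1 <= 2 ^+ d.+1 * m%:R ^+ 3 * L%:R ^+ d.
Proof.
move=> mL; rewrite /gap_sum /pow_sum -sumrB.
under eq_bigr => i _ do rewrite -sumrB.
pose b : R := 2 ^+ d.+1 * (m%:R * L%:R ^+ d).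
have b0 : 0 <= b by rewrite !mulr_ge0 ?exprn_ge0.
have h (i j : 'I_m) : (0 : R) <= (gap la i j)%:R ^+ d.+1 - (j - i)%:R ^+ d.+1 -
    (nth 0%N la i - nth 0%N la j)%:R ^+ d.+1 <= b.
  rewrite /gap !natrD; have := @pow_gap_bound (nth 0%N la i - nth 0%N la j)%:R (j - i)%:R m%:R L%:R d.
  rewrite !ler_nat !ler0n sub_ord_le mL (leq_trans (leq_subr _ _) (ltnW (ltn_ord j))) => /(_ isT isT isT).
  move=> /andP[-> /le_trans ->]//.
  by rewrite ler_wpM2r ?mulr_ge0 ?exprn_ge0// gerBl.
apply/andP; split.
  by apply: sumr_ge0 => i _; apply: sumr_ge0 => j _; case/andP: (h i j).
apply: (@le_trans _ _ (\sum_(i < m) \sum_(j < m) b)).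
  apply: ler_sum => i _; rewrite big_mkcond; apply: ler_sum => j _.
  by case: ifP => _ //; case/andP: (h i j).
under eq_bigr do rewrite sumr_const card_ord.
rewrite sumr_const card_ord -mulrnA -[b *+ _]mulr_natl natrM /b le_eqVlt; apply/orP; left; apply/eqP; ring.
Qed.

Lemma gap_sum_ratio d : (0 < d)%N -> (0 < L)%N -> (m <= L)%N ->
  `|gap_sum R la m d / pow_sum d - 1| <= 2 ^+ d * (m%:R ^+ 3 / L%:R).
Proof.
case: d => // d _ L0 mL; have /andP[g0 g1] := gap_sum_bound d mL.
have pL := pow_sum_ge d.+1 L0.
have LR : 0 < L%:R :> R by rewrite ltr0n.
have p0 : 0 < pow_sum d.+1 by apply: lt_le_trans pL; rewrite exprn_gt0.
have -> : gap_sum R la m d.+1 / pow_sum d.+1 - 1 = (gap_sum R la m d.+1 - pow_sum d.+1) / pow_sum d.+1.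
  by field; rewrite gt_eqF.
rewrite ger0_norm ?divr_ge0//; last exact: ltW.
rewrite ler_pdivrMr//; apply: (le_trans g1).
apply: (@le_trans _ _ (2 ^+ d.+1 * (m%:R ^+ 3 / L%:R) * L%:R ^+ d.+1)).
  by rewrite [L%:R ^+ d.+1]exprS le_eqVlt; apply/orP; left; apply/eqP; field; rewrite gt_eqF.
by rewrite ler_wpM2l// mulr_ge0 ?exprn_ge0// divr_ge0.
Qed.

Let t := t_of_partition R la m.

Lemma size_t_of_partition : size t = m.
Proof. by rewrite size_map size_iota. Qed.

Lemma nth_t_of_partition (i : nat) : (i < m)%N -> t`_i = (nth 0%N la i)%:R / L%:R.
Proof. by move=> im; rewrite (nth_map 0%N) ?size_iota// nth_iota. Qed.

Lemma sorted_t_of_partition : sorted >=%R t.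
Proof.
apply/(sortedP 0) => i; rewrite size_t_of_partition => im.
rewrite !nth_t_of_partition//; last exact: ltnW.
by rewrite /= ler_wpM2r ?invr_ge0// ler_nat nth_partition_le.
Qed.

Lemma dist_sum_t_of_partition d : dist_sum t d = L%:R^-1 ^+ d * pow_sum d.
Proof.
rewrite /dist_sum size_t_of_partition /pow_sum mulr_sumr; apply: eq_bigr => i _.
rewrite mulr_sumr; apply: eq_bigr => j ij.
rewrite -exprMn !nth_t_of_partition// -mulrBl mulrC natrB//.
by apply: nth_partition_le => //; exact: ltnW.
Qed.

(** The norm scales with the distances, so dividing the parts by the first one changes nothing. *)
Lemma hat_dist_pow_sum d : (0 < L)%N ->
  (Num.sqrt 12 / Num.sqrt (dist_sum t 2)) ^+ d * dist_sum t d =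
  (Num.sqrt 12 / Num.sqrt (pow_sum 2)) ^+ d * pow_sum d.
Proof.
move=> L0; rewrite !dist_sum_t_of_partition mulrA -exprMn.
have LR : 0 < L%:R :> R by rewrite ltr0n.
rewrite sqrtrM ?exprn_ge0 ?invr_ge0// sqrtr_sqr ger0_norm ?invr_ge0//.
congr (_ ^+ _ * _); field.
rewrite [_%:R == 0]gt_eqF// ?andbT gt_eqF// sqrtr_gt0.
by apply: lt_le_trans (pow_sum_ge 2 L0); rewrite exprn_gt0.
Qed.

Lemma dist_sum2_gt0 : (0 < L)%N -> 0 < dist_sum t 2.
Proof.
move=> L0; have LR : 0 < L%:R :> R by rewrite ltr0n.
rewrite dist_sum_t_of_partition mulr_gt0 ?exprn_gt0 ?invr_gt0//.
by apply: lt_le_trans (pow_sum_ge 2 L0); rewrite exprn_gt0.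
Qed.

End one_partition.

(** The criterion does not divide by g, which in the application vanishes for odd d >= 3 together
    with B_d. *)
Lemma equiv_of_ratio (R : realType) (f g w : nat -> R^o) :
  (\forall N \near \oo, f N = g N * w N) -> w N @[N --> \oo] --> (1 : R) -> f ~_\oo g.
Proof.
move=> fgw w1; apply/eqaddoP => _ /posnumP[e].
move/cvgrPdist_le : w1 => /(_ e%:num (gt0 e)) w1.
near=> N; rewrite (_ : (f - g) N = f N - g N)//.
have -> : f N = g N * w N by near: N.
rewrite -[X in _ - X]mulr1 -mulrBr normrM mulrC ler_wpM2r// distrC.
by near: N.
Unshelve. all: by end_near. Qed.

Section asymptotics.
Variables (R : realType) (la : nat -> seq nat) (m : nat -> nat).
Hypothesis hla : forall N, is_partition (la N).
Hypothesis hlam : forall N, (size (la N) < m N)%N.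
Hypothesis hla1 : ((nth 0%N (la N) 0)%:R / (m N)%:R ^+ 3 : R) @[N --> \oo] --> +oo.

Local Notation L N := (nth 0%N (la N) 0).
Let X N := standardize (rank_var R (la N) (m N)).
Let t N := t_of_partition R (la N) (m N).
Let Dt N : R^nat := hat_dist (t N).
Let K N := size (distance_multiset (t N)).

Lemma first_part_large (A : R) : \forall N \near \oo, A <= (L N)%:R / (m N)%:R ^+ 3.
Proof. by move/cvgryPge : hla1 => /(_ A). Qed.

Lemma first_part_ge : \forall N \near \oo, (0 < L N)%N /\ (m N <= L N)%N.
Proof.
near=> N; have m0 : (0 < m N)%N by exact: leq_ltn_trans (hlam N).
have : 1 <= (L N)%:R / (m N)%:R ^+ 3 :> R by near: N; exact: first_part_large.
rewrite ler_pdivlMr ?exprn_gt0 ?ltr0n// mul1r -natrX ler_nat => h.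
have mL : (m N <= L N)%N.
  by apply: leq_trans h; rewrite -[leqLHS]expn1 leq_pexp2l.
by split=> //; exact: leq_trans mL.
Unshelve. all: by end_near. Qed.

Lemma gap_sum_ratio_cvg d : (0 < d)%N ->
  gap_sum R (la N) (m N) d / pow_sum R (la N) (m N) d @[N --> \oo] --> (1 : R).
Proof.
move=> d0; apply/cvgrPdist_le => e e0; near=> N.
have [L0 mL] : (0 < L N)%N /\ (m N <= L N)%N by near: N; exact: first_part_ge.
have m0 : (0 < m N)%N by exact: leq_ltn_trans (hlam N).
rewrite distrC; apply: (le_trans (gap_sum_ratio R (hla N) (hlam N) d0 L0 mL)).
have : 2 ^+ d / e <= (L N)%:R / (m N)%:R ^+ 3 by near: N; exact: first_part_large.
have L0' : 0 < (L N)%:R :> R by rewrite ltr0n.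
have m0' : 0 < (m N)%:R ^+ 3 :> R by rewrite exprn_gt0 ?ltr0n.
rewrite ler_pdivlMr// mulrAC ler_pdivrMr// => h.
by rewrite mulrA ler_pdivrMr// [leRHS]mulrC.
Unshelve. all: by end_near. Qed.

(** The perturbation caused by the shifts j - i: the relative change of the d-th power sum, times
    that of the standard deviation to the power -d. *)
Definition std_ratio d N : R := gap_sum R (la N) (m N) d / pow_sum R (la N) (m N) d *
  (Num.sqrt (gap_sum R (la N) (m N) 2 / pow_sum R (la N) (m N) 2))^-1 ^+ d.

Lemma std_ratio_cvg d : (0 < d)%N -> std_ratio d N @[N --> \oo] --> (1 : R).
Proof.
move=> d0; rewrite -[X in _ --> X]mulr1; apply: cvgM; first exact: gap_sum_ratio_cvg.
rewrite -[X in _ --> X](expr1n _ d).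
apply: (@continuous_cvg _ _ _ _ _ _ (fun x : R => x ^+ d)); first exact: exprn_continuous.
rewrite -[X in _ --> X]invr1; apply: cvgV; first exact: oner_neq0.
rewrite -sqrtr1; apply: (@continuous_cvg _ _ _ _ _ _ Num.sqrt); first exact: sqrt_continuous.
exact: gap_sum_ratio_cvg.
Qed.

Lemma cumulant_standardizeE d : (2 <= d)%N -> \forall N \near \oo,
  cumulant d (X N) = bernoulli R d / d%:R * (\sum_(k < K N) Dt N k ^+ d) * std_ratio d N.
Proof.
move=> d2; near=> N.
have [L0 mL] : (0 < L N)%N /\ (m N <= L N)%N by near: N; exact: first_part_ge.
rewrite cumulant_rank_std//; last exact: ltnW.
rewrite /Dt /K /t hat_dist_sum ?hat_dist_pow_sum//; last exact: sorted_t_of_partition.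
rewrite -[RHS]mulrA; congr (_ * _); rewrite /std_ratio.
have LR : 0 < (L N)%:R :> R by rewrite ltr0n.
have p0 e : 0 < pow_sum R (la N) (m N) e.
  by apply: lt_le_trans (pow_sum_ge R (hlam N) e L0); rewrite exprn_gt0.
have g0 : 0 < gap_sum R (la N) (m N) 2.
  have /andP[+ _] := gap_sum_bound R (hla N) 1 mL.
  by rewrite subr_ge0; apply: lt_le_trans.
rewrite !sqrtrM ?(ltW g0)// !sqrtrV ?ltW// !invfM !invrK !exprMn !exprVn.
by field; rewrite !expf_neq0 ?gt_eqF ?sqrtr_gt0.
Unshelve. all: by end_near. Qed.

Lemma pnorm_hat_dist d N : (0 < d)%N ->
  fine (pnorm d%:R (Dt N)) ^+ d = \sum_(k < K N) Dt N k ^+ d.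
Proof.
move=> d0; have st := sorted_t_of_partition R (m N) (hla N).
rewrite (pnorm_pow (K := K N))//; first by have [] := hat_dist_multiset st.
by move=> k; exact: hat_dist_default.
Qed.

Lemma cumulant_standardize_equiv d : (2 <= d)%N ->
  (fun N => cumulant d (X N) : R^o) ~_\oo
  (fun N => bernoulli R d / d%:R * fine (pnorm d%:R (Dt N)) ^+ d).
Proof.
move=> d2; have d0 : (0 < d)%N by exact: ltnW.
apply: (equiv_of_ratio (w := std_ratio d)); last exact: std_ratio_cvg.
near=> N; rewrite pnorm_hat_dist//; near: N; exact: cumulant_standardizeE.
Unshelve. all: by end_near. Qed.

Lemma unif_sum_of_hat_dist N :
  exists (dp : measure_display) (T : measurableType dp)
          (P : probability T R) (S : {RV P >-> R}),
        is_unif_sum (Dt N) S /\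
        forall d, (2 <= d)%N -> bernoulli R d / d%:R * fine (pnorm d%:R (Dt N)) ^+ d = cumulant d S.
Proof.
have st := sorted_t_of_partition R (m N) (hla N).
have [h0 _] := hat_dist_multiset st.
have [dp [T [P [S [uS eS mS]]]]] := unif_sum_exists h0 (hat_dist_default st).
exists dp, T, P, S; split=> // d d2.
by rewrite pnorm_hat_dist ?(ltnW d2)// (cumulant_unif_sum d mS) D0_ln_unif_mgf_ge2.
Qed.

End asymptotics.

Section asymptotics.
Variables (R : realType) (la : nat -> seq nat) (m : nat -> nat).
Hypothesis hla : forall N, is_partition (la N).
Hypothesis hlam : forall N, (size (la N) < m N)%N.
Hypothesis hla1 : ((nth 0%N (la N) 0)%:R / (m N)%:R ^+ 3 : R) @[N --> \oo] --> +oo.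

Local Notation L N := (nth 0%N (la N) 0).
Let X N := standardize (rank_var R (la N) (m N)).
Let t N := t_of_partition R (la N) (m N).
Let Dt N : R^nat := hat_dist (t N).
Let K N := size (distance_multiset (t N)).

(** The denominators in [mgf_rank_std] are at least 1 and are dropped; the numerators are at most
    e^(gap^2 u^2 / 2). The sum of gap^2 is at most 2 g2, because the sum of (j - i)^2 is at most m^4
    <= L^2 <= g2. With u^2 = 12 s^2 / g2 the exponent is at most 12 s^2. *)
Lemma mgf_std_bound : \forall N \near \oo, forall s, mgf (X N) s <= expR (12 * s ^+ 2).
Proof.
near=> N => s.
have [L0 mL] : (0 < L N)%N /\ (m N <= L N)%N by near: N; exact: (first_part_ge hlam hla1).
have m0 : (0 < m N)%N by exact: leq_ltn_trans (hlam N).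
have m3L : (m N)%:R ^+ 3 <= (L N)%:R :> R.
  have : 1 <= (L N)%:R / (m N)%:R ^+ 3 :> R by near: N; exact: (first_part_large hla1).
  by rewrite ler_pdivlMr ?mul1r// exprn_gt0 ?ltr0n.
set g2 := gap_sum R (la N) (m N) 2.
have gp : pow_sum R (la N) (m N) 2 <= g2.
  by have /andP[] := gap_sum_bound R (hla N) 1 mL; rewrite subr_ge0.
have pL := pow_sum_ge R (hlam N) 2 L0.
have L2 : 0 < (L N)%:R ^+ 2 :> R by rewrite exprn_gt0 ?ltr0n.
have g20 : 0 < g2 by apply: lt_le_trans gp; exact: lt_le_trans pL.
rewrite /X mgf_rank_std//; last exact: ltnW.
set u := _^-1 * s.
have uE : u ^+ 2 = 12 * s ^+ 2 / g2.
  rewrite exprMn exprVn sqr_sqrtr; last by rewrite divr_ge0// ltW.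
  by rewrite invf_div mulrAC mulrA.
apply: (@le_trans _ _ (\prod_(i < m N) \prod_(j < m N | (i < j)%N) expR (((gap (la N) i j)%:R * u) ^+ 2 / 2))).
  apply: ler_prod => i _; rewrite prodr_ge0/=; last by move=> j _; rewrite divr_ge0// ltW// unif_mgf_gt0.
  apply: ler_prod => j _; rewrite divr_ge0/=; try by rewrite ltW// unif_mgf_gt0.
  apply: le_trans (unif_mgf_le_expR _); rewrite ler_pdivrMr ?unif_mgf_gt0// ler_peMr ?unif_mgf_ge1//.
  by rewrite ltW// unif_mgf_gt0.
under eq_bigr => i _ do rewrite -expR_sum.
rewrite -expR_sum ler_expR.
under eq_bigr => i _ do (under eq_bigr => j _ do rewrite exprMn -mulrA; rewrite -mulr_suml).
rewrite -mulr_suml.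
have c4 : \sum_(i < m N) \sum_(j < m N | (i < j)%N) (j - i)%:R ^+ 2 <= g2.
  apply: le_trans gp; apply: le_trans pL.
  apply: (@le_trans _ _ (\sum_(i < m N) \sum_(j < m N) (m N)%:R ^+ 2)).
    apply: ler_sum => i _; rewrite big_mkcond; apply: ler_sum => j _.
    case: ifP => _ //; rewrite ?exprn_ge0// lerXn2r ?nnegrE// ler_nat.
    by rewrite (leq_trans (leq_subr _ _))// ltnW.
  under eq_bigr do rewrite sumr_const card_ord.
  rewrite sumr_const card_ord -mulrnA -[_ ^+ 2 *+ _]mulr_natl natrM.
  have m1 : 1 <= (m N)%:R :> R by rewrite ler1n.
  apply: (@le_trans _ _ (((m N)%:R ^+ 3) ^+ 2)); last by rewrite lerXn2r ?nnegrE ?exprn_ge0.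
  by rewrite -expr2 -exprD -exprM; apply: ler_weXn2l.
have gapE : \sum_(i < m N) \sum_(j < m N | (i < j)%N) (gap (la N) i j)%:R ^+ 2 =
    g2 + \sum_(i < m N) \sum_(j < m N | (i < j)%N) (j - i)%:R ^+ 2.
  rewrite /g2 /gap_sum -big_split /=; apply: eq_bigr => i _; rewrite -big_split /=.
  by apply: eq_bigr => j _; rewrite subrK.
rewrite uE; set S := \sum_(i < _) _.
have S2 : S <= 2 * g2 by rewrite /S gapE mulr_natl mulr2n lerD2l.
rewrite [leRHS](_ : _ = 2 * g2 * (12 * s ^+ 2 / g2 / 2)); last by field; rewrite gt_eqF.
by rewrite ler_wpM2r// divr_ge0// divr_ge0 ?(ltW g20)// mulr_ge0// sqr_ge0.
Unshelve. all: by end_near. Qed.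

Section limit.
Variable F : set_system nat.
Context {FF : ProperFilter F}.
Hypothesis Foo : F --> \oo.
Context (dq : measure_display) (TQ : measurableType dq) (Q : probability TQ R)
  (Y : {RV Q >-> R}).
Hypothesis eY : exp_integrable Y.
Hypothesis Y1 : cumulant 1 Y = 0.
Hypothesis Yd : forall d, (2 <= d)%N ->
  bernoulli R d / d%:R * (\sum_(k < K N) Dt N k ^+ d) @[N --> F] --> cumulant d Y.

Lemma cdf_cvg_of_power_sums (x : R) :
  {for x, continuous (fun y : R => distribution Q Y `]-oo, y]%classic)} ->
  cdf (X N) x @[N --> F] --> distribution Q Y `]-oo, x]%classic.
Proof.
apply: cdf_cvg_of_cumulants => //.
- by move=> N; apply: standardize_exp_integrable; exact: filling_exp_integrable.
- move=> s; exists (expR (12 * s ^+ 2)); apply: Foo.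
  near=> N; have : forall s, mgf (X N) s <= expR (12 * s ^+ 2) by near: N; exact: mgf_std_bound.
  exact.
move=> [|[|d]]// _.
  rewrite Y1; under eq_fun => N do rewrite cumulant1_rank_std.
  exact: cvg_cst.
apply: (@cvg_trans _ (bernoulli R d.+2 / d.+2%:R * (\sum_(k < K N) Dt N k ^+ d.+2) *
   std_ratio R la m d.+2 N @[N --> F])).
  apply: near_eq_cvg; apply: Foo; near=> N; apply/esym; near: N.
  exact: (cumulant_standardizeE hla hlam hla1).
rewrite -[cumulant d.+2 Y]mulr1; apply: cvgM; first exact: Yd.
apply: cvg_trans (std_ratio_cvg hla hlam hla1 (d := d.+2) isT).
exact: cvg_app.
Unshelve. all: by end_near. Qed.

End limit.
End asymptotics.

(** * Limit laws *)

Section ultrafilters.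
Variable R : realType.

(** This replaces the extraction of a subsequence: a property that does not fail eventually holds
    along some ultrafilter finer than \oo. *)
Lemma ultra_frequently (B : set nat) : ~ (\forall N \near \oo, ~ B N) ->
  exists G : set_system nat, [/\ UltraFilter G, G --> \oo & G B].
Proof.
move=> nB.
have FF : ProperFilter (within B \oo).
  by apply: Build_ProperFilter; apply: contra_not nB => h; apply: filterS h => N.
have [G [GU BG]] := ultraFilterLemma FF; exists G; split => //.
- by move=> A hA; apply: BG; apply: filterS hA => N ? _.
- by apply: BG; rewrite /within /=; apply: filterE.
Qed.

Lemma ultra_cvg (u : nat -> R) (G : set_system nat) (a b : R) : UltraFilter G ->
  (forall N, a <= u N <= b) -> exists l : R, u N @[N --> G] --> l.
Proof.
move=> GU uab.
have PF : ProperFilter (u @ G) by exact: fmap_proper_filter.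
have [|p [_ cp]] := @segment_compact R a b (u @ G) PF.
  by apply: (@filterE _ G _ (u @^-1` `[a, b])) => N; rewrite /= in_itv; exact: uab.
exists p => U Up; have [//|GnU] := in_ultra_setVsetC (u @^-1` U) GU.
by have [x [/= nUx Ux]] := cp (~` U) U GnU Up.
Qed.

End ultrafilters.

Section comparison.
Context (R : realType) (d : nat -> measure_display) (T : forall N, measurableType (d N))
  (P : forall N, probability (T N) R) (X : forall N, {RV (P N) >-> R}).
Context (dp : measure_display) (TS : measurableType dp) (PS : probability TS R)
  (S : {RV PS >-> R}).
Context (dq : measure_display) (TQ : measurableType dq) (Q : probability TQ R)
  (Y : {RV Q >-> R}).
Variables (F G : set_system nat).
Context {FF : ProperFilter F} {GF : ProperFilter G}.
Hypothesis GsubF : G `=>` F.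
Hypothesis XS : forall x : R,
  {for x, continuous (fun y : R => distribution PS S `]-oo, y]%classic)} ->
  cdf (X N) x @[N --> G] --> distribution PS S `]-oo, x]%classic.
Hypothesis XY : forall x : R,
  {for x, continuous (fun y : R => distribution Q Y `]-oo, y]%classic)} ->
  cdf (X N) x @[N --> F] --> distribution Q Y `]-oo, x]%classic.

(** At points that are atoms of neither law both distribution functions are continuous, and they are
    limits of the same values, along F and along the finer G. *)
Lemma mgf_eq_of_limits : mgf S = mgf Y.
Proof.
apply: mgf_eq_of_law; apply: (@distribution_eq _ _ _ _ _ _ _ _ _
  ([set x | distribution PS S [set x] != 0%E] `|` [set x | distribution Q Y [set x] != 0%E])).
  rewrite -bigcup2E; apply: bigcup_countable => // -[|[|i]] _ /=; exact: countable_atoms || exact: countable0.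
move=> x /not_orP[/negP/negPn/eqP Sx /negP/negPn/eqP Yx].
apply: (cvg_unique _ (XS (cdf_continuous_of_noatom Sx))) => //.
apply: cvg_trans (XY (cdf_continuous_of_noatom Yx)); exact: cvg_app.
Qed.

End comparison.

Section normal.
Variable R : realType.
Local Notation Z := (@id_rv R : {RV (normal_prob 0 1) >-> R}).

Lemma cumulant_normal n : cumulant n Z = (n == 2)%:R.
Proof.
have sid : smooth (id \* id : R -> R) by apply: smoothM; exact: smooth_id.
rewrite cumulantE (_ : (fun s => _) = fun s => 2^-1 * (id \* id) s); last first.
  by apply/funext => s; rewrite mgf_normal expRK /= -expr2 mulrC.
rewrite (D0Zl _ _ sid); case: n => [|n]; first by rewrite /D0 /= !mulr0.
rewrite D0_idM; last exact: smooth_id.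
by rewrite D0_id eqSS; case: eqP => [->|_]; rewrite ?mulr0// mulr1 mulVf.
Qed.

End normal.

(** It presents the limit law as the law of a random variable, the form used by the convergence
    theorems. *)
Lemma cvg_in_law_id_rv (R : realType) (d : nat -> measure_display) (T : forall N, measurableType (d N))
  (P : forall N, probability (T N) R) (X : forall N, {RV (P N) >-> R})
  (nu : probability (measurableTypeR R) R) : cvg_in_law X nu <->
  (forall x : R,
  {for x, continuous (fun y : R => distribution nu (@id_rv R : {RV nu >-> R}) `]-oo, y]%classic)} ->
  cdf (X N) x @[N --> \oo] --> distribution nu (@id_rv R : {RV nu >-> R}) `]-oo, x]%classic).
Proof. by []. Qed.

Section filter_limits.
Context (R : realType) (F : set_system nat) {FF : Filter F}.

Lemma cvg_expn (u : nat -> R) (l : R) d :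
  u N @[N --> F] --> l -> u N ^+ d @[N --> F] --> l ^+ d.
Proof.
move=> ul; apply: (@continuous_cvg _ _ _ _ _ _ (fun x : R => x ^+ d)) => //.
exact: exprn_continuous.
Qed.

Lemma cvg_bigsum (I : Type) (r : seq I) (Q : pred I) (u : I -> nat -> R) (l : I -> R) :
  (forall i, Q i -> u i N @[N --> F] --> l i) ->
  \sum_(i <- r | Q i) u i N @[N --> F] --> \sum_(i <- r | Q i) l i.
Proof. by move=> ul; apply: cvg_big => //; exact: add_continuous. Qed.

End filter_limits.

(** The finitely many values partition the indices, and an ultrafilter selects one part. *)
Lemma ultra_const (G : set_system nat) (f : nat -> nat) (M : nat) : UltraFilter G ->
  (\forall N \near G, (f N <= M)%N) -> exists M0, \forall N \near G, f N = M0.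
Proof.
move=> GU; elim: M => [|M IH] fM.
  by exists 0%N; apply: filterS fM => N; rewrite leqn0 => /eqP.
have [h|h] := in_ultra_setVsetC [set N | f N = M.+1] GU; first by exists M.+1.
apply: IH; near=> N; rewrite -ltnS ltn_neqAle; apply/andP; split; last by near: N.
by apply/eqP; near: N; exact: h.
Unshelve. all: by end_near. Qed.

Section asymptotics.
Variables (R : realType) (la : nat -> seq nat) (m : nat -> nat).
Hypothesis hla : forall N, is_partition (la N).
Hypothesis hlam : forall N, (size (la N) < m N)%N.
Hypothesis hla1 : ((nth 0%N (la N) 0)%:R / (m N)%:R ^+ 3 : R) @[N --> \oo] --> +oo.

Local Notation L N := (nth 0%N (la N) 0).
Let X N := standardize (rank_var R (la N) (m N)).
Let t N := t_of_partition R (la N) (m N).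
Let Dt N : R^nat := hat_dist (t N).
Let K N := size (distance_multiset (t N)).

Let Dt_multiset N : is_multiset (Dt N).
Proof. by apply: hat_dist_multiset; exact: sorted_t_of_partition. Qed.

Let Dt_default N k : (K N <= k)%N -> Dt N k = 0.
Proof. by apply: hat_dist_default; exact: sorted_t_of_partition. Qed.

Let K_le N M : (m N <= M)%N -> (K N <= M * M)%N.
Proof.
move=> mM; apply: leq_trans (size_distance_multiset _) _.
by rewrite size_t_of_partition leq_mul.
Qed.

Let Dt_sum2 : \forall N \near \oo, \sum_(k < K N) Dt N k ^+ 2 = 12.
Proof.
near=> N; have [L0 mL] : (0 < L N)%N /\ (m N <= L N)%N by near: N; exact: (first_part_ge hlam hla1).
apply: hat_dist_sum2; first exact: sorted_t_of_partition.
exact: dist_sum2_gt0.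
Unshelve. all: by end_near. Qed.

(** One ultrafilter gives limits for all k at once, in place of a diagonal extraction. *)
Lemma hat_dist_ultra_cvg (G : set_system nat) : UltraFilter G ->
  exists l : R^nat, forall k, Dt N k @[N --> G] --> l k.
Proof.
move=> GU; suff /choice[l hl] : forall k, exists x : R, Dt N k @[N --> G] --> x by exists l.
move=> k; apply: (@ultra_cvg _ _ _ 0 (Num.sqrt 12)) => N.
have [D0 _] := Dt_multiset N; rewrite D0 hat_dist_le//; exact: sorted_t_of_partition.
Qed.

Section bounded.
Variables (F : set_system nat) (M : nat) (l : R^nat).
Context {FF : ProperFilter F}.
Hypothesis Foo : F --> \oo.
Hypothesis hM : \forall N \near F, (m N <= M)%N.
Hypothesis hl : forall k, Dt N k @[N --> F] --> l k.

Lemma limit_multiset : is_multiset l.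
Proof.
split=> k.
  by apply: (@cvgr_to_ge _ _ FF R _ _ _ (@hl k)); apply: nearW => N; have [] := Dt_multiset N.
by apply: (@ler_cvg_to _ _ FF R _ _ _ _ (@hl k.+1) (@hl k)); apply: nearW => N; have [] := Dt_multiset N.
Qed.

Lemma limit_default k : (M * M <= k)%N -> l k = 0.
Proof.
move=> Mk; apply: (cvg_unique _ (@hl k)) => //.
apply: (@cvg_trans _ (0 @[_ --> F])); last exact: cvg_cst.
apply: near_eq_cvg; near=> N; apply/esym/Dt_default; apply: leq_trans Mk.
by apply: K_le; near: N.
Unshelve. all: by end_near. Qed.

Lemma limit_power_sum d : (0 < d)%N ->
  \sum_(k < K N) Dt N k ^+ d @[N --> F] --> \sum_(k < M * M) l k ^+ d.
Proof.
move=> d0; apply: (@cvg_trans _ (\sum_(k < M * M) Dt N k ^+ d @[N --> F])).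
  apply: near_eq_cvg; near=> N; rewrite (psum_widen d0 (@Dt_default N))//.
  by apply: K_le; near: N.
by apply: cvg_bigsum => k _; apply: cvg_expn; exact: hl.
Unshelve. all: by end_near. Qed.

Lemma limit_sum2 : \sum_(k < M * M) l k ^+ 2 = 12.
Proof.
apply: (cvg_unique _ (limit_power_sum (d := 2) isT)) => //.
apply: (@cvg_trans _ ((12 : R) @[_ --> F])); last exact: cvg_cst.
apply: near_eq_cvg; apply: Foo; near=> N; apply/esym; near: N; exact: Dt_sum2.
Unshelve. all: by end_near. Qed.

Lemma limit_law : exists (dp : measure_display) (T : measurableType dp)
    (P : probability T R) (S : {RV P >-> R}),
  [/\ is_unif_sum l S,
      forall d, (2 <= d)%N -> cumulant d S = bernoulli R d / d%:R * \sum_(k < M * M) l k ^+ d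
    & forall x : R, {for x, continuous (fun y : R => distribution P S `]-oo, y]%classic)} ->
        cdf (X N) x @[N --> F] --> distribution P S `]-oo, x]%classic].
Proof.
have [l0 _] := limit_multiset.
have [dp [T [P [S [uS eS mS]]]]] := unif_sum_exists l0 limit_default.
have cS d : (2 <= d)%N -> cumulant d S = bernoulli R d / d%:R * \sum_(k < M * M) l k ^+ d.
  by move=> d2; rewrite (cumulant_unif_sum d mS) D0_ln_unif_mgf_ge2.
exists dp, T, P, S; split => //.
apply: (cdf_cvg_of_power_sums hla hlam hla1) => //.
  by rewrite (cumulant_unif_sum 1 mS) D0_ln_unif_mgf mul0r.
move=> d d2; rewrite cS//; apply: cvgM; first exact: cvg_cst.
by apply: limit_power_sum; exact: ltnW.
Qed.

End bounded.

(** Along the ultrafilter m is eventually constant and the normalized parts converge; their limits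
    form the witness s. Sorting is not followed through the limit: l and [hat_dist s] are shown to
    have the same even power sums. *)
Lemma limit_P_DIST (G : set_system nat) (M : nat) (l : R^nat) : UltraFilter G -> G --> \oo ->
  (\forall N \near G, (m N <= M)%N) -> (forall k, Dt N k @[N --> G] --> l k) -> P_DIST l.
Proof.
move=> GU Goo hM hl.
have [M0 hM0] := ultra_const GU hM.
pose r (i : nat) N : R := (nth 0%N (la N) i)%:R / (L N)%:R.
have /choice[tau htau] : forall i, exists x : R, r i N @[N --> G] --> x.
  move=> i; apply: (@ultra_cvg _ _ _ 0 1) => N; rewrite /r divr_ge0//=.
  have [->|L0] := posnP (L N); first by rewrite invr0 mulr0.
  by rewrite ler_pdivrMr ?ltr0n// mul1r ler_nat nth_partition_le.
have good : \forall N \near G, [/\ (0 < L N)%N, (m N <= M)%N & m N = M0].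
  near=> N; split; last by near: N.
  - suff : (0 < L N)%N /\ (m N <= L N)%N by case.
    by near: N; apply: Goo; exact: (first_part_ge hlam hla1).
  - by near: N.
have [N0 [L0 M0M mM0]] := filter_ex good.
have M02 : (2 <= M0)%N by rewrite -mM0; apply: leq_ltn_trans (hlam N0); case: (la N0) L0.
have MM0 : (M0 <= M)%N by rewrite -mM0.
pose s := mkseq tau M0.
have ss : size s = M0 by rewrite size_mkseq.
have tau0 : tau 0%N = 1.
  apply: (cvg_unique _ (htau 0%N)) => //.
  apply: (@cvg_trans _ ((1 : R) @[_ --> G])); last exact: cvg_cst.
  apply: near_eq_cvg; apply: filterS good => N [LN _ _].
  by rewrite /r divff// pnatr_eq0 -lt0n.
(* Part M0 is 0 because the partition has fewer than m = M0 parts. *)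
have tau1 : tau M0.-1 = 0.
  apply: (cvg_unique _ (htau M0.-1)) => //.
  apply: (@cvg_trans _ ((0 : R) @[_ --> G])); last exact: cvg_cst.
  apply: near_eq_cvg; apply: filterS good => N [_ _ mN].
  rewrite /r nth_default ?mul0r// -ltnS prednK ?(ltnW M02)// -mN; exact: hlam.
have sS : sorted >=%R s.
  apply/(sortedP 0) => i; rewrite ss => iM; rewrite !nth_mkseq ?(ltnW iM)//=.
  rewrite -subr_ge0; apply: (@cvgr_to_ge _ _ _ R _ _ _ (cvgB (htau i) (htau i.+1))); apply: nearW => N.
  by rewrite subr_ge0 ler_wpM2r ?invr_ge0// ler_nat nth_partition_le.
have ds d : dist_sum (t N) d @[N --> G] --> dist_sum s d.
  apply: (@cvg_trans _ (\sum_(i < M0) \sum_(j < M0 | (i < j)%N) (r i N - r j N) ^+ d @[N --> G])).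
    apply: near_eq_cvg; apply: filterS good => N [_ _ mN].
    rewrite /dist_sum size_t_of_partition mN; apply: eq_bigr => i _; apply: eq_bigr => j _.
    by rewrite !nth_t_of_partition ?mN.
  rewrite /dist_sum ss; apply: cvg_bigsum => i _; apply: cvg_bigsum => j _.
  rewrite !nth_mkseq//; apply: cvg_expn; apply: cvgB; exact: htau.
have ds2 : 0 < dist_sum s 2.
  have M0gt0 : (0 < M0)%N by exact: ltnW.
  have s0 : (0 < size s)%N by rewrite ss.
  have s1 : (M0.-1 < size s)%N by rewrite ss prednK.
  rewrite /dist_sum (bigD1 (Ordinal s0))//= (bigD1 (Ordinal s1))/=; last by rewrite -ltnS prednK.
  rewrite !nth_mkseq ?prednK// tau0 tau1 subr0 expr1n -addrA ltr_pwDl// addr_ge0//.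
    by apply: sumr_ge0 => j _; exact: sqr_ge0.
  by apply: sumr_ge0 => i _; apply: sumr_ge0 => j _; exact: sqr_ge0.
exists s; split; rewrite ?ss//.
- by rewrite nth_mkseq// ltnW.
- by rewrite nth_mkseq ?prednK// ltnW.
have Ks : (size (distance_multiset s) <= M * M)%N.
  by apply: leq_trans (size_distance_multiset _) _; rewrite ss leq_mul.
apply: (even_power_sums_inj (K := (M * M)%N)).
- exact: limit_multiset hl.
- exact: hat_dist_multiset.
- exact: limit_default hM hl.
- by move=> k Mk; apply: hat_dist_default => //; exact: leq_trans Mk.
move=> j j0; have jj : (0 < j.*2)%N by rewrite double_gt0.
rewrite [RHS](psum_widen jj (hat_dist_default sS) Ks) hat_dist_sum//.
apply: (cvg_unique _ (limit_power_sum hM hl jj)) => //.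
apply: (@cvg_trans _ ((Num.sqrt 12 / Num.sqrt (dist_sum (t N) 2)) ^+ j.*2 * dist_sum (t N) j.*2 @[N --> G])).
  apply: near_eq_cvg; apply: nearW => N; rewrite hat_dist_sum//; exact: sorted_t_of_partition.
apply: cvgM; last exact: ds.
apply: cvg_expn; apply: cvgM; first exact: cvg_cst.
apply: cvgV; first by rewrite gt_eqF// sqrtr_gt0.
apply: (@continuous_cvg _ _ _ _ _ _ Num.sqrt); first exact: sqrt_continuous.
exact: ds.
Unshelve. all: by end_near. Qed.

End asymptotics.

(** * Distances when m tends to infinity *)

Section unit_spread.
Variables (R : realType) (t : seq R) (n : nat).
Hypotheses (st : sorted >=%R t) (tn : size t = n.+2) (t0 : t`_0 = 1) (t1 : t`_n.+1 = 0).

Lemma unit_spread_sub i j : (i < j < n.+2)%N -> 0 <= t`_i - t`_j <= 1.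
Proof.
move=> /andP[ij jn]; have mono := sorted_leq_nth (rev_trans le_trans) (fun x => lexx x) 0 st.
have h k l : (k <= l)%N -> (l < n.+2)%N -> t`_l <= t`_k.
  by move=> kl ln; apply: mono; rewrite ?inE ?tn// (leq_ltn_trans kl).
have i1 : t`_i <= 1 by rewrite -t0 h// (ltn_trans ij).
have j0 : 0 <= t`_j by have := h j n.+1 jn (ltnSn _); rewrite t1.
have ji : t`_j <= t`_i by rewrite h// ltnW.
by apply/andP; split; lra.
Qed.

Lemma dist_sum_le2 d : dist_sum t d.+2 <= dist_sum t 2.
Proof.
rewrite /dist_sum tn; apply: ler_sum => i _; apply: ler_sum => j ij.
have /andP[h0 h1] : 0 <= t`_i - t`_j <= 1 by rewrite unit_spread_sub// ij ltn_ord.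
by rewrite -[d.+2]addn2 exprD ler_piMl ?sqr_ge0// exprn_ile1.
Qed.

(** The pairs joining entry i to the first entry 1 and to the last entry 0 contribute (1 - t_i)^2 +
    t_i^2 >= 1/2, for each of the n + 1 indices i > 0. *)
Lemma dist_sum2_ge : n.+1%:R / 2 <= dist_sum t 2.
Proof.
pose i0 : 'I_n.+2 := ord0; pose i1 : 'I_n.+2 := ord_max.
rewrite /dist_sum tn (bigD1 i0)//=.
have h : \sum_(i < n.+2 | i != i0) t`_i ^+ 2 <=
    \sum_(i < n.+2 | i != i0) \sum_(j < n.+2 | (i < j)%N) (t`_i - t`_j) ^+ 2.
  apply: ler_sum => i _; have [->|ii1] := eqVneq i i1.
    by rewrite t1 expr0n; apply: sumr_ge0 => j _; exact: sqr_ge0.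
  rewrite (bigD1 i1)/=; last by rewrite ltn_neqAle ii1/= -ltnS ltn_ord.
  by rewrite t1 subr0 lerDl; apply: sumr_ge0 => j _; exact: sqr_ge0.
apply: le_trans (lerD (lexx _) h).
rewrite [X in _ + X](eq_bigl (fun i : 'I_n.+2 => (0 < i)%N)); last by move=> i; rewrite lt0n.
rewrite -big_split /= t0.
apply: (@le_trans _ _ (\sum_(i < n.+2 | (0 < i)%N) 2^-1)).
  rewrite sumr_const -[leRHS]mulr_natl.
  rewrite (_ : #|_| = n.+1); first by rewrite mulrC.
  have := cardC (pred1 i0); rewrite card1 card_ord => -[cE].
  by apply: etrans cE; apply: eq_card => -[[|k] ki].
apply: ler_sum => i _; rewrite -subr_ge0.
have -> : (1 - t`_i) ^+ 2 + t`_i ^+ 2 - 2^-1 = 2 * (t`_i - 2^-1) ^+ 2 by field.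
by rewrite mulr_ge0// sqr_ge0.
Qed.

End unit_spread.

Section asymptotics.
Variables (R : realType) (la : nat -> seq nat) (m : nat -> nat).
Hypothesis hla : forall N, is_partition (la N).
Hypothesis hlam : forall N, (size (la N) < m N)%N.
Hypothesis hla1 : ((nth 0%N (la N) 0)%:R / (m N)%:R ^+ 3 : R) @[N --> \oo] --> +oo.

Local Notation L N := (nth 0%N (la N) 0).
Let X N := standardize (rank_var R (la N) (m N)).
Let t N := t_of_partition R (la N) (m N).
Let Dt N : R^nat := hat_dist (t N).
Let K N := size (distance_multiset (t N)).

Lemma unit_spread_t_of_partition : \forall N \near \oo, exists n,
  [/\ m N = n.+2, size (t N) = n.+2, (t N)`_0 = 1 & (t N)`_n.+1 = 0].
Proof.
near=> N; have [L0 mL] : (0 < L N)%N /\ (m N <= L N)%N by near: N; exact: (first_part_ge hlam hla1).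
have m2 : (1 < m N)%N by apply: leq_ltn_trans (hlam N); case: (la N) L0.
exists (m N).-2; have mN : m N = (m N).-2.+2 by case: (m N) m2 => [|[]].
split; [exact: mN|by rewrite size_t_of_partition -mN| |].
  by rewrite nth_t_of_partition ?(ltnW m2)// divff// pnatr_eq0 -lt0n.
rewrite nth_t_of_partition; last by rewrite [ltnRHS]mN.
by rewrite nth_default ?mul0r// -ltnS -mN.
Unshelve. all: by end_near. Qed.

Lemma power_sum2_cvg : \sum_(k < K N) Dt N k ^+ 2 @[N --> \oo] --> (12 : R).
Proof.
apply: (@cvg_trans _ ((12 : R) @[_ --> \oo])); last exact: cvg_cst.
apply: near_eq_cvg; near=> N.
have [L0 mL] : (0 < L N)%N /\ (m N <= L N)%N by near: N; exact: (first_part_ge hlam hla1).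
rewrite hat_dist_sum2//; first exact: sorted_t_of_partition.
exact: dist_sum2_gt0.
Unshelve. all: by end_near. Qed.

(** [b N] is eventually the largest rescaled distance. It tends to 0, and the power sum of order d +
    3 is at most 12 b^(d+1), where 12 is the sum of squares. *)
Lemma power_sum_cvg0 d : m @ \oo --> \oo ->
  \sum_(k < K N) Dt N k ^+ d.+3 @[N --> \oo] --> (0 : R).
Proof.
move=> moo; pose b N : R := Num.sqrt 12 / Num.sqrt (dist_sum (t N) 2).
have b0 : b N @[N --> \oo] --> (0 : R).
  apply/cvgrPdist_le => e e0.
  move/cvgnyPge : moo => moo; near=> N.
  have [n [mN tN tN0 tN1]] : exists n, [/\ m N = n.+2, size (t N) = n.+2, (t N)`_0 = 1 & (t N)`_n.+1 = 0].
    by near: N; exact: unit_spread_t_of_partition.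
  have ds := dist_sum2_ge tN tN0 tN1.
  have ds0 : 0 < dist_sum (t N) 2 by apply: lt_le_trans ds; rewrite divr_gt0.
  (* Here b^2 <= 24 / (m - 1), which is at most e^2 for these m. *)
  have mlarge : ((Num.trunc (24 / e ^+ 2)).+2 <= m N)%N by near: N; exact: moo.
  rewrite sub0r normrN ger0_norm ?divr_ge0 ?sqrtr_ge0// ler_pdivrMr ?sqrtr_gt0//.
  rewrite -[X in X * _](ger0_norm (ltW e0)) -sqrtr_sqr -sqrtrM ?sqr_ge0//.
  apply: ler_wsqrtr; rewrite mulrC -ler_pdivrMr ?exprn_gt0//.
  apply: le_trans ds; rewrite ler_pdivlMr// mulrAC (_ : 12 * 2 = 24); last by ring.
  have := truncnS_gt (24 / e ^+ 2) => /ltW /le_trans; apply.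
  by rewrite ler_nat -ltnS -mN.
apply: (@squeeze_cvgr _ _ _ _ (fun=> 0) (fun N => 12 * b N ^+ d.+1)).
- near=> N.
  have [n [mN tN tN0 tN1]] : exists n, [/\ m N = n.+2, size (t N) = n.+2, (t N)`_0 = 1 & (t N)`_n.+1 = 0].
    by near: N; exact: unit_spread_t_of_partition.
  have st := sorted_t_of_partition R (m N) (hla N).
  rewrite hat_dist_sum// -/(b N) mulr_ge0 ?dist_sum_ge0 ?exprn_ge0 ?divr_ge0 ?sqrtr_ge0//=.
  have ds := dist_sum2_ge tN tN0 tN1.
  have ds0 : 0 < dist_sum (t N) 2 by apply: lt_le_trans ds; rewrite divr_gt0.
  have <- : b N ^+ 2 * dist_sum (t N) 2 = 12.
    by rewrite expr_div_n !sqr_sqrtr// ?mulfVK ?gt_eqF// ltW.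
  have : 0 <= b N by rewrite divr_ge0 ?sqrtr_ge0.
  move: (b N) => c c0; rewrite (exprD c 2 d.+1) mulrAC ler_wpM2r ?exprn_ge0//.
  by rewrite ler_wpM2l ?exprn_ge0// (dist_sum_le2 st tN tN0 tN1).
- exact: cvg_cst.
- rewrite -[X in _ --> X](mulr0 12); apply: cvgM; first exact: cvg_cst.
  by rewrite -[X in _ --> X](expr0n R d.+1); apply: cvg_expn.
Unshelve. all: by end_near. Qed.

Lemma cvg_in_law_normal : m @ \oo --> \oo -> cvg_in_law X (@normal_prob R 0 1).
Proof.
move=> moo; apply/cvg_in_law_id_rv.
apply: (cdf_cvg_of_power_sums hla hlam hla1) => //; first exact: normal_exp_integrable.
  by rewrite cumulant_normal.
move=> [|[|[|d]]]// _; rewrite cumulant_normal.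
  rewrite [X in _ --> X](_ : _ = bernoulli R 2 / 2 * 12); last by rewrite bernoulli2 /=; field.
  by apply: cvgM; [exact: cvg_cst|exact: power_sum2_cvg].
rewrite -[X in _ --> X](mulr0 (bernoulli R d.+3 / d.+3%:R)).
apply: cvgM; [exact: cvg_cst|exact: power_sum_cvg0].
Qed.

(** If m stayed below A along an ultrafilter, the limit would be a uniform sum with vanishing fourth
    cumulant. As B_4 is not 0, all its widths would vanish, whereas their squares add up to 12. *)
Lemma normal_limit_unbounded : cvg_in_law X (@normal_prob R 0 1) -> m @ \oo --> \oo.
Proof.
move=> /cvg_in_law_id_rv Xn; apply/cvgnyPge => A; apply: contrapT => nA.
have [|G [GU Goo GA]] := @ultra_frequently [set N | (m N <= A)%N].
  apply: contra_not nA => h; near=> N; rewrite leqNgt; apply/negP => mA.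
  have : ~ (m N <= A)%N by near: N.
  by apply; exact: ltnW.
have [l hl] := hat_dist_ultra_cvg R m hla GU.
have [dp [T [P [S [uS cS XS]]]]] := limit_law hla hlam hla1 Goo GA hl.
have SZ : mgf S = mgf (@id_rv R : {RV (normal_prob 0 1) >-> R}) by exact: (mgf_eq_of_limits Goo XS Xn).
have c4 : cumulant 4 S = 0 by rewrite cumulantE SZ -cumulantE cumulant_normal.
have s2 : \sum_(k < A * A) l k ^+ 2 = 12 by exact: (limit_sum2 hla hlam hla1 Goo GA hl).
have [l0 _] := limit_multiset hla hl.
have s4 : \sum_(k < A * A) l k ^+ 4 = 0.
  move: c4; rewrite cS// => /eqP; rewrite mulf_eq0 => /orP[|/eqP//].
  by rewrite mulf_eq0 invr_eq0 pnatr_eq0 orbF (negbTE (bernoulli_even_neq0 R (k := 2) isT)).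
have l_eq0 (k : 'I_(A * A)) : l k = 0.
  have /eqP := s4; rewrite psumr_eq0 => [|i _]; last exact: exprn_ge0.
  by move=> /allP /(_ k (mem_index_enum _)) /=; rewrite expf_eq0 /= => /eqP.
have /eqP := s2; rewrite big1; last by move=> k _; rewrite l_eq0 expr0n.
by rewrite eq_sym pnatr_eq0.
Unshelve. all: by end_near. Qed.

Section bounded.
Variable M : nat.
Hypothesis mM : forall N, (m N <= M)%N.

(** Uniqueness of the ultrafilter limit forces convergence: a sequence staying away from the common
    limit infinitely often would have another ultrafilter limit. *)
Lemma hat_dist_cvg_of_law (nu : probability (measurableTypeR R) R) : cvg_in_law X nu ->
  exists l : R^nat, is_multiset l /\ forall k, Dt N k @[N --> \oo] --> l k.
Proof.
move=> /cvg_in_law_id_rv Xnu.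
have uniq_lim (F G : set_system nat) (l l' : R^nat) : UltraFilter F -> UltraFilter G ->
    F --> \oo -> G --> \oo ->
    (forall k, Dt N k @[N --> F] --> l k) -> (forall k, Dt N k @[N --> G] --> l' k) -> l = l'.
  move=> FU GU Foo Goo hl hl'.
  have FM : \forall N \near F, (m N <= M)%N by exact: nearW.
  have GM : \forall N \near G, (m N <= M)%N by exact: nearW.
  have [dp [T [P [S [_ cS XS]]]]] := limit_law hla hlam hla1 Foo FM hl.
  have [dp' [T' [P' [S' [_ cS' XS']]]]] := limit_law hla hlam hla1 Goo GM hl'.
  have SS' : mgf S = mgf S'.
    by rewrite (mgf_eq_of_limits Foo XS Xnu) (mgf_eq_of_limits Goo XS' Xnu).
  apply: (even_power_sums_inj (K := (M * M)%N)).
  - exact: limit_multiset hl.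
  - exact: limit_multiset hl'.
  - exact: limit_default FM hl.
  - exact: limit_default GM hl'.
  move=> j j0; have j2 : (2 <= j.*2)%N by rewrite -(leq_double 1) in j0.
  have : cumulant j.*2 S = cumulant j.*2 S' by rewrite !cumulantE SS'.
  rewrite cS// cS'//; apply: mulfI.
  by rewrite mulf_neq0 ?bernoulli_even_neq0// invr_eq0 pnatr_eq0 double_eq0 -lt0n.
have [G0 [G0U G0oo]] := ultraFilterLemma (eventually_filter : ProperFilter \oo).
have [l hl] := hat_dist_ultra_cvg R m hla G0U.
exists l; split; first exact: limit_multiset hl.
move=> k; apply/cvgrPdist_lt => e e0; apply: contrapT => nF.
have [|G [GU Goo GB]] := @ultra_frequently [set N | e <= `|l k - Dt N k|].
  apply: contra_not nF => h; near=> N; rewrite ltNge; apply/negP; near: N; exact: h.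
have [l' hl'] := hat_dist_ultra_cvg R m hla GU.
have ll' := uniq_lim _ _ _ _ G0U GU G0oo Goo hl hl'.
have /cvgrPdist_lt /(_ e e0) := hl' k; rewrite -ll' => lk.
have [N [/= h1 h2]] := filter_ex (filterI lk GB).
by move: h2; rewrite leNgt h1.
Unshelve. all: by end_near. Qed.

Lemma bounded_limit (l : R^nat) : (forall k, Dt N k @[N --> \oo] --> l k) ->
  (exists (dp : measure_display) (T : measurableType dp) (P : probability T R) (S : {RV P >-> R}),
     is_unif_sum l S /\ cvg_in_law X (distribution P S)) /\ P_DIST l.
Proof.
move=> hl; split.
  have ooM : \forall N \near \oo, (m N <= M)%N by exact: nearW.
  have [dp [T [P [S [uS _ XS]]]]] := limit_law hla hlam hla1 (fun A h => h) ooM hl.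
  by exists dp, T, P, S.
have [G [GU Goo]] := ultraFilterLemma (eventually_filter : ProperFilter \oo).
apply: (limit_P_DIST hla hlam hla1 GU Goo (M := M)); first exact: nearW.
by move=> k; apply: cvg_trans (hl k); exact: cvg_app.
Qed.

End bounded.
End asymptotics.

Theorem theorem4p5 (R : realType) (la : nat -> seq nat) (m : nat -> nat)
    (hla : forall N, is_partition (la N))
    (hm : forall N, (0 < m N)%N)
    (hlam : forall N, (size (la N) < m N)%N)
    (hn : ((sumn (la N))%:R / (m N)%:R : R) @[N --> \oo] --> +oo)
    (hla1 : ((nth 0%N (la N) 0)%:R / (m N)%:R ^+ 3 : R) @[N --> \oo] --> +oo) :
  let X N := standardize (rank_var R (la N) (m N)) in
  let Dt N : R^nat := hat_dist (t_of_partition R (la N) (m N)) in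
  let K d N : R := bernoulli R d / d%:R * fine (pnorm d%:R (Dt N)) ^+ d in
  [/\ forall d, (2 <= d)%N -> (fun N => cumulant d (X N) : R^o) ~_\oo (K d),
      forall N, exists (dp : measure_display) (T : measurableType dp)
          (P : probability T R) (S : {RV P >-> R}),
        is_unif_sum (Dt N) S /\
        forall d, (2 <= d)%N -> K d N = cumulant d S,
      (exists M, forall N, (m N <= M)%N) ->
        ((exists nu : probability (measurableTypeR R) R, cvg_in_law X nu) <->
         (exists t : R^nat, is_multiset t /\
            forall k, Dt N k @[N --> \oo] --> t k)) /\
        (forall t : R^nat, is_multiset t ->
           (forall k, Dt N k @[N --> \oo] --> t k) ->
           (exists (dp : measure_display) (T : measurableType dp)
               (P : probability T R) (S : {RV P >-> R}),
              is_unif_sum t S /\ cvg_in_law X (distribution P S)) /\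
           t \in @P_DIST R)
    & (m @ \oo --> \oo) <-> cvg_in_law X (@normal_prob R 0 1)].
Proof.
move=> X Dt K; split.
- by move=> d d2; exact: (cumulant_standardize_equiv hla hlam hla1).
- by move=> N; exact: unif_sum_of_hat_dist.
- move=> [M mM]; split; last first.
    move=> t mt ht; have [h1 h2] := bounded_limit hla hlam hla1 mM ht.
    by split=> //; rewrite inE.
  split=> [[nu Xnu]|[t [mt ht]]]; first exact: (hat_dist_cvg_of_law hla hlam hla1 mM Xnu).
  have [[dp [T [P [S [uS XS]]]]] _] := bounded_limit hla hlam hla1 mM ht.
  (* The limit law is asked for as a probability on [measurableTypeR R], hence this copy of the
     distribution of S. *)
  by exists (borel_law S).
- by split; [exact: cvg_in_law_normal|exact: normal_limit_unbounded].
Qed.
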